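(* Fix integers $k,t\ge0$ and a context-free grammar $G$ that is XLR($k,t$). Then there is an algorithm which, on every input string $x\in\Sigma^n$, runs in time $O(n)$ (the implied constant depending only on $G$, $k$ and $t$) and determines whether $x$ is generated by $G$, outputting a parse tree of $x$ if $x$ has exactly one parse tree (and reporting failure otherwise).
   Context: $G$ has finite nonterminal set $\Lambda$, terminal set $\Sigma$, $\Gamma=\Sigma\cup\{\dashv\}$ with $\dashv$ an end marker, and start symbol $S$. $\mathrm{First}_k(w)$ of a string $w=w_1\cdots w_r$ is $w_1\cdots w_{\min(k,r)}$. LR parse of a parse tree $P$: the sequence of operations obtained by a postorder traversal of $P$, where a leaf labeled by a terminal $\sigma$ contributes $\mathrm{Shift}(\sigma)$ and an internal node expanded by production $\Pi$ contributes $\mathrm{Reduce}(\Pi)$ (after its children). A partial LR parse of $x_1\cdots x_s\in\Sigma^*$ with lookahead $\lambda\in\Gamma^k$ is a sequence $\mathcal S_{\mathrm{part}}$ such that for some $x_{s+1}\cdots x_n\in\Sigma^*$ with $\lambda$ equal to the first $k$ symbols of $x_{s+1}\cdots x_n\dashv^k$, and some LR parse $\mathcal S$ of a parse tree of $x_1\cdots x_n$ with root $S$, $\mathcal S_{\mathrm{part}}$ is the longest prefix of $\mathcal S$ containing exactly $s$ Shift operations. $G$ is XLR($k,t$) if for every string $x\in\Sigma^*$ and every $\lambda\in\Gamma^k$, $x$ has at most $t$ distinct partial LR parses with lookahead $\lambda$. *)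

(* Defs.v *)
From mathcomp Require Import all_boot.
From Stdlib Require List.
Set Implicit Arguments. Unset Strict Implicit. Unset Printing Implicit Defensive.

Record cfg := CFG {
  Nt : finType;
  Tm : finType;
  start : Nt;
  prods : seq (Nt * seq (Nt + Tm)%type)%type
}.

Section Grammar.
Variable G : cfg.

Definition symbol := (Nt G + Tm G)%type.

Inductive ptree :=
| Leaf of Tm G
| Node of Nt G & seq ptree.

Definition root (P : ptree) : symbol :=
  match P with Leaf a => inr a | Node A _ => inl A end.

Fixpoint valid (P : ptree) : Prop :=
  match P with
  | Leaf _ => True
  | Node A cs =>
      List.In (A, map root cs) (prods G) /\
      (fix all_valid (l : seq ptree) : Prop :=
         match l with nil => True | c :: l' => valid c /\ all_valid l' end) cs
  end.

Fixpoint yield (P : ptree) : seq (Tm G) :=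
  match P with
  | Leaf a => [:: a]
  | Node _ cs => flatten (map yield cs)
  end.

Definition parse_tree_of (x : seq (Tm G)) (P : ptree) : Prop :=
  valid P /\ root P = inl (start G) /\ yield P = x.

Inductive lr_op :=
| Shift of Tm G
| Reduce of Nt G & seq symbol.

Definition is_shift (o : lr_op) : bool :=
  if o is Shift _ then true else false.

Fixpoint lr_parse (P : ptree) : seq lr_op :=
  match P with
  | Leaf a => [:: Shift a]
  | Node A cs => flatten (map lr_parse cs) ++ [:: Reduce A (map root cs)]
  end.

Definition longest_prefix_shifts (s : nat) (ops p : seq lr_op) : Prop :=
  (exists r, ops = p ++ r) /\ count is_shift p = s /\
  (forall p' r', ops = p' ++ r' -> count is_shift p' = s -> size p' <= size p).

(* Gamma = Sigma + {end marker}; we use option (Tm G), None = end marker. *)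
Definition partial_lr_parse (k : nat) (x : seq (Tm G)) (lam : seq (option (Tm G)))
    (Spart : seq lr_op) : Prop :=
  exists (y : seq (Tm G)) (P : ptree),
    lam = take k (map Some y ++ nseq k None) /\
    parse_tree_of (x ++ y) P /\
    longest_prefix_shifts (size x) (lr_parse P) Spart.

Definition XLR (k t : nat) : Prop :=
  forall (x : seq (Tm G)) (lam : seq (option (Tm G))), size lam = k ->
    exists L : seq (seq lr_op), size L <= t /\
      forall Spart, partial_lr_parse k x lam Spart -> List.In Spart L.

Fixpoint encode_tree (P : ptree) : seq nat :=
  match P with
  | Leaf a => [:: 0; nat_of_ord (enum_rank a)]
  | Node A cs => [:: 1; nat_of_ord (enum_rank A); size cs] ++ flatten (map encode_tree cs)
  end.

Definition encode_input (x : seq (Tm G)) : seq nat :=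
  map (fun a => nat_of_ord (enum_rank a)) x.

End Grammar.

Inductive instr :=
| IConst of nat & nat
| IAdd of nat & nat & nat
| ISub of nat & nat & nat
| ILoad of nat & nat
| IStore of nat & nat
| IJz of nat & nat
| IRead of nat                 (* IRead r : R[r] := 1 + next input symbol,
                                  or 0 if the input is exhausted              *)
| IWrite of nat
| IHalt.

Definition program := seq instr.

Record config := Config {
  pc : nat;
  mem : nat -> nat;
  inp : seq nat;
  outp : seq nat
}.

Definition upd (m : nat -> nat) (r v : nat) : nat -> nat :=
  fun i => if i == r then v else m i.

Definition halted (p : program) (c : config) : bool :=
  if nth IHalt p (pc c) is IHalt then true else false.

Definition step (p : program) (c : config) : config :=
  let m := mem c in
  let n := (pc c).+1 in
  match nth IHalt p (pc c) with
  | IConst r v => Config n (upd m r v) (inp c) (outp c)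
  | IAdd r a b => Config n (upd m r (m a + m b)) (inp c) (outp c)
  | ISub r a b => Config n (upd m r (m a - m b)) (inp c) (outp c)
  | ILoad r a => Config n (upd m r (m (m a))) (inp c) (outp c)
  | IStore a b => Config n (upd m (m a) (m b)) (inp c) (outp c)
  | IJz r l => Config (if m r == 0 then l else n) m (inp c) (outp c)
  | IRead r =>
      match inp c with
      | nil => Config n (upd m r 0) nil (outp c)
      | a :: rest => Config n (upd m r a.+1) rest (outp c)
      end
  | IWrite r => Config n m (inp c) (rcons (outp c) (m r))
  | IHalt => c
  end.

Definition init_config (input : seq nat) : config :=
  Config 0 (fun _ => 0) input nil.

(* [runs_within p input N acc uniq out]: started on [input], program [p]
   halts after at most N steps; in the final configuration register 0 holds
   the membership answer (nonzero = yes), register 1 holds the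
   "unique parse tree found" flag (nonzero = yes; zero = failure reported),
   and the output stream is [out]. *)
Definition runs_within (p : program) (input : seq nat) (N : nat)
    (acc uniq : bool) (out : seq nat) : Prop :=
  exists steps, steps <= N /\
    let c := iter steps (step p) (init_config input) in
    halted p c /\ (mem c 0 != 0) = acc /\ (mem c 1 != 0) = uniq /\ outp c = out.

(* Main.v *)
From HB Require Import structures.
Require Import Defs.
From mathcomp Require Import all_boot.
From mathcomp Require Import boolp zify.
From Stdlib Require List.
Set Implicit Arguments. Unset Strict Implicit. Unset Printing Implicit Defensive.

(* A partial LR parse is the same thing as a forest, namely a stack of complete parse trees, so XLR(k, t)
   bounds by [t] the number of live stacks in front of each input symbol. The algorithm keeps all of them,
   as linked stacks sharing their tails, and replaces each by its successors when it reads a symbol.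

   A chain of reductions may pop an unbounded part of a stack and then die, over and over again. As in Leo's
   treatment of right recursion, each stack node therefore memoizes, for every symbol [X] and lookahead, the
   outcomes of pushing [X] on it and reducing until the next shift. By XLR there are at most [t] of
   them, an outcome is computed in constant time from those of the parent node, and which computation has to be
   done depends on a finite state only: the valid LR(k + 1) items together with the number of outcomes
   of each kind. An outcome records the surrounding tree lazily, as a list of frames.

   When the parse tree is unique it has linear size, since collapsing empty subtrees and unary chains
   shows that some parse tree does; it is then expanded from the frames and written out. *)

(** The XLR bound counts stacks, so it limits the number of outcomes only if distinct outcomes give
    distinct stacks. Trees with empty yield endanger this, since they can be inserted without
    reading anything. The remedy is to cut every forest at its last tree with nonempty yield, which
    is a canonical place. Hence a chain of reductions always carries a tree of nonempty yield, and
    pushed symbols are required to be [fruitful]. The lookahead has length k + 1 because a positive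
    length shows whether a shift is pending or the input has ended. A reduction pops several nodes,
    whereas a slot may refer to the parent node only. Therefore a reduction in progress is itself a
    key: it lists the symbols still to be popped. Only the existence of a program is claimed. Item
    sets, outcome tables and size constants are obtained by classical choice and are built into the
    finite control. Apart from two loops all code is loop-free; one loop runs once per input symbol,
    the other is charged to the size of the written tree. *)

HB.instance Definition _ (G : cfg) := gen_eqMixin (ptree G).
HB.instance Definition _ (G : cfg) := gen_eqMixin (lr_op G).

Lemma InE (T : eqType) (x : T) s : List.In x s <-> x \in s.
Proof.
elim: s => [|y s IH] //=; rewrite inE; split.
  by case=> [->|/IH ->]; rewrite ?eqxx ?orbT.
by case/orP=> [/eqP ->|/IH]; [left | right].
Qed.

(** * Forests and LR parses *)

Section Grammar.
Variable G : cfg.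
Local Notation tree := (ptree G).
Local Notation sym := (Nt G + Tm G)%type.
Local Notation rt := (@Defs.root G).
Local Notation str := (seq (Tm G)).
Implicit Types (T : tree) (cs g st : seq tree) (al : seq sym) (y z w : str).

Lemma ptree_nested_ind (P : tree -> Prop) :
  (forall a, P (Leaf a)) ->
  (forall A cs, (forall c, c \in cs -> P c) -> P (Node A cs)) -> forall T, P T.
Proof.
move=> hl hn; fix IH 1; case=> [a|A cs]; first exact: hl.
apply: hn; have: List.Forall P cs.
  by elim: cs => [|c cs IHcs]; constructor; [exact: IH | exact: IHcs].
by move/List.Forall_forall=> h c /InE /h.
Qed.

Fixpoint vall cs : Prop :=
  match cs with nil => True | c :: cs' => valid c /\ vall cs' end.

Lemma valid_node A cs :
  valid (Node A cs) = (List.In (A, map rt cs) (prods G) /\ vall cs).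
Proof. by []. Qed.

Lemma vall_cat cs1 cs2 : vall (cs1 ++ cs2) <-> vall cs1 /\ vall cs2.
Proof. by elim: cs1 => [|c cs1 IH] /=; tauto. Qed.

Lemma vall_rev cs : vall (rev cs) <-> vall cs.
Proof.
elim: cs => [|c cs IH] //; rewrite rev_cons -cats1 vall_cat /=; tauto.
Qed.

Lemma vall_in cs T : vall cs -> T \in cs -> valid T.
Proof.
by elim: cs => [|c cs IH] //= [vc vcs]; rewrite inE => /predU1P [->|/IH]; auto.
Qed.

(* A stack is the list of its trees, top first. *)
Definition syield st : str := flatten (map (@yield G) (rev st)).
Definition sops st := flatten (map (@lr_parse G) (rev st)).
Local Notation roots := (map rt).

Lemma syield_cons T st : syield (T :: st) = syield st ++ yield T.
Proof. by rewrite /syield rev_cons -cats1 map_cat flatten_cat /= cats0. Qed.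

Lemma syield_rev cs st : syield (rev cs ++ st) = syield st ++ flatten (map (@yield G) cs).
Proof. by rewrite /syield rev_cat revK map_cat flatten_cat. Qed.

Lemma sops_cons T st : sops (T :: st) = sops st ++ lr_parse T.
Proof. by rewrite /sops rev_cons -cats1 map_cat flatten_cat /= cats0. Qed.

Lemma sops_rev cs st : sops (rev cs ++ st) = sops st ++ flatten (map (@lr_parse G) cs).
Proof. by rewrite /sops rev_cat revK map_cat flatten_cat. Qed.

Definition run_op st (o : lr_op G) : seq tree :=
  match o with
  | Shift a => Leaf a :: st
  | Reduce A be => Node A (rev (take (size be) st)) :: drop (size be) st
  end.

(** Executing the operations on a stack of trees gives a left inverse of [lr_parse]. It makes [sops]
    injective, so distinct stacks count as distinct partial parses. *)
Lemma run_lr_parse T st : foldl run_op st (lr_parse T) = T :: st.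
Proof.
elim/ptree_nested_ind: T st => [a|A cs IH] st //=.
rewrite foldl_cat.
have -> : foldl run_op st (flatten (map (@lr_parse G) cs)) = rev cs ++ st.
  elim: cs st IH => [|c cs IHcs] st IH //=.
  rewrite foldl_cat IH ?mem_head // IHcs ?rev_cons ?cat_rcons //.
  by move=> d dcs; apply: IH; rewrite inE dcs orbT.
by rewrite /= size_map -(size_rev cs) take_size_cat // drop_size_cat // revK.
Qed.

Lemma sops_inj : injective sops.
Proof.
have runE st : foldl run_op [::] (sops st) = st.
  elim: st => [|T st IH] //; by rewrite sops_cons foldl_cat IH run_lr_parse.
by move=> s1 s2 e; rewrite -(runE s1) e runE.
Qed.

Lemma count_shift_lr_parse T : count (@is_shift G) (lr_parse T) = size (yield T).
Proof.
elim/ptree_nested_ind: T => [a|A cs IH] //=.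
rewrite count_cat /= !addn0.
elim: cs IH => [|c cs IHcs] IH //.
rewrite [LHS]/= [RHS]/=.
rewrite count_cat size_cat IH ?mem_head // IHcs //.
by move=> d dcs; apply: IH; rewrite inE dcs orbT.
Qed.

Lemma count_shift_sops st : count (@is_shift G) (sops st) = size (syield st).
Proof.
elim: st => [|T st IH] //.
by rewrite sops_cons syield_cons count_cat size_cat IH count_shift_lr_parse.
Qed.

(* [accepts al y]: from the stack [al] (top first) an LR machine can accept the remaining input [y]. *)
Inductive accepts : seq sym -> str -> Prop :=
| accepts_done : accepts [:: inl (start G)] [::]
| accepts_shift al a y : accepts (inr a :: al) y -> accepts al (a :: y)
| accepts_reduce al A be y : List.In (A, be) (prods G) ->
    accepts (inl A :: al) y -> accepts (rev be ++ al) y.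

Lemma accepts_tree T al y : valid T -> accepts (rt T :: al) y -> accepts al (yield T ++ y).
Proof.
elim/ptree_nested_ind: T al y => [a|A cs IH] al y; first by move=> _ /accepts_shift.
rewrite valid_node /= => -[inA vcs] /(accepts_reduce inA).
elim/last_ind: cs y IH vcs {inA} => [|cs c IHcs] y IH vcs //=.
have [vcs' [vc _]] : vall cs /\ vall [:: c] by move: vcs; rewrite -cats1 vall_cat.
rewrite map_rcons rev_rcons /= map_rcons flatten_rcons -catA => h.
apply: IHcs => // [d dcs|]; first by apply: IH; rewrite mem_rcons inE dcs orbT.
by apply: IH => //; rewrite mem_rcons mem_head.
Qed.

Lemma accepts_forest cs al y : vall cs ->
  accepts (rev (map rt cs) ++ al) y -> accepts al (flatten (map (@yield G) cs) ++ y).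
Proof.
elim/last_ind: cs y => [|cs c IHcs] y vcs //=.
have [vcs' [vc _]] : vall cs /\ vall [:: c] by move: vcs; rewrite -cats1 vall_cat.
rewrite map_rcons rev_rcons /= map_rcons flatten_rcons -catA => h.
by apply: IHcs => //; apply: accepts_tree.
Qed.

(** The accepting run on symbols is replayed on the trees of [st]: a shift pushes a leaf, a
    reduction gathers the topmost trees under a new node. *)
Lemma accepts_complete al y : accepts al y -> forall st, vall st -> roots st = al ->
  exists P r, [/\ valid P, rt P = inl (start G), yield P = syield st ++ y &
                  lr_parse P = sops st ++ r].
Proof.
elim=> {al y} [|al a y h IH|al A be y inA h IH] st vst rst.
- case: st vst rst => [|T [|T' st]] //= [vT _] [rT].
  by exists T, [::]; split=> //; rewrite ?syield_cons ?sops_cons !cats0.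
- have [||P [r [vP rP yP lP]]] := IH (Leaf a :: st); [by []|by rewrite /= rst|].
  exists P, (Shift a :: r); split=> //.
    by rewrite yP syield_cons /= cats1 cat_rcons.
  by rewrite lP sops_cons /= cats1 cat_rcons.
- pose cs := rev (take (size be) st); pose st' := drop (size be) st.
  have est : st = rev cs ++ st' by rewrite revK cat_take_drop.
  have sz : size be <= size st by rewrite -(size_map rt) rst size_cat size_rev leq_addr.
  have rcs : map rt cs = be.
    by rewrite map_rev map_take rst take_size_cat ?revK ?size_rev.
  have rst' : roots st' = al.
    by rewrite map_drop rst drop_size_cat ?size_rev.
  have [vcs vst'] : vall cs /\ vall st'.
    by move: vst; rewrite {1}est vall_cat vall_rev.
  have [||P [r [vP rP yP lP]]] := IH (Node A cs :: st').
  + by split=> //; rewrite valid_node rcs.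
  + by rewrite /= rst'.
  exists P, (Reduce A be :: r); split=> //.
    by rewrite yP syield_cons -syield_rev -est.
  by rewrite lP sops_cons /= catA -sops_rev -est rcs -catA.
Qed.

(** * Lookaheads and the XLR bound on live stacks *)

Definition la K (y : str) : seq (option (Tm G)) := take K (map Some y ++ nseq K None).

Lemma take_cat_take (E : Type) K m (u v : seq E) : K <= m -> take K (u ++ take m v) = take K (u ++ v).
Proof.
elim: u K m => [|a u IH] K m le /=; first by rewrite take_takel.
by case: K le => [|K] //= le; rewrite IH 1?ltnW.
Qed.

Lemma size_la K y : size (la K y) = K.
Proof. by rewrite size_takel // size_cat size_nseq leq_addl. Qed.

Lemma take_pad (E : Type) K m (s : seq E) e : K <= m -> take K (s ++ nseq m e) = take K (s ++ nseq K e).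
Proof.
have tn p q : p <= q -> take p (nseq q e) = nseq p e.
  by elim: p q => [|p IH] [|q] //= le; rewrite IH.
elim: s K m => [|b s IH] K m le; first by rewrite /= !tn.
case: K le => [|K] //= le.
by congr cons; rewrite IH 1?ltnW // -[e :: nseq K e]/(nseq K.+1 e) [RHS]IH.
Qed.

Lemma la_cat K (w : seq (Tm G)) y : la K (w ++ y) = take K (map Some w ++ la K y).
Proof. by rewrite /la take_cat_take // map_cat catA. Qed.

Lemma la_cons K a y y' : la K y = la K y' -> la K (a :: y) = la K (a :: y').
Proof. by move=> e; rewrite -(cat1s a y) -(cat1s a y') !la_cat e. Qed.

Lemma la_nseq K : la K [::] = nseq K None.
Proof. by rewrite /la take_oversize ?size_nseq. Qed.

(* Liveness just before a shift, or at the end of the parse. *)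
Definition shift_live K (al : seq sym) (lam : seq (option (Tm G))) : Prop :=
  (al = [:: inl (start G)] /\ lam = nseq K None) \/
  exists a y, la K (a :: y) = lam /\ accepts (inr a :: al) y.

Lemma shift_live_partial K st lam : vall st -> shift_live K (roots st) lam ->
  partial_lr_parse K (syield st) lam (sops st).
Proof.
move=> vst live.
have [y [P [r [lamE [vP rP yP lP] rE]]]] : exists y P r, [/\ lam = la K y,
  [/\ valid P, rt P = inl (start G), yield P = syield st ++ y & lr_parse P = sops st ++ r]
  & r = [::] \/ exists a r', r = Shift a :: r'].
  case: live => [[rst ->]|[a [y [<- acc]]]].
    case: st vst rst => [|T [|T' st]] //= [vT _] [rT].
    exists [::], T, [::]; split; [by rewrite la_nseq| |by left].
    by split; rewrite ?syield_cons ?sops_cons ?cats0.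
  have [||P [r [vP rP yP lP]]] := accepts_complete acc (st := Leaf a :: st); [by []|by []|].
  exists (a :: y), P, (Shift a :: r); split=> //; last by right; exists a, r.
  split=> //; first by rewrite yP syield_cons /= cats1 cat_rcons.
  by rewrite lP sops_cons /= cats1 cat_rcons.
exists y, P; split=> //; split; first by [].
rewrite lP; split; first by exists r.
split; first exact: count_shift_sops.
(* A longer prefix would contain the operation that follows [sops st]. That operation is a shift,
   which raises the count, or does not exist because the parse is over. *)
move=> p' r' e cp'; rewrite leqNgt; apply/negP => lt.
have e1 : p' = sops st ++ drop (size (sops st)) p'.
  have : take (size (sops st)) (p' ++ r') = sops st by rewrite -e take_size_cat.
  by rewrite take_cat lt => {1}<-; rewrite cat_take_drop.
have : drop (size (sops st)) (sops st ++ r) = drop (size (sops st)) (p' ++ r') by rewrite e.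
rewrite drop_size_cat // drop_cat lt.
have : size (drop (size (sops st)) p') > 0 by rewrite size_drop subn_gt0.
move: e1 cp'; case: (drop _ _) => [|o p2] // -> + _.
rewrite count_cat count_shift_sops /= => cp2.
case: rE => [->|[a [r2 ->]]] // [eo _]; move: cp2; rewrite -eo /=.
by move/eqP; rewrite -{2}[size _]addn0 eqn_add2l.
Qed.

(** Apart from the change of lookahead length in [XLR_succ], this is the only place where the
    hypothesis [XLR] is unfolded; all bounds by [t] come from here. *)
Lemma shift_live_bound K t x lam (L : seq (seq tree)) : XLR G K t -> size lam = K ->
  uniq L -> (forall st, st \in L -> [/\ vall st, syield st = x & shift_live K (roots st) lam]) ->
  size L <= t.
Proof.
move=> xlr sz uL HL; have [L' [sL' subL']] := xlr x lam sz.
apply: leq_trans sL'; rewrite -(size_map sops L); apply: uniq_leq_size.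
  by rewrite map_inj_uniq //; exact: sops_inj.
move=> _ /mapP [st /HL [vst yst live] ->]; apply/InE/subL'; rewrite -yst; exact: shift_live_partial.
Qed.

(** A longer lookahead only splits the sets of partial parses into smaller ones. *)
Lemma XLR_succ k t : XLR G k t -> XLR G k.+1 t.
Proof.
move=> xlr x lam sz; have [|L [sL HL]] := xlr x (take k lam).
  by rewrite size_takel // sz.
exists L; split=> // p [y [P [lamE [ptP lpP]]]]; apply: HL; exists y, P; split=> //.
by rewrite lamE take_takel // take_pad.
Qed.

(* The frame [(A, be, g)] turns a tree [T] on the stack [rev cs ++ st] into
   [Node A (cs ++ T :: g)] on [st], where [be] lists the roots of [rev cs] and the trees of [g] have empty yield. *)
Definition frame := (Nt G * seq sym * seq tree)%type.
Implicit Types (f : frame) (fs : seq frame).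
Definition fbe f : seq sym := f.1.2.

Definition apply_frame (c : seq tree * tree) f : seq tree * tree :=
  (drop (size (fbe f)) c.1, Node f.1.1 (rev (take (size (fbe f)) c.1) ++ c.2 :: f.2)).
Definition apply_frames st T fs := foldl apply_frame (st, T) fs.

Definition eps g : Prop := vall g /\ flatten (map (@yield G) g) = [::].

Definition frame_ok (X : sym) f : Prop :=
  List.In (f.1.1, rev (fbe f) ++ X :: map rt f.2) (prods G) /\ eps f.2.

(** The trace of [apply_frame] on root symbols: whether frames fit a stack, and where they lead, can
    be decided without knowing the trees. *)
Definition frame_tgt (c : seq sym * sym) f : seq sym * sym :=
  (drop (size (fbe f)) c.1, inl f.1.1).
Definition frames_tgt al X fs := foldl frame_tgt (al, X) fs.

Fixpoint frames_ok al X fs : Prop :=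
  if fs is f :: fs' then
    [/\ frame_ok X f, prefix (fbe f) al & frames_ok (drop (size (fbe f)) al) (inl f.1.1) fs']
  else True.

Lemma frames_ok_cat al X fs1 fs2 : frames_ok al X (fs1 ++ fs2) <->
  frames_ok al X fs1 /\ (let c := frames_tgt al X fs1 in frames_ok c.1 c.2 fs2).
Proof.
elim: fs1 al X => [|f fs1 IH] al X /=; first by tauto.
rewrite /frames_tgt /= -/(frames_tgt _ _ _) /=; split.
  by case=> ? ? /IH [? ?].
by case=> [[? ? ?] ?]; split=> //; apply/IH.
Qed.

Lemma prefix_take (T : eqType) (s1 s2 : seq T) : prefix s1 s2 -> take (size s1) s2 = s1.
Proof. by case/prefixP => s ->; rewrite take_size_cat. Qed.

Lemma apply_frames_spec st T fs : vall st -> valid T -> frames_ok (roots st) (rt T) fs ->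
  let c := apply_frames st T fs in
  [/\ vall c.1, valid c.2, (roots c.1, rt c.2) = frames_tgt (roots st) (rt T) fs
    & syield (c.2 :: c.1) = syield (T :: st)].
Proof.
elim: fs st T => [|f fs IH] st T vst vT /=; first by [].
case=> [[inf [vg yg]] pre ok].
rewrite /apply_frames /= -/(apply_frames _ _ _) /frames_tgt /= -/(frames_tgt _ _ _).
set b := size (fbe f) in ok *.
have rtk : roots (take b st) = fbe f by rewrite map_take prefix_take.
have [vt vd] : vall (take b st) /\ vall (drop b st) by rewrite -vall_cat cat_take_drop.
have [|||v1 v2 e y] := IH (drop b st) (Node f.1.1 (rev (take b st) ++ T :: f.2)) => //.
- rewrite valid_node vall_cat vall_rev /= map_cat map_rev rtk; tauto.
- by rewrite map_drop.
split=> //; first by rewrite e map_drop.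
rewrite y !syield_cons /= map_cat flatten_cat /= yg cats0 catA.
by rewrite -{3}(cat_take_drop b st) -{2}(revK (take b st)) syield_rev.
Qed.

End Grammar.

(** * Right spines *)

Section Spine.
Variable G : cfg.
Local Notation tree := (ptree G).
Local Notation sym := (Nt G + Tm G)%type.
Local Notation rt := (@Defs.root G).
Local Notation roots := (map rt).
Local Notation yields cs := (flatten (map (@yield G) cs)).
Implicit Types (T : tree) (cs g st : seq tree) (al : seq sym) (f : frame G) (fs : seq (frame G)).

Lemma last_nonempty cs : yields cs <> [::] ->
  exists cs1 T g, [/\ cs = cs1 ++ T :: g, yield T <> [::] & yields g = [::]].
Proof.
elim/last_ind: cs => [|cs T IH] //.
case: (altP (yield T =P [::])) => [e|/eqP ne _].
  rewrite map_rcons flatten_rcons e cats0 => /IH [cs1 [T1 [g [-> ? yg]]]].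
  exists cs1, T1, (rcons g T); split=> //; first by rewrite rcons_cat.
  by rewrite map_rcons flatten_rcons e yg.
by exists cs, T, [::]; rewrite cats1.
Qed.

(** The uniqueness on which all later injectivity rests: whatever empty trees surround it, the last
    tree with nonempty yield has a definite position. *)
Lemma last_nonempty_inj cs T g cs' T' g' : cs ++ T :: g = cs' ++ T' :: g' ->
  yield T <> [::] -> yield T' <> [::] -> yields g = [::] -> yields g' = [::] ->
  [/\ cs = cs', T = T' & g = g'].
Proof.
move=> + yT yT'; elim/last_ind: g g' => [|g U IH] g'; case/lastP: g' => [|g' U'].
- by rewrite !cats1 => /rcons_inj [-> ->].
- rewrite -rcons_cons -rcons_cat cats1 => /rcons_inj [_ <-] _.
  by rewrite map_rcons flatten_rcons; case: (yields g') => //=.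
- rewrite -rcons_cons -rcons_cat cats1 => /rcons_inj [_ ->].
  by rewrite map_rcons flatten_rcons; case: (yields g) => //=.
rewrite -!rcons_cons -!rcons_cat => /rcons_inj [e ->].
rewrite !map_rcons !flatten_rcons => y y'.
have cat0 (u v : seq (Tm G)) : u ++ v = [::] -> u = [::] by case: u.
by have [-> -> ->] := IH _ e (cat0 _ _ y) (cat0 _ _ y').
Qed.

Lemma apply_frames_rcons st T fs f :
  apply_frames st T (rcons fs f) = apply_frame (apply_frames st T fs) f.
Proof. by rewrite /apply_frames -cats1 foldl_cat. Qed.

Lemma apply_frames_yield st T fs : yield T <> [::] -> yield (apply_frames st T fs).2 <> [::].
Proof.
move=> nT; elim/last_ind: fs => [|fs f IH] //; rewrite apply_frames_rcons /= map_cat flatten_cat /=.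
by case: (yields _) => //=; case: (yield _) IH.
Qed.

Fixpoint tsize T : nat := match T with Leaf _ => 1 | Node _ cs => (sumn (map tsize cs)).+1 end.

(** Every frame adds a node. Hence no nonempty list of frames leads from a tree back to itself,
    which [paths_bound] needs in order to exclude cyclic derivations. *)
Lemma apply_frames_size st T fs : tsize T + size fs <= tsize (apply_frames st T fs).2.
Proof.
elim/last_ind: fs => [|fs f IH]; first by rewrite addn0.
rewrite apply_frames_rcons /= size_rcons addnS ltnS map_cat sumn_cat /=.
by apply: leq_trans IH _; rewrite addnCA leq_addr.
Qed.

(** Frames can be peeled off from the outside: the child at which the outermost node was extended is
    its last child with nonempty yield, and this determines the frame. The process stops when the
    shorter list is used up, so that list is a suffix of the other. *)
Lemma apply_frames_inj st T fs st2 T2 fs2 :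
  vall st -> valid T -> vall st2 -> valid T2 -> yield T <> [::] -> yield T2 <> [::] ->
  frames_ok (roots st) (rt T) fs -> frames_ok (roots st2) (rt T2) fs2 ->
  apply_frames st T fs = apply_frames st2 T2 fs2 ->
  (exists2 fs3, fs2 = fs3 ++ fs & apply_frames st2 T2 fs3 = (st, T)) \/
  (exists2 fs3, fs = fs3 ++ fs2 & apply_frames st T fs3 = (st2, T2)).
Proof.
move=> vst vT vst2 vT2 nT nT2.
elim/last_ind: fs fs2 => [|fs f IH] fs2.
  by move=> _ _ e; left; exists fs2; rewrite ?cats0 // -e.
case/lastP: fs2 => [|fs2 f2]; first by move=> _ _ e; right; exists (rcons fs f); rewrite ?cats0.
rewrite -!cats1 => /frames_ok_cat [ok1] + /frames_ok_cat [ok2].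
have := apply_frames_spec vst vT ok1; have := apply_frames_spec vst2 vT2 ok2.
rewrite !cats1 !apply_frames_rcons.
have := @apply_frames_yield st T fs nT; have := @apply_frames_yield st2 T2 fs2 nT2.
move e1: (apply_frames st T fs) => [s1 U1]; move e2: (apply_frames st2 T2 fs2) => [s2 U2].
move=> /= n2 n1 [_ _ <- _] [_ _ <- _] /= [[_ [_ yg1]] p1 _] [[_ [_ yg2]] p2 _].
move=> [ed eA er].
have [et eU eg] := last_nonempty_inj er n1 n2 yg1 yg2.
have et' : take (size (fbe f)) s1 = take (size (fbe f2)) s2 by apply: (can_inj revK).
have es : s1 = s2 by rewrite -(cat_take_drop (size (fbe f)) s1) et' ed cat_take_drop.
have ef : f = f2.
  have : fbe f = fbe f2 by rewrite -(prefix_take p1) -(prefix_take p2) -!map_take et'.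
  by move: eA eg; case: (f) => [[? ?] ?]; case: (f2) => [[? ?] ?]; rewrite /fbe /= => -> -> ->.
have [|[fs3 -> e3]|[fs3 -> e3]] := IH fs2 ok1 ok2; first by rewrite e1 e2 es eU.
  by left; exists fs3; rewrite // ef rcons_cat.
by right; exists fs3; rewrite // ef rcons_cat.
Qed.

Lemma frames_accepts al X fs g y : frames_ok al X fs -> eps g ->
  let c := frames_tgt al X fs in accepts (rev (map rt g) ++ c.2 :: c.1) y -> accepts (X :: al) y.
Proof.
move=> ok [vg yg] /= /(accepts_forest vg); rewrite yg /=.
elim: fs al X ok => [|f fs IH] al X //= [[inf [vf yf]] pre ok] /(IH _ _ ok) h.
have := accepts_reduce inf h; rewrite rev_cat rev_cons revK cat_rcons -!catA /=.
have -> : fbe f ++ drop (size (fbe f)) al = al by rewrite -{2}(cat_take_drop (size (fbe f)) al) prefix_take.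
by move/(accepts_forest vf); rewrite yf.
Qed.

(** The frames are read off the path from the last leaf up to the root. At each node on it the left
    siblings go to the stack, and the right siblings have empty yield because the leaf is the last
    one. This gives completeness: each live stack after a shift comes from a stack before it. *)
Lemma right_spine T : valid T -> forall w a, yield T = rcons w a -> forall st, vall st ->
  exists st0 fs, [/\ vall st0, apply_frames st0 (Leaf a) fs = (st, T),
    syield st0 = syield st ++ w & frames_ok (roots st0) (inr a) fs].
Proof.
elim/ptree_nested_ind: T => [b|A cs IH].
  move=> _ w a /=; rewrite -[[:: b]]/(rcons [::] b) => /rcons_inj [<- <-] st vst.
  by exists st, [::]; rewrite cats0.
rewrite valid_node => -[inA vcs] w a yE st vst.
have [|cs1 [T [g [ecs nT yg]]]] := @last_nonempty cs; first by rewrite -[yields cs]/(yield (Node A cs)) yE; case: (w).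
have [vcs1 [vT vg]] : vall cs1 /\ vall (T :: g) by rewrite -vall_cat -ecs.
have [w' yT] : exists w', yield T = rcons w' a.
  move: yE nT; rewrite /= ecs map_cat flatten_cat /= yg cats0; case/lastP: (yield T) => // w' b.
  by rewrite -rcons_cat => /rcons_inj [_ ->] _; exists w'.
have [||st0 [fs [vst0 e ye ok]]] := IH T _ vT _ _ yT (rev cs1 ++ st).
- by rewrite ecs mem_cat mem_head orbT.
- by rewrite vall_cat vall_rev.
have eb : size (rev (map rt cs1)) = size (rev cs1) by rewrite !size_rev size_map.
exists st0, (rcons fs (A, rev (map rt cs1), g)); split=> //.
- rewrite apply_frames_rcons e /apply_frame /= /fbe /= eb drop_size_cat // take_size_cat //.
  by rewrite revK ecs.
- rewrite ye syield_rev -catA; congr cat.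
  move: yE; rewrite /= ecs map_cat flatten_cat /= yg cats0 yT -rcons_cat.
  by move/rcons_inj => [->].
have [_ _ + _] := apply_frames_spec (T := Leaf a) vst0 I ok; rewrite e => te.
rewrite -cats1; apply/frames_ok_cat; split=> //; rewrite -te /=; split=> //.
by split=> //; rewrite /fbe /= revK; move: inA; rewrite ecs map_cat.
by rewrite map_cat -map_rev; exact: prefix_prefix.
Qed.

End Spine.

(** * Valid items and liveness *)

Section Viable.
Variables (G : cfg) (k : nat).
Local Notation K := k.+1.
Local Notation tree := (ptree G).
Local Notation sym := (Nt G + Tm G)%type.
Local Notation rt := (@Defs.root G).
Local Notation roots := (map rt).
Local Notation yields cs := (flatten (map (@yield G) cs)).
Implicit Types (T : tree) (cs g st : seq tree) (al ga be : seq sym) (mu lam : seq (option (Tm G))).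

(* [follow al ga mu]: some LR(K) item with [ga] after its dot and lookahead [mu] is valid for the stack [al]. *)
Inductive follow : seq sym -> seq sym -> seq (option (Tm G)) -> Prop :=
| follow_start : follow [::] [:: inl (start G)] (nseq K None)
| follow_step al X ga mu : follow al (X :: ga) mu -> follow (X :: al) ga mu
| follow_predict al B ga mu be cs : follow al (inl B :: ga) mu ->
    List.In (B, be) (prods G) -> vall cs -> roots cs = ga ->
    follow al be (take K (map Some (yields cs) ++ mu)).

Definition viable al lam := exists y, la K y = lam /\ accepts al y.

Lemma follow_sound al ga mu : follow al ga mu ->
  exists y, la K y = mu /\ accepts (rev ga ++ al) y.
Proof.
elim=> {al ga mu} [|al X ga mu _ [y [e h]]|al B ga mu be cs _ [y [e h]] inB vcs rcs].
- by exists [::]; split; [exact: la_nseq | exact: accepts_done].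
- by exists y; rewrite -cat_rcons -rev_cons.
exists (yields cs ++ y); split; first by rewrite la_cat e.
apply: accepts_reduce inB _; apply: accepts_forest => //.
by rewrite rcs -cat_rcons -rev_cons.
Qed.

(** Undoes the predictions made since [X] was pushed and then the step over [X] itself. The trees
    that follow are collected on the way, so that the lookahead stays the same. *)
Lemma follow_pop al' ga mu : follow al' ga mu -> forall X al, al' = X :: al ->
  forall cs, vall cs -> roots cs = ga -> exists ga' mu' cs',
  [/\ follow al (X :: ga') mu', vall cs', roots cs' = ga' &
      take K (map Some (yields cs) ++ mu) = take K (map Some (yields cs') ++ mu')].
Proof.
elim=> {al' ga mu} [|al Y ga mu h _|al B ga mu be cs h IH inB vcs rcs] X al0 //.
  by case=> <- <- cs vcs rcs; exists ga, mu, cs.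
move=> e ds vds rds; have [||ga' [mu' [cs' [f' v' r' t']]]] := IH _ _ e (Node B ds :: cs).
- by split=> //; rewrite valid_node rds.
- by rewrite /= rcs.
exists ga', mu', cs'; split=> //; rewrite -t' /= take_cat_take //.
by rewrite map_cat catA.
Qed.

(** The run is followed backwards from acceptance, where the initial item is valid. [follow_pop]
    undoes the push made by each step; for a reduction, its production is then predicted and its
    right-hand side traversed. *)
Lemma follow_complete al y : accepts al y -> exists ga mu cs,
  [/\ follow al ga mu, vall cs, roots cs = ga & la K y = take K (map Some (yields cs) ++ mu)].
Proof.
elim=> {al y} [|al a y _ [ga [mu [cs [f v r e]]]]|al A be y inA _ [ga [mu [cs [f v r e]]]]].
- exists [::], (nseq K None), [::]; split=> //.
  exact: (follow_step (follow_start)).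
- have [ga' [mu' [cs' [f' v' r' t']]]] := follow_pop f erefl v r.
  exists (inr a :: ga'), mu', (Leaf a :: cs'); split=> //; first by rewrite /= r'.
  by rewrite -cat1s la_cat e t' take_cat_take // map_cat catA.
have [ga' [mu' [cs' [f' v' r' t']]]] := follow_pop f erefl v r.
exists [::], (take K (map Some (yields cs') ++ mu')), [::]; split=> //.
  have := follow_predict f' inA v' r'.
  elim: be al {inA f f'} => [|X be IH] al //= /follow_step /IH.
  by rewrite rev_cons cat_rcons.
by rewrite e t' /= [RHS]take_takel.
Qed.

Lemma viable_follow al lam : viable al lam <-> exists ga mu cs,
  [/\ follow al ga mu, vall cs, roots cs = ga & lam = take K (map Some (yields cs) ++ mu)].
Proof.
split=> [[y [<- /follow_complete]] //|[ga [mu [cs [/follow_sound [y [<- h]] v r ->]]]]].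
exists (yields cs ++ y); split; first by rewrite la_cat.
by apply: accepts_forest => //; rewrite r.
Qed.

Definition follow_sub al al' := forall ga mu, follow al ga mu -> follow al' ga mu.

Lemma follow_sub_cons X al al' : follow_sub al al' -> follow_sub (X :: al) (X :: al').
Proof.
move=> s ga mu; move e: (X :: al) => al1 h; elim: h e => {al1 ga mu}.
- by [].
- by move=> al1 Y ga mu h _ [-> e1]; apply: follow_step; apply: s; rewrite e1.
by move=> al1 B ga mu be cs h IH inB vcs rcs e; apply: follow_predict (IH e) inB vcs rcs.
Qed.

Lemma follow_sub_cat be al al' : follow_sub al al' -> follow_sub (be ++ al) (be ++ al').
Proof. by move=> s; elim: be => // X be; exact: follow_sub_cons. Qed.

Lemma follow_sub_viable al al' lam : follow_sub al al' -> viable al lam -> viable al' lam.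
Proof.
move=> s /viable_follow [ga [mu [cs [f v r e]]]]; apply/viable_follow.
by exists ga, mu, cs; split=> //; exact: s.
Qed.

(** With [be] and [al] nonempty the stack has at least two symbols, which rules out the accepting
    disjunct. What remains is viability after pushing [a], and this depends on the valid items
    only. *)
Lemma follow_sub_shift_live be al al' lam : be <> [::] -> al <> [::] -> al' <> [::] ->
  follow_sub al al' -> shift_live K (be ++ al) lam -> shift_live K (be ++ al') lam.
Proof.
case: be => // X be _; case: al => // Y al _; case: al' => // Y' al' _ s.
case=> [[[_]] |[a [y [e h]]]]; first by case: be.
right; have [y' [e' h']] : viable (inr a :: (X :: be) ++ Y' :: al') (la K y).
  apply: (follow_sub_viable (al := inr a :: (X :: be) ++ Y :: al)); last by exists y.
  exact/follow_sub_cons/follow_sub_cat.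
by exists a, y'; split=> //; rewrite -e; apply: la_cons.
Qed.

(** The successor makes room for the start item, whose remainder has length one even if all
    right-hand sides are empty. *)
Definition maxrhs := (\max_(p <- prods G) size p.2).+1.

Lemma leq_maxrhs A be : List.In (A, be) (prods G) -> size be <= maxrhs.
Proof.
move/InE => inA; apply: leqW; rewrite (big_rem _ inA) /=; exact: leq_maxl.
Qed.

Lemma follow_size al ga mu : follow al ga mu -> size ga <= maxrhs /\ size mu = K.
Proof.
elim=> {al ga mu} [|al X ga mu _ [/= l1 l2]|al B ga mu be cs _ [l1 l2] inB _ _].
- by rewrite size_nseq.
- by split=> //; exact: ltnW.
split; first exact: leq_maxrhs inB.
by rewrite size_takel // size_cat l2 leq_addl.
Qed.

Definition lr_item := (maxrhs.-bseq sym * K.-tuple (option (Tm G)))%type.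

Definition items al : {set lr_item} := [set u : lr_item | `[< follow al u.1 u.2 >]].

Lemma items_follow_sub al al' : items al = items al' -> follow_sub al al'.
Proof.
move=> e ga mu f; have [sg /eqP sm] := follow_size f.
move/setP/(_ (Bseq sg, Tuple sm)): e; rewrite !inE => e.
by apply/asboolP; rewrite -e; apply/asboolP.
Qed.

Lemma items_cons X al al' : items al = items al' -> items (X :: al) = items (X :: al').
Proof.
move=> e; apply/setP => u; rewrite !inE; apply/asboolP/asboolP.
  exact/follow_sub_cons/items_follow_sub.
exact/follow_sub_cons/items_follow_sub/esym.
Qed.

(** The goto function of the LR automaton, defined through an arbitrarily chosen stack with item set
    [H]. By [items_cons] the choice does not matter; sets that belong to no stack get a dummy
    value. *)
Definition items_step (H : {set lr_item}) X : {set lr_item} :=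
  if pselect (exists al, items al = H) is left e then items (X :: projT1 (cid e)) else set0.

Lemma items_stepE al X : items_step (items al) X = items (X :: al).
Proof.
rewrite /items_step; case: pselect => [e|[]]; last by exists al.
by apply: items_cons; case: cid.
Qed.

End Viable.

(** * Enumeration of predicates with boundedly many witnesses *)

Lemma bounded_enum (T : eqType) (P : T -> Prop) n :
  (forall L, uniq L -> (forall x, x \in L -> P x) -> size L <= n) ->
  exists L, uniq L /\ forall x, x \in L <-> P x.
Proof.
move=> bnd.
(* A duplicate-free list of witnesses can be extended until it is exhaustive; one of length [n.+1]
   would violate the bound. *)
have grow m : (exists L, uniq L /\ forall x, x \in L <-> P x) \/
    exists L, [/\ uniq L, forall x, x \in L -> P x & size L = m].
  elim: m => [|m [IH|[L [uL HL sL]]]]; [by right; exists [::]|by left|].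
  case: (pselect (exists2 x, P x & x \notin L)) => [[x Px nx]|no].
    right; exists (x :: L); rewrite /= nx sL; split=> // y; rewrite inE.
    by case/predU1P => [->|/HL].
  left; exists L; split=> // x; split; first exact: HL.
  by move=> Px; apply/negPn/negP => nx; apply: no; exists x.
have [//|[L [uL HL sL]]] := grow n.+1.
by have := bnd L uL HL; rewrite sL ltnn.
Qed.

(** A total function chosen classically, so that it can occur in the definitions of the program
    tables. The empty list is the value for infinite predicates. *)
Definition enum_prop (T : eqType) (P : T -> Prop) : seq T :=
  if pselect (exists L, uniq L /\ forall x, x \in L <-> P x) is left e then projT1 (cid e) else [::].

Lemma enum_propP (T : eqType) (P : T -> Prop) n :
  (forall L, uniq L -> (forall x, x \in L -> P x) -> size L <= n) ->
  uniq (enum_prop P) /\ forall x, x \in enum_prop P <-> P x.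
Proof.
move/bounded_enum => h; rewrite /enum_prop; case: pselect => [e|] //; by case: cid.
Qed.

Lemma uniq_flatten_disjoint (T U : eqType) (L : seq T) (F : T -> seq U) :
  uniq L -> (forall x, x \in L -> uniq (F x)) ->
  (forall x y u, x \in L -> y \in L -> u \in F x -> u \in F y -> x = y) -> uniq (flatten (map F L)).
Proof.
elim: L => [|x L IH] //= /andP [nx uL] uF dj.
rewrite cat_uniq uF ?mem_head //= IH //; first last.
- by move=> y z u yL zL; apply: dj; rewrite inE ?yL ?zL orbT.
- by move=> y yL; apply: uF; rewrite inE yL orbT.
rewrite andbT; apply/hasPn => u /flatten_mapP [y yL uy]; apply/negP => ux.
by move: nx; rewrite (dj x y u) ?yL // inE ?eqxx // yL orbT.
Qed.

(** * Memoized reduction paths *)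

Section Slots.
Variables (G : cfg) (k t : nat).
Local Notation K := k.+1.
Local Notation tree := (ptree G).
Local Notation sym := (Nt G + Tm G)%type.
Local Notation rt := (@Defs.root G).
Local Notation roots := (map rt).
Implicit Types (T : tree) (cs g st : seq tree) (al ga be : seq sym) (f : frame G) (fs : seq (frame G)).

(* [(X, rb, lam)]: the symbols [rb] remain to be popped, after which [X] is pushed, with lookahead [lam]. *)
Definition key := (sym * (maxrhs G).-bseq sym * K.-tuple (option (Tm G)))%type.
Definition label := (sym * seq tree)%type.
Definition path := (seq (frame G) * label)%type.
Definition exit := (seq (frame G) * (label + key))%type.
Definition source := (seq (frame G) * (label + key * nat))%type.
Implicit Types (z : key) (r : path) (e : exit).

(** The paths for a key are counted by realizing [X] by such a tree and comparing the resulting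
    forests; the nonempty yield lets the tree be located in them. *)
Definition fruitful (X : sym) := exists T, [/\ valid T, rt T = X & yield T <> [::]].

(* The ways to go on, by reductions only, until the next shift, after [X] has been pushed. *)
Definition is_path al z r : Prop :=
  let: (X, rb, lam) := z in
  let al' := drop (size rb) al in
  let c := frames_tgt al' X r.1 in
  [/\ fruitful X, prefix rb al, frames_ok al' X r.1, eps r.2.2 &
      r.2.1 = c.2 /\ shift_live K (rev (roots r.2.2) ++ c.2 :: c.1) lam].

Definition path_forest st T r : seq tree :=
  let c := apply_frames st T r.1 in rev r.2.2 ++ c.2 :: c.1.

Lemma path_forest_spec st T r : vall st -> valid T ->
  frames_ok (roots st) (rt T) r.1 -> eps r.2.2 ->
  let c := frames_tgt (roots st) (rt T) r.1 in
  [/\ vall (path_forest st T r), syield (path_forest st T r) = syield (T :: st) &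
      roots (path_forest st T r) = rev (roots r.2.2) ++ c.2 :: c.1].
Proof.
move=> vst vT ok [vg yg] /=; have [v1 v2 <- y] := apply_frames_spec vst vT ok.
rewrite /path_forest; split; first by apply/vall_cat; rewrite vall_rev.
  by rewrite syield_rev yg cats0 y.
by rewrite map_cat map_rev.
Qed.

Lemma path_forest_inj st T r st2 T2 r2 :
  vall st -> valid T -> vall st2 -> valid T2 -> yield T <> [::] -> yield T2 <> [::] ->
  frames_ok (roots st) (rt T) r.1 -> frames_ok (roots st2) (rt T2) r2.1 ->
  eps r.2.2 -> eps r2.2.2 ->
  path_forest st T r = path_forest st2 T2 r2 ->
  r.2.2 = r2.2.2 /\ apply_frames st T r.1 = apply_frames st2 T2 r2.1.
Proof.
move=> vst vT vst2 vT2 nT nT2 ok ok2 [_ y] [_ y2].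
have := @apply_frames_yield _ st T r.1 nT; have := @apply_frames_yield _ st2 T2 r2.1 nT2.
rewrite /path_forest; case: (apply_frames _ _ _) => s1 U1; case: (apply_frames _ _ _) => s2 U2 /= n2 n1 e.
have {e} : rev s2 ++ U2 :: r.2.2 = rev s1 ++ U1 :: r2.2.2.
  by rewrite -!cat_rcons -!rev_cons; apply: (can_inj revK); rewrite !rev_cat !revK.
by case/last_nonempty_inj => // /(can_inj revK) -> -> ->.
Qed.

Section Bound.
Hypothesis xlr : XLR G K t.

(** A fruitful tree for [X] turns the paths into live stacks over one string with one lookahead. If
    two paths gave the same stack, [apply_frames_inj] would make their frame lists differ by frames
    that lead from the tree back to itself, and sizes forbid that. *)
Lemma paths_bound st z (L : seq path) : vall st -> uniq L ->
  (forall r, r \in L -> is_path (roots st) z r) -> size L <= t.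
Proof.
case: z => [[X rb] lam] vst uL HL.
case: L uL HL => [|r0 L0] //; move: (r0 :: L0) (mem_head r0 L0) => L r0L uL HL.
have [[T [vT rT nT]] _ _ _ _] := HL _ r0L.
pose st' := drop (size rb) st.
have vst' : vall st' by move: vst; rewrite -{1}(cat_take_drop (size rb) st) vall_cat; case.
rewrite -(size_map (path_forest st' T)).
apply: (shift_live_bound (x := syield (T :: st')) (lam := lam) xlr); first by rewrite size_tuple.
  rewrite map_inj_in_uniq // => r r2 /HL [_ pre ok eg [eB _]] /HL [_ _ ok2 eg2 [eB2 _]].
  rewrite -map_drop -/st' -rT in ok ok2 eB eB2 => epf.
  have [egg ea] := path_forest_inj vst' vT vst' vT nT nT ok ok2 eg eg2 epf.
  have er : r.1 = r2.1.
    have [[fs3 e e']|[fs3 e e']] := apply_frames_inj vst' vT vst' vT nT nT ok ok2 ea.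
      have := apply_frames_size st' T fs3; rewrite e' /= -{2}[tsize T]addn0 leq_add2l leqn0.
      by case: fs3 e {e'} => //.
    have := apply_frames_size st' T fs3; rewrite e' /= -{2}[tsize T]addn0 leq_add2l leqn0.
    by case: fs3 e {e'} => //.
  by move: eB eB2 egg er; case: (r) => [? [? ?]]; case: (r2) => [? [? ?]] /= -> -> -> ->.
move=> _ /mapP [r /HL [_ pre ok eg [eB lv]] ->].
rewrite -map_drop -/st' -rT in ok lv.
have [? ? e] := path_forest_spec vst' vT ok eg.
by split=> //; rewrite e.
Qed.

End Bound.

(** On the empty stack nothing can be popped. This is why [frames_ok [::]] serves in [is_exit] to
    express that a list consists of unit frames. *)
Lemma frames_ok_nil X fs : frames_ok [::] X fs -> all (fun f : frame G => fbe f == [::]) fs.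
Proof.
elim: fs X => [|f fs IH] X //= [_]; case: (fbe f) => //= _; exact: IH.
Qed.

Lemma unit_frames al al' X fs : all (fun f : frame G => fbe f == [::]) fs ->
  (frames_ok al X fs <-> frames_ok al' X fs) /\
  frames_tgt al X fs = (al, (frames_tgt al' X fs).2).
Proof.
elim: fs al al' X => [|f fs IH] al al' X //= /andP [/eqP e u].
rewrite /frames_tgt /= /frame_tgt /= e /= !drop0 -!/(frames_tgt _ _ _).
have [h1 h2] := IH al al' (inl f.1.1) u; split; last by rewrite h2.
by rewrite !prefix0s; split; case=> ? ? /h1.
Qed.

Definition bs (s : seq sym) : (maxrhs G).-bseq sym := insub_bseq (maxrhs G) s.

Lemma bsK (s : seq sym) : size s <= maxrhs G -> bs s = s :> seq sym.
Proof. by move=> h; rewrite /bs /insub_bseq insubdK. Qed.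

(* [H] and [c] describe the stack below [Y]: its valid items and its number of paths for each key. *)
Definition is_exit (H : {set lr_item G k}) (c : key -> nat) (Y : sym) z e : Prop :=
  let: (X, rb, lam) := z in
  match (rb : seq sym), e.2 with
  | [::], inl (B, g) =>
      [/\ fruitful X, frames_ok [::] X e.1, B = (frames_tgt [::] X e.1).2, eps g &
          exists2 al, items k al = H & shift_live K (rev (roots g) ++ B :: Y :: al) lam]
  | [::], inr z' => exists us f rb',
      [/\ fruitful X, e.1 = rcons us f, frames_ok [::] X us,
          frame_ok (frames_tgt [::] X us).2 f &
          [/\ fbe f = Y :: rb', z' = (inl f.1.1, bs rb', lam) & 0 < c z']]
  | Y' :: rb', inr z' => [/\ e.1 = [::], Y' = Y, z' = (X, bs rb', lam) & 0 < c z']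
  | _, inl _ => False
  end.

Definition root_shape z : seq source :=
  take t [seq (r.1, inl r.2) | r <- enum_prop (is_path [::] z)].

Definition nstate := ({set lr_item G k} * {ffun key -> 'I_t.+1})%type.

(** An outcome of the parent is named by its key and its number, so the counts of the parent
    suffice. The truncation keeps the length within [t] even for states that no stack has; on
    genuine stacks it cuts nothing, as the proof of [pathsP] shows. *)
Definition node_shape (s : nstate) (Y : sym) z : seq source :=
  take t (flatten [seq match e.2 with
                       | inl l => [:: (e.1, inl l)]
                       | inr z' => [seq (e.1, inr (z', j)) | j <- iota 0 (s.2 z')]
                       end | e <- enum_prop (is_exit s.1 (fun z => s.2 z) Y z)]).

Definition state0 : nstate := (items k [::], [ffun z => inord (size (root_shape z))]).
Definition next_state (s : nstate) Y : nstate :=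
  (items_step s.1 Y, [ffun z => inord (size (node_shape s Y z))]).
Fixpoint state_of al : nstate := if al is Y :: al' then next_state (state_of al') Y else state0.

Definition extend_path fs r : path := (fs ++ r.1, r.2).

(** The list that the slots of a node will represent, in the same order. At the root there is no
    parent, and the [inr] branch never occurs ([root_shape_source]). *)
Fixpoint paths al z : seq path :=
  match al with
  | [::] => [seq match s.2 with inl l => (s.1, l) | inr (z', j) => (s.1, (z'.1.1, [::])) end | s <- root_shape z]
  | Y :: al' => [seq match s.2 with
                     | inl l => (s.1, l)
                     | inr (z', j) => extend_path s.1 (nth ([::], (Y, [::])) (paths al' z') j)
                     end | s <- node_shape (state_of al') Y z]
  end.

Lemma state_of_items al : (state_of al).1 = items k al.
Proof. by elim: al => [|Y al IH] //=; rewrite IH items_stepE. Qed.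

Lemma size_paths al z : size (paths al z) = (state_of al).2 z.
Proof.
case: al => [|Y al] /=; rewrite size_map ffunE inordK // ltnS size_take;
  by case: ltnP => // _; apply: leqnn.
Qed.

Lemma frames_tgt_cat al X fs1 fs2 :
  frames_tgt al X (fs1 ++ fs2) = frames_tgt (frames_tgt al X fs1).1 (frames_tgt al X fs1).2 fs2.
Proof. by rewrite /frames_tgt foldl_cat; case: (foldl _ _ fs1). Qed.

Lemma frame_ok_size X f : frame_ok X f -> size (fbe f) < maxrhs G.
Proof.
case=> /leq_maxrhs + _; rewrite size_cat size_rev /= addnS; apply: leq_ltn_trans.
exact: leq_addr.
Qed.

Definition pops (f : frame G) := fbe f != [::].

(** Cuts a path after the first frame that pops something, which is where it leaves the top node. As
    the exit is a function of the path, different exits contribute disjoint families of paths. *)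
Definition exit_of z r : exit :=
  let: (X, rb, lam) := z in
  if (rb : seq sym) is _ :: rb' then ([::], inr (X, bs rb', lam))
  else let n := find pops r.1 in
    if drop n r.1 is f :: _ then (take n.+1 r.1, inr (inl f.1.1, bs (behead (fbe f)), lam))
    else (r.1, inl r.2).

Definition exit_paths al e : seq path :=
  match e.2 with inl l => [:: (e.1, l)] | inr z' => [seq extend_path e.1 r | r <- paths al z'] end.

Lemma all_unit_find fs : all (fun f : frame G => fbe f == [::]) fs -> find pops fs = size fs.
Proof. by move=> u; apply: hasNfind; rewrite -all_predC; apply: sub_all u => f /=; rewrite /pops negbK. Qed.

Section Step.
Variables (al : seq sym) (Y : sym) (st : seq tree).
Hypotheses (vst : vall st) (rst : roots st = Y :: al).
Hypothesis IH : forall z, uniq (paths al z) /\ forall r, r \in paths al z <-> is_path al z r.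
Let exits z e := is_exit (items k al) (fun z => size (paths al z)) Y z e.

Lemma exit_paths_sound z e r : exits z e -> r \in exit_paths al e ->
  is_path (Y :: al) z r /\ exit_of z r = e.
Proof.
case: z => [[X rb] lam]; rewrite /exits /is_exit /exit_paths /exit_of /is_path.
case: e => [es [[B g]|z']] /=; case e1: (bseqval rb) => [|Y' rb'] //=.
- case=> fX ok eB eg [al1 eH lv]; rewrite inE => /eqP ->; rewrite /= ?prefix0s.
  have u := frames_ok_nil ok.
  have [okE tgtE] := unit_frames (Y :: al) [::] X u.
  rewrite tgtE /= -eB; split; last by rewrite all_unit_find // drop_size.
  split=> //; first exact/okE.
  (* The exit speaks of some stack [al1] with the items of [al]. Liveness is transferred because [B]
     and [Y] lie above both. *)
  split=> //; move: lv; rewrite -!(cat_rcons B); apply: follow_sub_shift_live => //.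
    by case: (rev _).
  exact/follow_sub_cons/items_follow_sub.
- case=> us [f [rb' [fX -> ok okf [ef -> c]]]] /mapP [r' /(proj2 (IH _))].
  have le : size rb' <= maxrhs G by apply: ltnW; apply: ltnW; have := frame_ok_size okf; rewrite ef.
  rewrite /is_path bsK // => -[_ pre okr eg [eB lv]] ->.
  have u := frames_ok_nil ok.
  have [okE tgtE] := unit_frames (Y :: al) [::] X u.
  rewrite /= cat_rcons ?prefix0s; split; last first.
    rewrite find_cat -[has _ _]negbK -all_predC.
    have -> /= : all (predC pops) us by apply: sub_all u => f' /=; rewrite /pops negbK.
    rewrite /pops ef /= addn0 drop_size_cat // -cat_rcons take_size_cat ?size_rcons //.
    by rewrite ef.
  have tE : frames_tgt (Y :: al) X (us ++ f :: r'.1) = frames_tgt (drop (size rb') al) (inl f.1.1) r'.1.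
    by rewrite frames_tgt_cat tgtE /frames_tgt /= /frame_tgt ef.
  split=> //; last by rewrite tE.
  apply/frames_ok_cat; split; first exact/okE.
  by rewrite tgtE /= ef; split=> //=; rewrite eqxx.
- case=> -> -> -> c /mapP [[rs rl] /(proj2 (IH _)) + ->].
  have le : size rb' <= maxrhs G by have := size_bseq rb; rewrite e1; apply: ltnW.
  by rewrite /is_path bsK //= eqxx.
Qed.

Lemma exit_paths_complete z r : is_path (Y :: al) z r ->
  exits z (exit_of z r) /\ r \in exit_paths al (exit_of z r).
Proof.
case: z => [[X rb] lam]; rewrite /exits /is_exit /exit_paths /exit_of /is_path.
case e1: (bseqval rb) => [|Y' rb'] /=; last first.
  have le : size rb' <= maxrhs G by have := size_bseq rb; rewrite e1; apply: ltnW.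
  case=> fX /andP [/eqP eY pre] ok eg eB.
  have rin : r \in paths al (X, bs rb', lam) by apply/(proj2 (IH _)); rewrite /is_path bsK.
  split; first by split=> //; case: (paths _ _) rin.
  by apply/mapP; exists r => //; case: (r).
case: r => fs [B g] /= [fX _ ok eg [eB lv]].
have u : all (fun f : frame G => fbe f == [::]) (take (find pops fs) fs).
  apply/allP => f /(nthP f) [i]; rewrite size_takel ?find_size // => lti.
  by rewrite nth_take // => <-; have := before_find f lti; rewrite /pops => /negbFE.
case ed: (drop (find pops fs) fs) => [|f fs'] /=.
  have efs : take (find pops fs) fs = fs by rewrite -[RHS](cat_take_drop (find pops fs)) ed cats0.
  rewrite efs in u; have [okE tgtE] := unit_frames (Y :: al) [::] X u.
  split; last by rewrite inE.
  split=> //; [exact/okE | by rewrite eB tgtE|].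
  by exists al => //; move: lv; rewrite -eB tgtE.
have lt : find pops fs < size fs by rewrite ltnNge; apply/negP => /drop_oversize; rewrite ed.
have efs : fs = take (find pops fs) fs ++ f :: fs' by rewrite -ed cat_take_drop.
have etk : take (find pops fs).+1 fs = rcons (take (find pops fs) fs) f.
  rewrite {2}efs -cat_rcons take_size_cat // size_rcons size_takel //; exact: ltnW.
move: ok; rewrite {1}efs => /frames_ok_cat [ok1].
have [okE tgtE] := unit_frames (Y :: al) [::] X u.
rewrite tgtE /= => -[okf pre okr].
have pf : pops f.
  have := @nth_find _ f pops fs; rewrite has_find lt => /(_ isT).
  by rewrite {1}efs nth_cat size_takel ?(ltnW lt) // ltnn subnn.
case ef: (fbe f) pf pre okr => [|Y1 rb'] //=; first by rewrite /pops ef.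
move=> _ /andP [/eqP eY pre] okr.
have le : size rb' <= maxrhs G by apply: ltnW; apply: ltnW; have := frame_ok_size okf; rewrite ef.
have tE : frames_tgt (Y :: al) X fs = frames_tgt (drop (size rb') al) (inl f.1.1) fs'.
  by rewrite {1}efs frames_tgt_cat tgtE /frames_tgt /= /frame_tgt ef.
have rin : (fs', (B, g)) \in paths al (inl f.1.1, bs rb', lam).
  apply/(proj2 (IH _)); rewrite /is_path bsK //=; rewrite tE in eB lv; split=> //.
  (* The nonterminal handed to the parent must be fruitful. A tree for it arises by applying the
     frames, up to the popping one, to a tree for [X] on the actual stack [st]; this is where the
     trees of [st] are needed. *)
  case: fX => T [vT rT nT].
  have okT : frames_ok (roots st) (rt T) (take (find pops fs).+1 fs).
    rewrite rst rT etk -cats1; apply/frames_ok_cat; split; first exact: ok1.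
    by rewrite tgtE /= ef; split=> //; rewrite /= eY eqxx pre.
  have [_ vN rN _] := apply_frames_spec vst vT okT.
  exists (apply_frames st T (take (find pops fs).+1 fs)).2; split=> //.
    by have /= -> := congr1 snd rN; rewrite rst rT etk -cats1 frames_tgt_cat.
  exact: apply_frames_yield.
split; last by apply/mapP; exists (fs', (B, g)); rewrite // /extend_path /= etk cat_rcons -efs.
exists (take (find pops fs) fs), f, rb'; split=> //; first exact/okE.
by rewrite ef /=; split=> //; [rewrite eY | case: (paths _ _) rin].
Qed.

End Step.

Hypothesis xlr : XLR G K t.

(** Induction on the stack: a path at a node is an exit of the node followed by a path at the
    parent, and [exit_of] makes this decomposition unique. Through [paths_bound] every enumeration
    involved is finite and no truncation takes effect. *)
Lemma pathsP st z : vall st ->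
  uniq (paths (roots st) z) /\ forall r, r \in paths (roots st) z <-> is_path (roots st) z r.
Proof.
elim: st z => [|T st IH] z vst.
  have [uE EP] := enum_propP (fun L uL => paths_bound xlr (st := [::]) (z := z) vst uL).
  have -> : paths (roots [::]) z = enum_prop (is_path [::] z); last by [].
  rewrite /= /root_shape take_oversize.
    by rewrite -map_comp map_id_in // => -[? ?].
  by rewrite size_map; apply: (paths_bound xlr (st := [::]) (z := z) vst uE) => r /EP.
have vst' : vall st by case: vst.
have {}IH z' := IH z' vst'.
set al := roots st in IH *; set Y := rt T.
have rst : roots (T :: st) = Y :: al by [].
pose ex e := is_exit (items k al) (fun z => size (paths al z)) Y z e.
have exE : is_exit (state_of al).1 (fun z' => (state_of al).2 z') Y z = ex.
  have ec : (fun z' => ((state_of al).2 z' : nat)) = (fun z' => size (paths al z')).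
    by apply: funext => z'; rewrite size_paths.
  by rewrite state_of_items ec.
have bnd L : uniq L -> (forall r, r \in L -> is_path (Y :: al) z r) -> size L <= t.
  by move=> uL HL; apply: (paths_bound xlr (z := z) vst uL).
pose r0 : path := ([::], (Y, [::])).
have [uE EP] : uniq (enum_prop ex) /\ forall e, e \in enum_prop ex <-> ex e.
  (* Each exit has at least one path, because the counts in [is_exit] are positive. Sending an exit
     to its first path is injective by [exit_of], so exits inherit the bound [t] from paths. *)
  apply: (enum_propP (n := t)) => L uL HL.
  have hin e : e \in L -> head r0 (exit_paths al e) \in exit_paths al e.
    move/HL; rewrite /ex /is_exit /exit_paths; case: z {exE bnd ex HL} => [[X rb] lam].
    case: e => [es [[B g]|z']] /=; first by rewrite mem_head.
    have nth0s : 0 < size (paths al z') ->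
        head r0 [seq extend_path es r | r <- paths al z'] \in [seq extend_path es r | r <- paths al z'].
      by case: (paths al z') => // r rs _; rewrite mem_head.
    case: (bseqval rb) => [|Y' rb'] /=; first by case=> us [f [rb' [_ _ _ _ [_ _ /nth0s]]]].
    by case=> _ _ _ /nth0s.
  rewrite -(size_map (fun e => head r0 (exit_paths al e))); apply: bnd.
    rewrite map_inj_in_uniq // => e1 e2 i1 i2 eh.
    have [_ <-] := exit_paths_sound IH (HL _ i1) (hin _ i1).
    by rewrite eh; have [] := exit_paths_sound IH (HL _ i2) (hin _ i2).
  by move=> _ /mapP [e ie ->]; have [] := exit_paths_sound IH (HL _ ie) (hin _ ie).
pose full := flatten [seq exit_paths al e | e <- enum_prop ex].
have uF : uniq full.
  apply: uniq_flatten_disjoint => //.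
    move=> [es [l|z']] _ //; rewrite /exit_paths /= map_inj_uniq; first by case: (IH z').
    by move=> [f1 l1] [f2 l2] [/eqP]; rewrite eqseq_cat // eqxx => /= /eqP -> ->.
  move=> e1 e2 r /EP i1 /EP i2 r1 r2.
  have [_ <-] := exit_paths_sound IH i1 r1; by have [_ <-] := exit_paths_sound IH i2 r2.
have FP r : r \in full <-> is_path (Y :: al) z r.
  split=> [/flatten_mapP [e /EP ie /(exit_paths_sound IH ie) []] //|].
  move/(exit_paths_complete vst rst IH) => [ie ir].
  by apply/flatten_mapP; exists (exit_of z r) => //; apply/EP.
rewrite -[roots (T :: st)]/(Y :: al).
suff -> : paths (Y :: al) z = full by [].
(* The right-hand side has at most [t] elements by the bound on paths, so [take t] may be put in
   front of it to match the truncated shape. *)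
rewrite /= /node_shape exE -[RHS](take_oversize (n := t)); last by apply: bnd => // r /FP.
rewrite map_take; congr take; rewrite map_flatten -map_comp; congr flatten.
apply: eq_map => -[es [l|z']] //=.
rewrite /exit_paths /= -size_paths -map_comp.
rewrite -{2}(take_size (paths al z')) -(map_nth_iota0 r0) // -map_comp.
exact: eq_map.
Qed.

Definition live x (lam : K.-tuple (option (Tm G))) st : Prop :=
  [/\ vall st, syield st = x & shift_live K (roots st) lam].

Lemma live_bound x lam (L : seq (seq tree)) : uniq L ->
  (forall st, st \in L -> live x lam st) -> size L <= t.
Proof. by move=> uL HL; apply: (shift_live_bound xlr _ uL HL); rewrite size_tuple. Qed.

(** Before anything is read, stacks of trees with empty yield can already be live. No shift produces
    them, so they are tabulated for each lookahead. *)
Definition empty_threads lam := enum_prop (live [::] lam).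

Lemma empty_threadsP lam :
  uniq (empty_threads lam) /\ forall st, st \in empty_threads lam <-> live [::] lam st.
Proof. by apply: (enum_propP (n := t)) => L; apply: live_bound. Qed.

Definition shift_key a (lam : K.-tuple (option (Tm G))) : key := (inr a, bs [::], lam).

Definition shift_thread a lam st :=
  [seq path_forest st (Leaf a) r | r <- paths (roots st) (shift_key a lam)].

Lemma is_shift_path al a lam r : is_path al (shift_key a lam) r <->
  [/\ frames_ok al (inr a) r.1, eps r.2.2 & let c := frames_tgt al (inr a) r.1 in
     r.2.1 = c.2 /\ shift_live K (rev (roots r.2.2) ++ c.2 :: c.1) lam].
Proof.
rewrite /shift_key /is_path bsK //= drop0; split; first by case.
by case=> *; split=> //; [exists (Leaf a) | rewrite prefix0s].
Qed.

(** The main loop on the level of trees: reading [a] neither loses, invents nor duplicates a live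
    stack. The lookahead before the shift is determined by [a] and the lookahead after it. *)
Lemma shift_threadsP x a (lam lam' : K.-tuple (option (Tm G))) (L : seq (seq tree)) :
  tval lam = take K (Some a :: lam') ->
  uniq L -> (forall st, st \in L <-> live x lam st) ->
  let L' := flatten (map (shift_thread a lam') L) in
  uniq L' /\ forall st, st \in L' <-> live (rcons x a) lam' st.
Proof.
move=> elam uL LP L'.
have vL st : st \in L -> vall st by case/LP.
have nT : yield (Leaf a) <> [::] by [].
split.
  apply: uniq_flatten_disjoint => // [st /vL vst|st st2 u /vL vst /vL vst2].
    have [uP PP] := pathsP (shift_key a lam') vst.
    rewrite map_inj_in_uniq // => r r2 /PP /is_shift_path [ok eg [eB _]] /PP /is_shift_path [ok2 eg2 [eB2 _]] e.
    have [egg ea] := path_forest_inj (T := Leaf a) (T2 := Leaf a) vst I vst I nT nT ok ok2 eg eg2 e.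
    (* If one frame list properly extended the other, the extra frames would turn a leaf into a
       leaf, but a frame always produces a [Node]. *)
    have er : r.1 = r2.1.
      have [[fs3 -> e']|[fs3 -> e']] := apply_frames_inj (T := Leaf a) (T2 := Leaf a) vst I vst I nT nT ok ok2 ea;
      by case/lastP: fs3 e' => // fs3 f; rewrite apply_frames_rcons.
    by move: eB eB2 egg er; case: (r) => [? [? ?]]; case: (r2) => [? [? ?]] /= -> -> -> ->.
  move=> /mapP [r /(proj2 (pathsP _ vst)) /is_shift_path [ok eg _] ->].
  move=> /mapP [r2 /(proj2 (pathsP _ vst2)) /is_shift_path [ok2 eg2 _] e].
  have [_ ea] := path_forest_inj (T := Leaf a) (T2 := Leaf a) vst I vst2 I nT nT ok ok2 eg eg2 e.
  have [[fs3 _ e']|[fs3 _ e']] := apply_frames_inj (T := Leaf a) (T2 := Leaf a) vst I vst2 I nT nT ok ok2 ea;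
    by case/lastP: fs3 e' => [[]|fs3 f] //; rewrite apply_frames_rcons.
move=> st'; split.
  case/flatten_mapP => st /LP [vst yst _] /mapP [r /(proj2 (pathsP _ vst)) /is_shift_path [ok eg [_ lv]] ->].
  have [v y e] := path_forest_spec (T := Leaf a) vst I ok eg.
  by split=> //; [rewrite y syield_cons yst /= cats1 | rewrite e].
case=> vst' yst' lv.
(* The topmost tree with nonempty yield ends in the leaf just shifted. Its right spine supplies the
   frames and the stack before the shift; the empty trees above it form the label. *)
have [|cs [T [g [e nT' yg]]]] := @last_nonempty _ (rev st').
  by rewrite -[flatten _]/(syield st') yst'; case: (x).
have {}e : st' = rev g ++ T :: rev cs by rewrite -cat_rcons -rev_cons -rev_cat -e revK.
have [vg [vT vcs]] : vall g /\ valid T /\ vall (rev cs).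
  by move: vst'; rewrite e => /vall_cat [/vall_rev].
have [w yT] : exists w, yield T = rcons w a.
  move: yst'; rewrite e syield_rev yg cats0 syield_cons.
  case/lastP: (yield T) nT' => // w b _; rewrite -rcons_cat => /rcons_inj [_ ->]; by exists w.
have [st0 [fs [vst0 ea ye ok]]] := right_spine vT yT vcs.
have [_ _ + _] := apply_frames_spec (T := Leaf a) vst0 I ok; rewrite ea => te.
have eg : eps g by [].
have e' : st' = path_forest st0 (Leaf a) (fs, (rt T, g)) by rewrite /path_forest /= ea.
apply/flatten_mapP; exists st0.
  apply/LP; split=> //.
    apply: (@rcons_injl _ a); rewrite -yst' e syield_rev yg cats0 syield_cons yT ye.
    by rewrite -rcons_cat.
  have [y [ey accy]] : exists y, la K y = lam' /\ accepts (roots st') y.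
    case: lv => [[-> ->]|[b [y [<- h]]]]; last by exists (b :: y); split=> //; apply: accepts_shift.
    by exists [::]; split; [exact: la_nseq | exact: accepts_done].
  right; exists a, y; split; first by rewrite -cat1s la_cat ey elam.
  apply: frames_accepts ok eg _; rewrite -te /=.
  by move: accy; rewrite e map_cat map_rev.
apply/mapP; exists (fs, (rt T, g)) => //.
apply/(proj2 (pathsP _ vst0))/is_shift_path; split=> //=.
rewrite -te /=; split=> //.
by move: lv; rewrite e map_cat map_rev.
Qed.

(** As the lookahead length is positive, an all-[None] lookahead leaves no shift pending, so only
    accepting stacks remain. *)
Lemma live_end x lam st : tval lam = nseq K None ->
  (live x lam st <-> exists2 P, st = [:: P] & parse_tree_of x P).
Proof.
move=> el; split.
  case=> vst yst; rewrite el => -[[e _]|[a [y [//]]]].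
  case: st vst yst e => [|P [|Q st]] //= [vP _]; rewrite syield_cons /= => yP [rP].
  by exists P.
case=> P -> [vP [rP yP]]; split=> //=; first by rewrite syield_cons.
by left; rewrite rP.
Qed.

End Slots.

Lemma finite_bound (I : finType) (P : I -> nat -> Prop) :
  (forall i m n, m <= n -> P i m -> P i n) -> exists N, forall i n, P i n -> P i N.
Proof.
move=> mono; pose f i := if pselect (exists n, P i n) is left e then projT1 (cid e) else 0.
exists (\max_i f i) => i n Pn; apply: mono (leq_bigmax i) _; rewrite /f.
by case: pselect => [e|[]]; [case: cid | exists n].
Qed.

(** * Size of unique parse trees *)

Section TreeSize.
Variable G : cfg.
Local Notation tree := (ptree G).
Local Notation sym := (Nt G + Tm G)%type.
Local Notation rt := (@Defs.root G).
Local Notation yields cs := (flatten (map (@yield G) cs)).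
Implicit Types (T B : tree) (cs : seq tree).

(** The additive cost of wrapping trees with root [X] into trees with root [Y] of the same yield. It
    depends on two symbols only, so one constant serves whenever wrapping is possible at a bounded
    cost. *)
Definition lifts (X Y : sym) n := forall T, valid T -> rt T = X -> exists T',
  [/\ valid T', rt T' = Y, yield T' = yield T & tsize T' <= tsize T + n].

Lemma lifts_bound : exists c, forall X Y n, lifts X Y n -> lifts X Y c.
Proof.
have [|N HN] := @finite_bound (sym * sym)%type (fun p n => lifts p.1 p.2 n).
  move=> i m n le h T vT rT; have [T' [? ? ? sT]] := h T vT rT.
  by exists T'; split=> //; apply: leq_trans sT _; rewrite leq_add2l.
by exists N => X Y n /(HN (X, Y)).
Qed.

Lemma empty_tree_bound : exists c, forall T, valid T -> yield T = [::] -> exists T',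
  [/\ valid T', rt T' = rt T, yield T' = yield T & tsize T' <= c].
Proof.
have [|N HN] := @finite_bound sym (fun X n => exists T',
    [/\ valid T', rt T' = X, yield T' = [::] & tsize T' <= n]).
  move=> i m n le [T' [? ? ? sT]]; exists T'; split=> //; exact: leq_trans le.
exists N => T vT yT; rewrite yT; apply: (HN _ (tsize T)).
by exists T.
Qed.

Lemma child_split cs T : T \in cs -> exists l r, cs = l ++ T :: r.
Proof. by case/splitPr => l r; exists l, r. Qed.

(** Descend as long as some child carries the whole nonempty yield. The siblings passed are empty,
    so the chain can be put over any tree with the root of [B], at a cost independent of that
    tree. *)
Lemma unit_spine T : valid T -> exists B,
  [/\ valid B, yield B = yield T, exists n, lifts (rt B) (rt T) n &
      if B is Node _ cs then forall c, c \in cs -> size (yield c) < size (yield B) \/ yield B = [::]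
      else True].
Proof.
elim/ptree_nested_ind: T => [a|A cs IH] vT.
  exists (Leaf a); split=> //; exists 0 => T' vT' rT'; exists T'; by rewrite addn0.
case: (pselect (exists2 c, c \in cs & ~ (size (yield c) < size (yield (Node A cs)) \/ yield (Node A cs) = [::])));
  last first.
  move=> no; exists (Node A cs); split=> //.
    by exists 0 => T' vT' rT'; exists T'; rewrite addn0.
  by move=> c ci; apply: contrapT => h; apply: no; exists c.
case=> T0 T0cs /not_orP [/negP + _]; rewrite -leqNgt => le.
have [inA vcs] : List.In (A, map rt cs) (prods G) /\ vall cs by [].
have [B [vB yB [n ln] cB]] := IH T0 T0cs (vall_in vcs T0cs).
have [l [r e]] := child_split T0cs.
have yE : yield (Node A cs) = yields l ++ yield T0 ++ yields r by rewrite /= e map_cat flatten_cat.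
have [yl yr] : yields l = [::] /\ yields r = [::].
  by move: le; rewrite yE !size_cat; case: (yields l); case: (yields r) => //= *; lia.
have yT0 : yield T0 = yield (Node A cs) by rewrite yE yl yr cats0.
exists B; split=> //; first by rewrite yB.
exists (n + (sumn (map (@tsize G) (l ++ r))).+1) => T1 vT1 rT1.
have [T2 [vT2 rT2 yT2 sT2]] := ln T1 vT1 rT1.
move: vcs; rewrite e => /vall_cat [vl [_ vr]].
exists (Node A (l ++ T2 :: r)); split=> //.
- rewrite valid_node; split; last by apply/vall_cat.
  by rewrite map_cat /= rT2 -(map_cons rt) -map_cat -e.
- by rewrite /= map_cat flatten_cat /= yl yr cats0.
by rewrite /= !map_cat !sumn_cat /=; lia.
Qed.

Lemma small_tree : exists C, forall T, valid T -> exists T',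
  [/\ valid T', rt T' = rt T, yield T' = yield T & tsize T' <= C * (size (yield T)).+1].
Proof.
have [c1 H1] := lifts_bound; have [c0 H0] := empty_tree_bound.
have [D eD] : exists D, D = c1 + 1 + maxrhs G * c0 by eexists.
(* [D] pays for one branching node: a lift to it, the node itself and its at most [maxrhs G] empty
   children of size [c0]. With at least two nonempty children per branching node, [n] leaves need at
   most 2n - 1 such payments. *)
pose F n := if n is 0 then c0 else D * (2 * n - 1).
suff main n T : size (yield T) = n -> valid T -> exists T',
    [/\ valid T', rt T' = rt T, yield T' = yield T & tsize T' <= F n].
  exists (2 * D + c0) => T /(main _ _ erefl) [T' [? ? ? sT]]; exists T'; split=> //.
  apply: leq_trans sT _; rewrite /F; case: (size _) => [|m]; nia.
elim/ltn_ind: n T => n IH T sn vT.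
case: n sn IH => [/size0nil yT _|n sn IH].
  have [T' [? ? ? ?]] := H0 T vT yT; by exists T'.
have [B [vB yB [m lm] cB]] := unit_spine vT.
suff [B' [vB' rB' yB' sB']] : exists B', [/\ valid B', rt B' = rt B, yield B' = yield B &
    tsize B' + c1 <= F n.+1].
  have [T' [? ? yT' sT']] := H1 _ _ _ lm B' vB' rB'.
  by exists T'; split=> //; [rewrite yT' yB' yB | apply: leq_trans sB'].
case: B vB yB lm cB => [a|A cs] vB yB _ cB.
  by exists (Leaf a); split=> //=; rewrite /F eD; nia.
have [inA vcs] : List.In (A, map rt cs) (prods G) /\ vall cs by [].
have {}cB c : c \in cs -> size (yield c) <= n.
  by move/cB; rewrite yB sn ltnS => -[//|y0]; move: sn; rewrite y0.
have [cs' [v' r' y' s']] : exists cs', [/\ vall cs', map rt cs' = map rt cs, yields cs' = yields cs &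
    sumn (map (@tsize G) cs') <= sumn (map (fun c => F (size (yield c))) cs)].
  elim: cs vcs cB {vB yB inA} => [|c cs IHcs] vcs cB; first by exists [::].
  have [vc vcs'] := vcs.
  have [c' [vc' rc' yc' sc']] := IH _ (cB c (mem_head c cs)) c erefl vc.
  have [|cs' [v' r' y' s']] := IHcs vcs'; first by move=> d dcs; apply: cB; rewrite inE dcs orbT.
  exists (c' :: cs'); split=> //=; [by rewrite rc' r' | by rewrite yc' y' | exact: leq_add].
exists (Node A cs'); split=> //=; first by rewrite r'.
have le1 : sumn (map (fun c => F (size (yield c))) cs) + D * count (fun c => yield c != [::]) cs
    <= size cs * c0 + 2 * D * size (yields cs).
  elim: (cs) => [|c cs1 IHc] /=; [by rewrite !muln0 | rewrite size_cat].
  have : F (size (yield c)) + D * (yield c != [::]) <= c0 + 2 * D * size (yield c).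
    by case: (yield c) => [|b w]; rewrite /F /=; nia.
  move=> h; rewrite !mulnDr mulSn addnACA [X in _ <= X]addnACA. exact: leq_add.
(* No child carries the whole yield, so a single nonempty child cannot suffice. *)
have le2 : 2 <= count (fun c => yield c != [::]) cs.
  have syc : size (yields cs) = n.+1 by rewrite -sn -yB.
  rewrite ltnNge; apply/negP => le.
  have : size (yields cs) <= n * count (fun c => yield c != [::]) cs.
    elim: (cs) cB => [|c cs1 IHc] //= cB; rewrite size_cat.
    have := cB c (mem_head _ _); have : size (yields cs1) <= n * count (fun c => yield c != [::]) cs1.
      by apply: IHc => d dcs; apply: cB; rewrite inE dcs orbT.
    by case: (yield c) => [|b w] /=; nia.
  rewrite syc; move: le; case: (count _ _) => [|[|]] //; lia.
have le3 : size cs <= maxrhs G by have := leq_maxrhs inA; rewrite size_map.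
move: le1; rewrite -[yields cs]/(yield (Node A cs)) yB sn /F.
move: s' le2; move: (sumn _) (sumn _) (count _ _) => x1 x2 x3 s' le2 le1.
have : size cs * c0 <= maxrhs G * c0 by rewrite leq_mul2r le3 orbT.
rewrite eD in le1 *; move: (maxrhs G * c0) (size cs * c0) le1 => x4 x5 le1; nia.
Qed.

(** A unique parse tree must be the small one. For ambiguous strings no bound on an arbitrary parse
    tree is available, as cyclic derivations show. *)
Lemma unique_tree_size : exists C, forall x (P : tree), parse_tree_of x P ->
  (forall P', parse_tree_of x P' -> P' = P) -> tsize P <= C * (size x).+1.
Proof.
have [C HC] := small_tree; exists C => x P [vP [rP yP]] un.
have [T' [v r y s]] := HC P vP; rewrite yP in s.
by rewrite -(un T') //; split=> //; rewrite r y.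
Qed.

End TreeSize.

(** * A structured language for the register machine *)

Inductive reg := RAcc | RUniq | RHp | RLam | ROld | RNew | RV | RP | RB | RC | RS | RX | RY | RZ | RD | RE
  | RFlag | RK.

(* Cells 2, 3 and 4 are scratch space of the compiled code. *)
Definition rn (r : reg) : nat :=
  match r with
  | RAcc => 0 | RUniq => 1 | RHp => 5 | RLam => 6 | ROld => 7 | RNew => 8 | RV => 9 | RP => 10 | RB => 11
  | RC => 12 | RS => 13 | RX => 14 | RY => 15 | RZ => 16 | RD => 17 | RE => 18 | RFlag => 19 | RK => 20
  end.

Definition heap_base := 32.

Record state := State { rg : reg -> nat; hp : nat -> nat; sin : seq nat; sout : seq nat }.

Definition setr (s : state) r v :=
  State (fun r' => if rn r' == rn r then v else rg s r') (hp s) (sin s) (sout s).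
Definition seth (s : state) a v := State (rg s) (upd (hp s) a v) (sin s) (sout s).

(** Loop-free on purpose: [clen] then bounds the running time as well as the code length, so every
    command takes constant time. *)
Inductive cmd :=
| Skip
| Const of reg & nat
| Mov of reg & reg
| AddC of reg & nat
| LoadAt of reg & reg & nat
| StoreAt of reg & nat & reg
| StoreC of reg & nat & nat
| Read of reg
| Write of nat
| Seq of cmd & cmd
| IfEq of reg & nat & cmd & cmd.

Fixpoint run (c : cmd) (s : state) : state :=
  match c with
  | Skip => s
  | Const r v => setr s r v
  | Mov r a => setr s r (rg s a)
  | AddC r v => setr s r (rg s r + v)
  | LoadAt r a o => setr s r (hp s (rg s a + o))
  | StoreAt a o b => seth s (rg s a + o) (rg s b)
  | StoreC a o v => seth s (rg s a + o) v
  | Read r => if sin s is a :: rest then setr (State (rg s) (hp s) rest (sout s)) r a.+1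
              else setr s r 0
  | Write v => State (rg s) (hp s) (sin s) (rcons (sout s) v)
  | Seq c1 c2 => run c2 (run c1 s)
  | IfEq r v c1 c2 => if rg s r == v then run c1 s else run c2 s
  end.

Fixpoint clen (c : cmd) : nat :=
  match c with
  | Skip => 0 | Const _ _ => 1 | Mov _ _ => 2 | AddC _ _ => 2 | LoadAt _ _ _ => 3 | StoreAt _ _ _ => 3
  | StoreC _ _ _ => 4 | Read _ => 1 | Write _ => 2
  | Seq c1 c2 => clen c1 + clen c2
  | IfEq _ _ c1 c2 => 7 + clen c2 + clen c1
  end.

(** Equality is tested by truncated subtraction both ways: the sum vanishes exactly when the values
    agree. An unconditional jump is [IJz] on a scratch cell just set to 0. *)
Fixpoint compile (off : nat) (c : cmd) : seq instr :=
  match c with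
  | Skip => [::]
  | Const r v => [:: IConst (rn r) v]
  | Mov r a => [:: IConst 2 0; IAdd (rn r) (rn a) 2]
  | AddC r v => [:: IConst 2 v; IAdd (rn r) (rn r) 2]
  | LoadAt r a o => [:: IConst 2 (heap_base + o); IAdd 2 (rn a) 2; ILoad (rn r) 2]
  | StoreAt a o b => [:: IConst 2 (heap_base + o); IAdd 2 (rn a) 2; IStore 2 (rn b)]
  | StoreC a o v => [:: IConst 2 (heap_base + o); IAdd 2 (rn a) 2; IConst 3 v; IStore 2 3]
  | Read r => [:: IRead (rn r)]
  | Write v => [:: IConst 2 v; IWrite 2]
  | Seq c1 c2 => compile off c1 ++ compile (off + clen c1) c2
  | IfEq r v c1 c2 =>
      [:: IConst 2 v; ISub 3 (rn r) 2; ISub 4 2 (rn r); IAdd 3 3 4; IJz 3 (off + (7 + clen c2))] ++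
      compile (off + 5) c2 ++
      [:: IConst 2 0; IJz 2 (off + clen (IfEq r v c1 c2))] ++ compile (off + (7 + clen c2)) c1
  end.

Lemma size_compile off c : size (compile off c) = clen c.
Proof.
elim: c off => //= [c1 IH1 c2 IH2|r v c1 IH1 c2 IH2] off.
  by rewrite size_cat IH1 IH2.
by rewrite size_cat /= IH1 IH2; lia.
Qed.

Definition code_at (p : program) off (code : seq instr) :=
  forall i, i < size code -> nth IHalt p (off + i) = nth IHalt code i.

Lemma code_at_cat p off c1 c2 : code_at p off (c1 ++ c2) ->
  code_at p off c1 /\ code_at p (off + size c1) c2.
Proof.
move=> h; split=> i lt.
  by rewrite h ?size_cat ?nth_cat ?lt //; lia.
rewrite -addnA h ?size_cat ?ltn_add2l // nth_cat ifN ?addKn //; lia.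
Qed.

Definition represents (cf : config) (s : state) :=
  [/\ forall r, Defs.mem cf (rn r) = rg s r, forall a, Defs.mem cf (heap_base + a) = hp s a,
      inp cf = sin s & outp cf = sout s].

Definition reaches (p : program) cf n off s :=
  exists2 m, m <= n & let cf' := iter m (step p) cf in pc cf' = off /\ represents cf' s.

Lemma reaches_trans p cf n1 off1 s1 n2 off2 s2 : reaches p cf n1 off1 s1 ->
  (forall cf', pc cf' = off1 -> represents cf' s1 -> reaches p cf' n2 off2 s2) ->
  reaches p cf (n1 + n2) off2 s2.
Proof.
case=> m1 l1 [pc1 r1] /(_ _ pc1 r1) [m2 l2 [pc2 r2]].
by exists (m2 + m1); [lia | rewrite iterD].
Qed.

Lemma reaches_refl p cf off s n : pc cf = off -> represents cf s -> reaches p cf n off s.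
Proof. by exists 0. Qed.

Lemma rn_bound r : rn r < heap_base. Proof. by case: r. Qed.
Lemma heap_base_rn r a : (heap_base + a == rn r) = false.
Proof. by apply/negbTE; have := rn_bound r; rewrite neq_ltn; lia. Qed.

Lemma rn_eq2 r : (rn r == 2) = false. Proof. by case: r. Qed.
Lemma rn_eq3 r : (rn r == 3) = false. Proof. by case: r. Qed.
Lemma rn_eq4 r : (rn r == 4) = false. Proof. by case: r. Qed.
Lemma heap_base_eq2 a : (heap_base + a == 2) = false. Proof. by []. Qed.
Lemma heap_base_eq3 a : (heap_base + a == 3) = false. Proof. by []. Qed.
Lemma heap_base_eq4 a : (heap_base + a == 4) = false. Proof. by []. Qed.

Lemma rn_eq_heap r a : (rn r == heap_base + a) = false. Proof. by rewrite eq_sym heap_base_rn. Qed.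

Definition cell_eqE := (heap_base_rn, rn_eq2, rn_eq3, rn_eq4, heap_base_eq2, heap_base_eq3, heap_base_eq4).

Definition is_jump i := match i with IJz _ _ => true | IHalt => true | _ => false end.

Definition effect (i : instr) (cf : config) : config := step [:: i] (Config 0 (Defs.mem cf) (inp cf) (outp cf)).

Fixpoint effects (code : seq instr) (cf : config) : config :=
  if code is i :: code' then effects code' (effect i cf) else cf.

Lemma effects_pc code m m' mm ii oo :
  let c1 := effects code (Config m mm ii oo) in let c2 := effects code (Config m' mm ii oo) in
  [/\ Defs.mem c1 = Defs.mem c2, inp c1 = inp c2 & outp c1 = outp c2].
Proof. by case: code. Qed.

Lemma run_straight p off code cf : code_at p off code -> all (predC is_jump) code -> pc cf = off ->
  let cf1 := iter (size code) (step p) cf in let cf2 := effects code cf in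
  [/\ pc cf1 = off + size code, Defs.mem cf1 = Defs.mem cf2, inp cf1 = inp cf2 & outp cf1 = outp cf2].
Proof.
elim: code off cf => [|i code IH] off cf h /=; first by rewrite addn0.
case/andP => ji jc e; rewrite -iterS iterSr.
have h' : code_at p off.+1 code by move=> j lt; rewrite addSnnS h.
have hi : nth IHalt p (pc cf) = i by rewrite e -[off in LHS]addn0 h.
have e1 : [/\ pc (step p cf) = off.+1, Defs.mem (step p cf) = Defs.mem (effect i cf),
   inp (step p cf) = inp (effect i cf) & outp (step p cf) = outp (effect i cf)].
  rewrite /effect /step hi /= e; case: i ji {h hi} => //= r _; by case: (inp cf).
case: e1 => pc1 m1 i1 o1.
have [-> -> -> ->] := IH _ _ h' jc pc1.
rewrite addnS addSn; split=> //; move: m1 i1 o1;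
  case: (step p cf) => a1 a2 a3 a4; case: (effect i cf) => b1 b2 b3 b4 /= -> -> ->;
  by have [? ? ?] := effects_pc code a1 b1 b2 b3 b4.
Qed.

Lemma reaches_straight p off code cf s : code_at p off code -> all (predC is_jump) code -> pc cf = off ->
  represents (effects code cf) s -> reaches p cf (size code) (off + size code) s.
Proof.
move=> h j e [r1 r2 r3 r4]; have [e1 e2 e3 e4] := run_straight h j e.
exists (size code) => //; split=> //; split; by [move=> r; rewrite e2 | rewrite ?e3 ?e4].
Qed.

Lemma reaches_goto p off cf s l : code_at p off [:: IConst 2 0; IJz 2 l] -> pc cf = off ->
  represents cf s -> reaches p cf 2 l s.
Proof.
move=> /(@code_at_cat p off [:: IConst 2 0] [:: IJz 2 l]) [h1 h2] e [rr rh ri ro].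
have [e1 e2 e3 e4] := run_straight h1 isT e.
exists 2 => //=; move: e1 e2 e3 e4 => /=; set cf1 := step p cf => e1 e2 e3 e4.
have hi : nth IHalt p (pc cf1) = IJz 2 l by rewrite e1 -[off + 1]addn0 h2.
rewrite /step hi /= e2 /=; split=> //.
split=> [r|a| |] /=. all: rewrite ?e2 ?e3 ?e4 /= /upd ?cell_eqE //.
Qed.

Lemma reaches_test p off cf s r v l :
  code_at p off [:: IConst 2 v; ISub 3 (rn r) 2; ISub 4 2 (rn r); IAdd 3 3 4; IJz 3 l] ->
  pc cf = off -> represents cf s -> reaches p cf 5 (if rg s r == v then l else off + 5) s.
Proof.
move=> /(@code_at_cat p off [:: _; _; _; _] [:: IJz 3 l]) [h1 h2] e [rr rh ri ro].
have [e1 e2 e3 e4] := run_straight h1 isT e.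
exists 5 => //; rewrite iterS; move: e1 e2 e3 e4; set cf1 := iter _ _ _ => e1 e2 e3 e4.
have hi : nth IHalt p (pc cf1) = IJz 3 l by rewrite e1 -[off + _]addn0 h2.
rewrite /step hi /= e2 /=; split; last first.
  split=> [r'|a| |] /=; rewrite ?e2 ?e3 ?e4 /= /upd ?cell_eqE //.
rewrite /upd /= ?cell_eqE rr e1 addnS.
have -> : (rg s r - v + (v - rg s r) == 0) = (rg s r == v) by lia.
by [].
Qed.

Lemma reaches_jz p off cf s r l : code_at p off [:: IJz (rn r) l] -> pc cf = off ->
  represents cf s -> reaches p cf 1 (if rg s r == 0 then l else off.+1) s.
Proof.
move=> h e [rr rh ri ro]; exists 1 => //=.
have hi : nth IHalt p (pc cf) = IJz (rn r) l by rewrite e -[off]addn0 h.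
by rewrite /step hi /= rr e.
Qed.

Lemma compile_correct c : forall p off cf s, code_at p off (compile off c) ->
  pc cf = off -> represents cf s -> reaches p cf (clen c) (off + clen c) (run c s).
Proof.
elim: c => [|r v|r a|r v|r a o|a o b|a o v|r|v|c1 IH1 c2 IH2|r v c1 IH1 c2 IH2] p off cf s h e [rr rh ri ro].
- by apply: reaches_refl; rewrite ?addn0.
1-8: apply: (reaches_straight h) => //.
1-6: split=> //= [r'|a']; rewrite /upd ?cell_eqE ?(eqn_add2l, rr, rh, addn0) //=.
1-5: by rewrite addnCA ?rn_eq_heap ?(rh, cell_eqE, eqn_add2l).
- by move: ri => /=; rewrite /effect /step /=; case: (inp cf) => [|x l] ri; rewrite -ri; split=> //= [r'|a'];
    rewrite /upd ?cell_eqE // rr.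
- by split=> /=; [move=> r'|move=> a'| |]; rewrite /upd ?cell_eqE ?ro.
- have [h1 h2] := code_at_cat h; rewrite size_compile in h2.
  rewrite /= addnA; apply: reaches_trans (IH1 _ _ _ _ h1 e _) _; first by [].
  by move=> cf' e' r'; apply: IH2.
have [h0 /code_at_cat [h1 /code_at_cat [h2 h3]]] := code_at_cat h.
rewrite !size_compile in h2 h3.
rewrite -[clen (IfEq r v c1 c2)]/(5 + 2 + clen c2 + clen c1) [run _ _]/=.
rewrite -!addnA; apply: reaches_trans (reaches_test h0 e _) _ => //.
move=> cf1; case: ifP => _ e1 rep1.
  have e3 : off + (7 + clen c2) = off + 5 + clen c2 + 2 by lia.
  rewrite -e3 in h3; have [m le [pcm rm]] := IH1 _ _ _ _ h3 e1 rep1.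
  by exists m; [lia | split=> //; lia].
rewrite addnCA; apply: reaches_trans (IH2 _ _ _ _ h1 e1 rep1) _ => cf2 e2 rep2.
have [m le [pcm rm]] := reaches_goto h2 e2 rep2.
by exists m; [lia | split=> //; rewrite pcm /=; lia].
Qed.

Definition while_code off r c : seq instr :=
  IJz (rn r) (off + (3 + clen c)) :: compile off.+1 c ++ [:: IConst 2 0; IJz 2 off].

Lemma size_while_code off r c : size (while_code off r c) = 3 + clen c.
Proof. by rewrite /= size_cat size_compile /=; lia. Qed.

(** The number carried by the invariant drops in each round. A round costs one test, the body and
    two instructions to jump back, and [n.+1] also covers the final test. *)
Lemma while_correct r c (I : nat -> state -> Prop) p off n cf s :
  code_at p off (while_code off r c) -> pc cf = off -> represents cf s -> I n s ->
  (forall n s, I n s -> rg s r != 0 -> exists2 m, m < n & I m (run c s)) ->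
  exists s', [/\ rg s' r = 0, exists m, I m s' &
    reaches p cf ((clen c + 3) * n.+1) (off + (3 + clen c)) s'].
Proof.
move=> h e rep In step_ok.
have [h0 /code_at_cat [h1 h2]] := @code_at_cat p off [:: _] _ h.
rewrite size_compile in h2.
elim/ltn_ind: n cf s e rep In => n IH cf s e rep In.
have := reaches_jz h0 e rep; case: eqP => [r0|/eqP rn0] tst.
  exists s; split=> //; first by exists n.
  by case: tst => m le h'; exists m => //; lia.
have [m lt Im] := step_ok _ _ In rn0.
have round : reaches p cf (clen c + 3) off (run c s).
  have -> : clen c + 3 = 1 + (clen c + 2) by lia.
  apply: reaches_trans tst _ => cf1 e1 rep1.
  rewrite addn1 in h1 h2; apply: reaches_trans (compile_correct h1 e1 rep1) _ => cf2.
  exact: reaches_goto.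
case: round => q leq [eq repq].
have [s' [r0 Is' [q' leq' [eq' rep']]]] := IH m lt _ _ eq repq Im.
exists s'; split=> //; exists (q' + q); last by rewrite iterD.
by nia.
Qed.

Definition seqs (cs : seq cmd) : cmd := foldr Seq Skip cs.

(** Table lookup by comparison with every possible value. The cost is the length of the table, which
    depends on the grammar, [k] and [t] only. *)
Definition switch (r : reg) n (f : nat -> cmd) : cmd :=
  foldr (fun i c => IfEq r i (f i) c) Skip (iota 0 n).

Definition switch_fin (T : finType) (r : reg) (f : T -> cmd) : cmd :=
  foldr (fun x c => IfEq r (enum_rank x) (f x) c) Skip (enum T).

Lemma run_seqs_cat cs1 cs2 s : run (seqs (cs1 ++ cs2)) s = run (seqs cs2) (run (seqs cs1) s).
Proof. by elim: cs1 s => //= c cs1 IH s; rewrite IH. Qed.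

Lemma run_switch r n f s : rg s r < n -> run (switch r n f) s = run (f (rg s r)) s.
Proof.
rewrite /switch => lt; have : rg s r \in iota 0 n by rewrite mem_iota.
elim: (iota 0 n) => //= i l IH; rewrite inE; case: eqP => [->|] //= _; exact: IH.
Qed.

Lemma run_switch_fin (T : finType) r (f : T -> cmd) s x :
  rg s r = enum_rank x -> run (switch_fin r f) s = run (f x) s.
Proof.
rewrite /switch_fin => e; have : x \in enum T by rewrite mem_enum.
elim: (enum T) => //= y l IH; rewrite inE e.
case: (altP (x =P y)) => [-> _|ne /= /IH <-]; first by rewrite eqxx.
by rewrite ifN // (inj_eq val_inj) (inj_eq enum_rank_inj).
Qed.

(** A syntactic frame condition, decided by computation: no input or output takes place, and
    registers outside [l] are preserved. The heap is not restricted. *)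
Fixpoint only (l : seq nat) (c : cmd) : bool :=
  match c with
  | Const r _ | Mov r _ | AddC r _ | LoadAt r _ _ => rn r \in l
  | Skip | StoreAt _ _ _ | StoreC _ _ _ => true
  | Read _ | Write _ => false
  | Seq c1 c2 | IfEq _ _ c1 c2 => only l c1 && only l c2
  end.

Lemma only_run l c s : only l c ->
  [/\ forall r, rn r \notin l -> rg (run c s) r = rg s r, sin (run c s) = sin s & sout (run c s) = sout s].
Proof.
have setE r v s' : rn r \in l -> [/\ forall r', rn r' \notin l -> rg (setr s' r v) r' = rg s' r',
    sin (setr s' r v) = sin s' & sout (setr s' r v) = sout s'].
  by move=> rl; split=> // r' /= nl; case: eqP nl => [->|] //; rewrite rl.
elim: c s => [|r v|r a|r v|r a o|a o b|a o v|r|v|c1 IH1 c2 IH2|r v c1 IH1 c2 IH2] s //=;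
  try exact: setE.
  case/andP => /(IH1 s) [r1 i1 o1] /(IH2 (run c1 s)) [r2 i2 o2].
  by split=> [r nr||]; rewrite ?r2 ?r1 ?i2 ?o2.
by case/andP => /(IH1 s) h1 /(IH2 s) h2; case: ifP.
Qed.

Lemma only_seqs l cs : all (only l) cs -> only l (seqs cs).
Proof. by elim: cs => //= c cs IH /andP [-> /IH]. Qed.

Lemma only_switch l r n f : (forall i, only l (f i)) -> only l (switch r n f).
Proof. by move=> h; rewrite /switch; elim: (iota 0 n) => //= i s ->; rewrite h. Qed.

Lemma only_switch_fin (T : finType) l r (f : T -> cmd) : (forall x, only l (f x)) -> only l (switch_fin r f).
Proof. by move=> h; rewrite /switch_fin; elim: (enum T) => //= i s ->; rewrite h. Qed.

Lemma only_sub l l' c : {subset l <= l'} -> only l c -> only l' c.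
Proof.
move=> sub; elim: c => [|? ?|? ?|? ?|? ? ?|? ? ?|? ? ?|?|?|c1 IH1 c2 IH2|? ? c1 IH1 c2 IH2] //=;
  try exact: sub.
  by case/andP => /IH1 -> /IH2.
by case/andP => /IH1 -> /IH2.
Qed.

Lemma all_map_true (T U : Type) (a : pred U) (F : T -> U) l : (forall x, a (F x)) -> all a (map F l).
Proof. by move=> h; elim: l => //= x l ->; rewrite h. Qed.

Lemma only_seq l c1 c2 : only l c1 -> only l c2 -> only l (Seq c1 c2).
Proof. by move=> /= -> ->. Qed.

Lemma run_seq c1 c2 s : run (Seq c1 c2) s = run c2 (run c1 s).
Proof. by []. Qed.

Lemma run_ifeq r v c1 c2 s : run (IfEq r v c1 c2) s = if rg s r == v then run c1 s else run c2 s.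
Proof. by []. Qed.

(** * Finite tables and the representation of stacks and trees in memory *)

Section Heap.
Variables (G : cfg) (k t : nat).
Local Notation K := k.+1.
Local Notation tree := (ptree G).
Local Notation sym := (Nt G + Tm G)%type.
Local Notation rt := (@Defs.root G).
Local Notation roots := (map rt).
Local Notation key := (key G k).
Local Notation lookahead := (K.-tuple (option (Tm G))).
Implicit Types (T : tree) (cs g st : seq tree) (al ga be : seq sym) (f : frame G) (fs : seq (frame G)).
Implicit Types (z : key) (r : path G) (src : source G k) (h : nat -> nat).

(** There are finitely many states, so the frames and labels that any node can introduce form finite
    tables. They are stored in memory by their indices. *)
Definition all_sources : seq (source G k) :=
  flatten [seq root_shape t z | z <- enum {: key}] ++
  flatten [seq node_shape p.1 p.2 z | p <- enum {: nstate G k t * sym}, z <- enum {: key}].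

Definition frame_table : seq (frame G) := flatten [seq src.1 | src <- all_sources].
Definition label_table : seq (label G) :=
  flatten [seq if src.2 is inl l then [:: l] else [::] | src <- all_sources].
Definition tree_table : seq tree :=
  [seq Leaf a | a <- enum (Tm G)] ++ flatten [seq l.2 | l <- label_table] ++
  flatten [seq flatten (empty_threads lam) | lam : lookahead].

Lemma root_shape_all z : {subset root_shape t z <= all_sources}.
Proof.
move=> src h; rewrite mem_cat; apply/orP; left; apply/flatten_mapP.
by exists z; rewrite ?mem_enum.
Qed.

Lemma node_shape_all (s : nstate G k t) Y z : {subset node_shape s Y z <= all_sources}.
Proof.
move=> src h; rewrite mem_cat; apply/orP; right.
apply/flattenP; exists (node_shape s Y z) => //.
by apply/allpairsP; exists ((s, Y), z); rewrite !mem_enum.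
Qed.

Definition known src := {subset src.1 <= frame_table} /\
  if src.2 is inl l then l \in label_table else true.

Lemma all_sources_known src : src \in all_sources -> known src.
Proof.
move=> h; split; first by move=> f fi; apply/flatten_mapP; exists src.
case e: src.2 => [l|] //; apply/flatten_mapP; exists src; rewrite // e; exact: mem_head.
Qed.

Lemma node_shape_source (s : nstate G k t) Y z src z' j : src \in node_shape s Y z ->
  src.2 = inr (z', j) -> j < s.2 z'.
Proof.
move/mem_take/flatten_mapP => [[es [l|z1]] _] /=; first by rewrite inE => /eqP ->.
by case/mapP => j1; rewrite mem_iota => lt -> /= [<- <-].
Qed.

Lemma root_shape_source z src : src \in root_shape t z -> exists l, src.2 = inl l.
Proof. by move/mem_take/mapP => [[? l] _ ->]; exists l. Qed.

Lemma label_tree (l : label G) T : l \in label_table -> T \in l.2 -> T \in tree_table.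
Proof.
move=> ll Tl; rewrite mem_cat; apply/orP; right; rewrite mem_cat; apply/orP; left.
by apply/flatten_mapP; exists l.
Qed.

Lemma leaf_tree a : Leaf a \in tree_table.
Proof. by rewrite mem_cat map_f ?mem_enum. Qed.

Lemma empty_thread_tree (lam : lookahead) st T : st \in empty_threads lam -> T \in st -> T \in tree_table.
Proof.
move=> sl Ts; rewrite mem_cat; apply/orP; right; rewrite mem_cat; apply/orP; right.
apply/flattenP; exists (flatten (empty_threads lam)); first by apply/mapP; exists lam; rewrite ?mem_enum.
by apply/flattenP; exists st.
Qed.

(** * Heap layout *)

(* A node is [state; parent; base tree; context] followed by three cells [target; label; context] per slot. *)
Definition slot z i := 4 + 3 * (enum_rank z * t + i).
Definition block := 4 + 3 * (#|{: key}| * t).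

Lemma slot_block z i o : i < t -> o < 3 -> slot z i + o < block.
Proof.
move=> li lo; rewrite /slot /block -addnA ltn_add2l.
have := ltn_ord (enum_rank z); move: (enum_rank z : nat) => q lq.
have : q * t + i < #|{: key}| * t.
  by apply: (@leq_trans (q * t + t)); rewrite ?ltn_add2l // -mulSnr leq_mul2r lq orbT.
clear lq; move: (q * t + i) (#|_| * t) => x y; lia.
Qed.

Lemma slot_inj z i o z' i' o' : i < t -> i' < t -> o < 3 -> o' < 3 ->
  slot z i + o = slot z' i' + o' -> [/\ z = z', i = i' & o = o'].
Proof.
move=> li li' lo lo'; rewrite /slot => e.
have e1 : enum_rank z * t + i = enum_rank z' * t + i'.
  by move: e; move: (_ + i) (_ + i') => *; lia.
have eo : o = o' by move: e; rewrite e1; lia.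
have tpos : 0 < t by case: t li.
have := congr1 (divn^~ t) e1; rewrite /= !divnMDl // !divn_small // !addn0 => /val_inj/enum_rank_inj ez.
by move: e1; rewrite ez => /addnI.
Qed.

(** A tree under expansion. Frame lists are stored innermost first, but the output starts at the
    root; walking a list reverses it into such a chain, whose head is the outermost frame. *)
Inductive etree := EBase of tree | EFrame of seq tree & frame G & etree.
Fixpoint etree_tree (e : etree) : tree :=
  match e with
  | EBase T => T
  | EFrame st f e' => Node f.1.1 (rev (take (size (fbe f)) st) ++ etree_tree e' :: f.2)
  end.

Inductive item :=
| INode of tree & seq tree
| IEps of frame G
| IWalk of seq tree & seq (frame G) & etree
| ICell of etree.

Inductive obj :=
| ONode of seq tree
| OCtx of seq tree & frame G & seq (frame G)
| OThreads of seq tree & seq (seq tree)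
| OCell of etree
| OItem of item & seq item.

(* A ghost heap lists the allocated objects; the [i]-th one occupies the cells from [block * i.+1]. *)
Definition ptr (Gam : seq obj) p o := exists2 i, p = block * i.+1 & onth Gam i = Some o.

(** Address 0 is the null pointer; objects begin at the positive address [block]. *)
Definition ctx_ptr Gam p st fs := if fs is f :: fs' then ptr Gam p (OCtx st f fs') else p = 0.
Definition threads_ptr Gam p (L : seq (seq tree)) :=
  if L is st :: L' then ptr Gam p (OThreads st L') else p = 0.
Definition items_ptr Gam p (its : seq item) :=
  if its is it :: its' then ptr Gam p (OItem it its') else p = 0.

Definition drop_frames st fs := foldl (fun s f => drop (size (fbe f)) s) st fs.

Lemma apply_frames1 st T fs : (apply_frames st T fs).1 = drop_frames st fs.
Proof. by rewrite /apply_frames; elim: fs st T => //= f fs IH st T; rewrite IH. Qed.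

Definition tree_rep Gam b x T := exists st0 T0 fs,
  [/\ b = index T0 tree_table, T0 \in tree_table, ctx_ptr Gam x st0 fs & (apply_frames st0 T0 fs).2 = T].

Definition slot_rep Gam st r u c x :=
  [/\ ptr Gam u (ONode (drop_frames st r.1)), c = index r.2 label_table, r.2 \in label_table
    & ctx_ptr Gam x st r.1].

Definition path0 : path G := ([::], (inl (start G), [::])).

Definition slot_stack z st := drop (size z.1.2) st.

Definition slot_ok h Gam p st z i :=
  slot_rep Gam (slot_stack z st) (nth path0 (paths t (roots st) z) i)
    (h (p + slot z i)) (h (p + (slot z i + 1))) (h (p + (slot z i + 2))).

Definition frame_rep h Gam p st f :=
  [/\ h p = index f frame_table, f \in frame_table, ptr Gam (h (p + 1)) (ONode st) & size (fbe f) <= size st].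

Definition node_header h Gam p st :=
  h p = enum_rank (state_of k t (roots st)) /\
  if st is T :: st' then ptr Gam (h (p + 1)) (ONode st') /\ tree_rep Gam (h (p + 2)) (h (p + 3)) T else True.

Definition item_rep Gam it q x y : Prop :=
  match it with
  | INode T st => q = 1 /\ ptr Gam x (ONode (T :: st))
  | IEps f => [/\ q = 0, x = index f frame_table & f \in frame_table]
  | IWalk st fs e => [/\ q = 2, ctx_ptr Gam x st fs & ptr Gam y (OCell e)]
  | ICell e => q = 3 /\ ptr Gam x (OCell e)
  end.

Definition local h Gam p (o : obj) : Prop :=
  match o with
  | ONode st => node_header h Gam p st /\
      forall z i, i < size (paths t (roots st) z) -> slot_ok h Gam p st z i
  | OCtx st f fs => frame_rep h Gam p st f /\ ctx_ptr Gam (h (p + 2)) (drop (size (fbe f)) st) fs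
  | OThreads st L => ptr Gam (h p) (ONode st) /\ threads_ptr Gam (h (p + 1)) L
  | OCell (EBase T) => [/\ h p = size frame_table, h (p + 1) = index T tree_table & T \in tree_table]
  | OCell (EFrame st f e) => frame_rep h Gam p st f /\ ptr Gam (h (p + 2)) (OCell e)
  | OItem it its => item_rep Gam it (h p) (h (p + 1)) (h (p + 2)) /\ items_ptr Gam (h (p + 3)) its
  end.

(** While a node is being filled its slots are not yet meaningful, so the node is exempted from
    well-formedness. *)
Definition wf_except (P : nat -> Prop) h Gam := forall i o, ~ P i -> onth Gam i = Some o -> local h Gam (block * i.+1) o.
Definition wf h Gam := forall i o, onth Gam i = Some o -> local h Gam (block * i.+1) o.

Lemma onth_cat1 (T : Type) (s1 s2 : seq T) i x : onth s1 i = Some x -> onth (s1 ++ s2) i = Some x.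
Proof. by elim: s1 i => [|y s1 IH] [|i] //=; exact: IH. Qed.

Lemma onth_size (T : Type) (s : seq T) i x : onth s i = Some x -> i < size s.
Proof. by elim: s i => [|y s IH] [|i] //=; exact: IH. Qed.

Lemma onth_mid (T : Type) (s1 s2 : seq T) x : onth (s1 ++ x :: s2) (size s1) = Some x.
Proof. by elim: s1. Qed.

Lemma ptr_cat Gam D p o : ptr Gam p o -> ptr (Gam ++ D) p o.
Proof. by case=> i e h; exists i => //; apply: onth_cat1. Qed.

Lemma ctx_ptr_cat Gam D p st fs : ctx_ptr Gam p st fs -> ctx_ptr (Gam ++ D) p st fs.
Proof. by case: fs => //= f fs; exact: ptr_cat. Qed.

Lemma threads_ptr_cat Gam D p L : threads_ptr Gam p L -> threads_ptr (Gam ++ D) p L.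
Proof. by case: L => //= f fs; exact: ptr_cat. Qed.

Lemma items_ptr_cat Gam D p L : items_ptr Gam p L -> items_ptr (Gam ++ D) p L.
Proof. by case: L => //= f fs; exact: ptr_cat. Qed.

Lemma tree_rep_cat Gam D b x T : tree_rep Gam b x T -> tree_rep (Gam ++ D) b x T.
Proof. by case=> s [T0 [fs [? ? ? ?]]]; exists s, T0, fs; split=> //; apply: ctx_ptr_cat. Qed.

Lemma slot_rep_cat Gam D st r u c x : slot_rep Gam st r u c x -> slot_rep (Gam ++ D) st r u c x.
Proof. by case=> ? ? ? ?; split=> //; [apply: ptr_cat | apply: ctx_ptr_cat]. Qed.

Lemma item_rep_cat Gam D it q x y : item_rep Gam it q x y -> item_rep (Gam ++ D) it q x y.
Proof.
case: it => [T st|f|st fs e|e] //=.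
- by case=> ->; split=> //; exact: ptr_cat.
- by case=> ->; split=> //; [exact: ctx_ptr_cat | exact: ptr_cat].
by case=> ->; split=> //; exact: ptr_cat.
Qed.

Lemma paths_size al z : size (paths t al z) <= t.
Proof. by rewrite size_paths -ltnS ltn_ord. Qed.

Lemma local_cat h h' Gam D p o : local h Gam p o ->
  (forall a, a < block -> h' (p + a) = h (p + a)) -> local h' (Gam ++ D) p o.
Proof.
move=> loc eh.
have e0 : h' p = h p by rewrite -[p]addn0 eh.
have e1 : h' (p + 1) = h (p + 1) by rewrite eh.
have e2 : h' (p + 2) = h (p + 2) by rewrite eh.
have e3 : h' (p + 3) = h (p + 3) by rewrite eh.
have fr st f : frame_rep h Gam p st f -> frame_rep h' (Gam ++ D) p st f.
  by rewrite /frame_rep e0 e1 => -[? ? ? ?]; split=> //; apply: ptr_cat.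
case: o loc => [st|st f fs|st L|[T|st f e]|it its] /=; rewrite /node_header ?e0 ?e1 ?e2 ?e3.
- case=> -[-> hst] sl; split.
    by split=> //; case: st hst {sl} => // T st [? ?]; split; [exact: ptr_cat | exact: tree_rep_cat].
  move=> z i lt; have lit : i < t by apply: leq_trans lt (paths_size _ _).
  have := sl z i lt; rewrite /slot_ok !eh; first exact: slot_rep_cat.
  + exact: slot_block.
  + exact: slot_block.
  by rewrite -[slot z i]addn0; apply: slot_block.
- by case=> /fr ? ?; split=> //; exact: ctx_ptr_cat.
- by case=> ? ?; split; [exact: ptr_cat | exact: threads_ptr_cat].
- by [].
- by case=> /fr ? ?; split=> //; exact: ptr_cat.
by case=> ? ?; split; [exact: item_rep_cat | exact: items_ptr_cat].
Qed.

End Heap.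

(** * Construction of stack nodes *)

Section NodeCode.
Variables (G : cfg) (k t : nat).
Local Notation tree := (ptree G).
Local Notation sym := (Nt G + Tm G)%type.
Local Notation rt := (@Defs.root G).
Local Notation roots := (map rt).
Local Notation key := (key G k).
Local Notation source := (source G k).
Local Notation block := (block G k t).
Local Notation obj := (obj G).
Local Notation ptr := (@ptr G k t).
Local Notation ctx_ptr := (@ctx_ptr G k t).
Local Notation wf := (@wf G k t).
Local Notation wf_except := (@wf_except G k t).
Local Notation local := (@local G k t).
Local Notation slot := (@slot G k t).
Local Notation frame_table := (@frame_table G k t).
Local Notation label_table := (@label_table G k t).
Local Notation slot_ok := (@slot_ok G k t).
Local Notation node_header := (@node_header G k t).
Implicit Types (T : tree) (cs g st : seq tree) (al ga be : seq sym) (f : frame G) (fs : seq (frame G)).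
Implicit Types (z : key) (r : path G) (src : source) (h : nat -> nat) (Gam D : seq obj) (s : state).

Definition alloc (r : reg) := Seq (Mov r RHp) (AddC RHp block).

Definition heap_ok s Gam := rg s RHp = block * (size Gam).+1 /\ wf (hp s) Gam.

Lemma block_gt3 : 3 < block. Proof. by rewrite /block; lia. Qed.

Lemma block_neq i j a b : i <> j -> a < block -> b < block -> (block * i.+1 + a == block * j.+1 + b) = false.
Proof.
move=> ij la lb; apply/negbTE/eqP => e; apply: ij; apply: succn_inj.
have b0 : 0 < block by apply: leq_ltn_trans la.
have := congr1 (divn^~ block) e.
by rewrite /= ![block * _]mulnC !divnMDl // !divn_small // !addn0.
Qed.

Lemma wf_except_new (P : nat -> Prop) h h' Gam o : wf_except P h Gam ->
  (forall i a, ~ P i -> i < size Gam -> a < block -> h' (block * i.+1 + a) = h (block * i.+1 + a)) ->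
  (~ P (size Gam) -> local h' (Gam ++ [:: o]) (block * (size Gam).+1) o) -> wf_except P h' (Gam ++ [:: o]).
Proof.
move=> w eh lo i o' nP; case: (ltnP i (size Gam)) => [lt|ge].
  move=> hi; have hi' : onth Gam i = Some o'.
    by move: hi; elim: (Gam) i lt {nP} => [|x l IH] [|i] //=; apply: IH.
  by apply: local_cat (w i o' nP hi') _ => a la; apply: eh.
have ei : i < (size Gam).+1 -> i = size Gam by move=> *; lia.
move=> hi; have := onth_size hi; rewrite size_cat /= addn1 => /ei e.
by move: hi nP; rewrite e onth_mid => -[<-]; exact: lo.
Qed.

Lemma wf_new h h' Gam o : wf h Gam ->
  (forall i a, i < size Gam -> a < block -> h' (block * i.+1 + a) = h (block * i.+1 + a)) ->
  local h' (Gam ++ [:: o]) (block * (size Gam).+1) o -> wf h' (Gam ++ [:: o]).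
Proof.
move=> w eh lo i o' hi.
apply: (@wf_except_new (fun _ => False) h h' Gam o) hi => //; first by move=> j o2 _; exact: w.
by move=> j a _; exact: eh.
Qed.

(* The frames created at one node are unit frames, except possibly the outermost one. *)
Fixpoint last_pops fs : Prop :=
  if fs is f :: fs' then (fs' = [::] \/ fbe f = [::]) /\ last_pops fs' else True.

Definition source_ok st z src : Prop :=
  [/\ last_pops src.1, forall f, f \in src.1 -> f \in frame_table /\ size (fbe f) <= size st,
      src.1 <> [::] -> slot_stack z st = st &
      match src.2 with
      | inl l => [/\ l \in label_table, slot_stack z st = st & drop_frames st src.1 = st]
      | inr (z', j) => exists T st', [/\ st = T :: st', j < size (paths t (roots st') z') &
          drop_frames (slot_stack z st) src.1 = slot_stack z' st']
      end].

Definition path_of st src : path G :=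
  match src.2 with
  | inl l => (src.1, l)
  | inr (z', j) => extend_path src.1 (nth (path0 G) (paths t (roots (behead st)) z') j)
  end.

(** Each new frame records the node under construction as the stack on which it acts. This is
    correct because, by [last_pops], no frame before the outermost one changes the stack. *)
Definition cons_frame f : cmd := seqs
  [:: alloc RZ; StoreC RZ 0 (index f frame_table); StoreAt RZ 1 RS; StoreAt RZ 2 RE; Mov RE RZ].

(** An inherited outcome shares the target, the label and the context of the slot of the parent.
    Only the frames created at this node are added, outermost first, so the time does not depend on
    the length of the path. *)
Definition fill_slot (zi : key * nat * source) : cmd :=
  let: (z, i, src) := zi in
  seqs ((match src.2 with
    | inl l => [:: Mov RX RS; Const RY (index l label_table); Const RE 0]
    | inr (z', j) => [:: LoadAt RX RP (slot z' j); LoadAt RY RP (slot z' j + 1); LoadAt RE RP (slot z' j + 2)]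
    end) ++ map cons_frame (rev src.1) ++
    [:: StoreAt RS (slot z i) RX; StoreAt RS (slot z i + 1) RY; StoreAt RS (slot z i + 2) RE]).

Definition shape_slots (sh : key -> seq source) : seq (key * nat * source) :=
  flatten [seq [seq (z, i, nth ([::], inl (path0 G).2) (sh z) i) | i <- iota 0 (size (sh z))] | z <- enum {: key}].

Definition mk_node (code : nat) (sh : key -> seq source) : cmd :=
  seqs ([:: alloc RS; StoreC RS 0 code; StoreAt RS 1 RP; StoreAt RS 2 RB; StoreAt RS 3 RC] ++
        map fill_slot (shape_slots sh) ++ [:: Mov RP RS]).

Definition node_regs := map rn [:: RS; RX; RY; RE; RZ; RHp; RP].

Lemma only_mk_node c sh : only node_regs (mk_node c sh).
Proof.
apply: only_seqs; rewrite /= all_cat /= !andbT; apply: all_map_true => -[[z i] src].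
rewrite /fill_slot; apply: only_seqs; rewrite !all_cat /= andbT; apply/andP; split.
  by case: src.2 => [l|[z' j]].
exact: all_map_true.
Qed.

Section Building.
Variables (Gam : seq obj) (st : seq tree).
Let p := block * (size Gam).+1.

Definition building s D :=
  [/\ rg s RHp = block * (size Gam + size D).+2, rg s RS = p,
      wf_except (fun i => i = size Gam) (hp s) (Gam ++ ONode st :: D) &
      node_header (hp s) (Gam ++ ONode st :: D) p st].

Lemma node_header_cat h h' Gam' D' q st' : node_header h Gam' q st' ->
  (forall a, a < 4 -> h' (q + a) = h (q + a)) -> node_header h' (Gam' ++ D') q st'.
Proof.
move=> [hq hs] eh; rewrite /node_header -[q in h' q]addn0 !eh // addn0; split=> //.
by case: st' hs {hq} => // T st' [? ?]; split; [exact: ptr_cat | exact: tree_rep_cat].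
Qed.

Lemma cons_frame_ok s D f fs : building s D -> f \in frame_table -> size (fbe f) <= size st ->
  ctx_ptr (Gam ++ ONode st :: D) (rg s RE) (drop (size (fbe f)) st) fs ->
  let s' := run (cons_frame f) s in let D' := D ++ [:: OCtx st f fs] in
  [/\ building s' D', ctx_ptr (Gam ++ ONode st :: D') (rg s' RE) st (f :: fs),
      rg s' RX = rg s RX, rg s' RY = rg s RY & forall a, a < block -> hp s' (p + a) = hp s (p + a)].
Proof.
move=> [eH eS w hd] fT lf cx s' D'; have b3 := block_gt3.
have eG : Gam ++ ONode st :: D' = (Gam ++ ONode st :: D) ++ [:: OCtx st f fs] by rewrite -catA.
have sG : size (Gam ++ ONode st :: D) = (size Gam + size D).+1 by rewrite size_cat /= addnS.
pose q := block * (size Gam + size D).+2.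
have hE i a : i < (size Gam + size D).+1 -> a < block -> hp s' (block * i.+1 + a) = hp s (block * i.+1 + a).
  by move=> li la; rewrite /s' /= eH /upd !block_neq //; lia.
have loc : local (hp s') (Gam ++ ONode st :: D') q (OCtx st f fs).
  rewrite /= /frame_rep /s' /= eH -/q /upd.
  have q1 : (q == q + 1) = false by lia.
  have q2 : (q == q + 2) = false by lia.
  rewrite addn0 !eqn_add2l q1 q2 /= !eqxx eS; split; last by rewrite eG; apply: ctx_ptr_cat.
  split=> //; exists (size Gam) => //; by rewrite onth_mid.
split=> //.
- split=> //; first by rewrite /s' /= eH size_cat /= addn1 addnS; lia.
    rewrite eG; apply: wf_except_new w _ _ => [i a _|_]; rewrite sG; first exact: hE.
    by rewrite -eG.
  rewrite eG; apply: node_header_cat hd _ => a la; apply: hE; lia.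
- rewrite /s' /= eH; exists (size Gam + size D).+1 => //; by rewrite eG -sG onth_mid.
- move=> a la; apply: hE => //; lia.
Qed.

Lemma cons_frames_ok st0 fs fs2 s D : building s D -> last_pops fs -> (fs <> [::] -> st0 = st) ->
  (forall f, f \in fs -> f \in frame_table /\ size (fbe f) <= size st) ->
  ctx_ptr (Gam ++ ONode st :: D) (rg s RE) (drop_frames st0 fs) fs2 ->
  let s' := run (seqs (map cons_frame (rev fs))) s in exists D2, let D' := D ++ D2 in
  [/\ building s' D', ctx_ptr (Gam ++ ONode st :: D') (rg s' RE) st0 (fs ++ fs2),
      rg s' RX = rg s RX, rg s' RY = rg s RY & forall a, a < block -> hp s' (p + a) = hp s (p + a)].
Proof.
move=> bd; elim: fs st0 => [|f fs IH] st0 /=.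
  by move=> _ _ _ cx; exists [::]; rewrite cats0.
case=> lf lp e0 fok; have {e0}-> : st0 = st by apply: e0.
have [fT lef] := fok f (mem_head _ _).
move=> cx; have [||D1 [b1 c1 x1 y1 h1]] := IH (drop (size (fbe f)) st) lp _ _ cx.
- by case: lf => [->|-> _] //; rewrite drop0.
- by move=> f' fi; apply: fok; rewrite inE fi orbT.
rewrite rev_cons map_rcons -cats1 run_seqs_cat [seqs [:: _]]/=.
have [b2 c2 x2 y2 h2] := cons_frame_ok b1 fT lef c1.
exists (D1 ++ [:: OCtx st f (fs ++ fs2)]); rewrite catA; split=> //.
by move=> a la; apply: etrans (h2 a la) (h1 a la).
Qed.

Lemma fill_slot_ok s D z i src : building s D -> source_ok st z src -> i < t ->
  nth (path0 G) (paths t (roots st) z) i = path_of st src ->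
  (forall T st', st = T :: st' -> ptr Gam (rg s RP) (ONode st')) ->
  let s' := run (fill_slot (z, i, src)) s in exists D2, let D' := D ++ D2 in
  [/\ building s' D', slot_ok (hp s') (Gam ++ ONode st :: D') p st z i &
      forall z1 i1 o, (z1, i1) <> (z, i) -> i1 < t -> o < 3 ->
        hp s' (p + (slot z1 i1 + o)) = hp s (p + (slot z1 i1 + o))].
Proof.
move=> bd [lp fok e0 tgt] lit nthE rp; move es' : (run _ s) => s'; move: es' => /=.
set pre := match src.2 with inl _ => _ | inr _ => _ end.
(* Here [fs2] is the part of the frame list that is inherited from the parent; it is empty for an
   outcome that ends at this node. *)
have [fs2 [u [c [[b1 cx1 ex1 ey1 eh1] [p1 p2 p3 p4]]]]] : exists fs2 u c, let s1 := run (seqs pre) s in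
    [/\ building s1 D, ctx_ptr (Gam ++ ONode st :: D) (rg s1 RE) (drop_frames (slot_stack z st) src.1) fs2,
      rg s1 RX = u, rg s1 RY = c & hp s1 = hp s] /\
    [/\ (path_of st src).1 = src.1 ++ fs2,
      ptr (Gam ++ ONode st :: D) u (ONode (drop_frames (slot_stack z st) (src.1 ++ fs2))),
      c = index (path_of st src).2 label_table & (path_of st src).2 \in label_table].
  case: bd => eH eS w hd; rewrite /pre /path_of; case: src.2 tgt => [l|[z' j]].
    case=> lT es ed; exists [::], p, (index l label_table); split=> //=.
    rewrite cats0; split=> //; rewrite es ed.
    by exists (size Gam) => //; rewrite onth_mid.
  case=> T [st' [est lj ed]]; have [i0 ei0 hi0] := rp _ _ est.
  have ni0 : i0 <> size Gam by have := onth_size hi0; lia.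
  have [_ /(_ z' j lj) [pu ec cT cx]] := w i0 _ ni0 (onth_cat1 _ hi0).
  set r' := nth _ _ _ in pu ec cT cx.
  rewrite -ei0 in pu ec cx.
  exists r'.1, (hp s (rg s RP + slot z' j)), (hp s (rg s RP + (slot z' j + 1))).
  split; first by split=> //=; rewrite ed.
  have -> : drop_frames (slot_stack z st) (src.1 ++ r'.1) = drop_frames (slot_stack z' st') r'.1.
    by rewrite -ed /drop_frames foldl_cat.
  by rewrite est /= -/r'; split=> //; rewrite -est.
rewrite !run_seqs_cat -/pre; set s1 := run (seqs pre) s in b1 cx1 ex1 ey1 eh1 * => es'.
have [D2 [b2 cx2 ex2 ey2 eh2]] := cons_frames_ok b1 lp e0 fok cx1.
set s2 := run _ s1 in b2 cx2 ex2 ey2 eh2 es'.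
case: b2 => eH2 eS2 w2 hd2.
exists D2; rewrite /building /=; set Gam' := Gam ++ ONode st :: D ++ D2 in cx2 w2 hd2 *.
have hE a : (forall o, o < 3 -> a <> p + (slot z i + o)) -> hp s' a = hp s2 a.
  move=> na; rewrite -es' /= eS2 /upd.
  have := na 0 isT; have := na 1 isT; have := na 2 isT.
  by rewrite addn0 => n2 n1 n0; do 3 case: eqP => //.
have l1 : forall o, o < 3 -> slot z i + o < block by move=> o; apply: slot_block.
split.
- split; [by rewrite -es' | by rewrite -es' | |].
    move=> i1 o1 ni1 hi1; rewrite -[Gam']cats0; apply: local_cat (w2 _ _ ni1 hi1) _ => a la.
    by apply: hE => o lo; apply/eqP; rewrite /p block_neq // l1.
  rewrite -[Gam']cats0; apply: node_header_cat hd2 _ => a la; apply: hE => o lo.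
  by rewrite /slot; lia.
- rewrite /slot_ok nthE -es' /= eS2 /upd.
  have e1 : (p + (slot z i) == p + (slot z i + 2)) = false by lia.
  have e2 : (p + (slot z i) == p + (slot z i + 1)) = false by lia.
  have e3 : (p + (slot z i + 1) == p + (slot z i + 2)) = false by lia.
  rewrite e1 e2 e3 !eqxx ex2 ey2 ex1 ey1; split=> //; rewrite ?p1 //.
  by rewrite /Gam' -cat_cons catA; apply: ptr_cat.
move=> z1 i1 o ne li1 lo; rewrite hE; last first.
  by move=> o' lo' /addnI /slot_inj []// *; apply: ne; congr pair.
by rewrite eh2 ?eh1 //; apply: slot_block.
Qed.

Lemma fill_slots_ok sl s D : building s D ->
  uniq (map fst sl) ->
  (forall z i src, (z, i, src) \in sl -> [/\ source_ok st z src, i < t &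
    nth (path0 G) (paths t (roots st) z) i = path_of st src]) ->
  (forall T st', st = T :: st' -> ptr Gam (rg s RP) (ONode st')) ->
  let s' := run (seqs (map fill_slot sl)) s in exists D2, let D' := D ++ D2 in
  [/\ building s' D', forall z i, (z, i) \in map fst sl -> slot_ok (hp s') (Gam ++ ONode st :: D') p st z i &
      forall z1 i1 o, (z1, i1) \notin map fst sl -> i1 < t -> o < 3 ->
        hp s' (p + (slot z1 i1 + o)) = hp s (p + (slot z1 i1 + o))].
Proof.
elim: sl s D => [|[[z i] src] sl IH] s D bd /=.
  by move=> _ _ _; exists [::]; rewrite cats0.
case/andP => nz us ok rp.
have [sok lit nE] := ok z i src (mem_head _ _).
have [D1 [b1 s1 h1]] := fill_slot_ok bd sok lit nE rp.
set s' := run _ s in b1 s1 h1 *.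
have rpE : rg s' RP = rg s RP.
  have : only (map rn [:: RS; RX; RY; RE; RZ; RHp]) (fill_slot (z, i, src)).
    rewrite /fill_slot; apply: only_seqs; rewrite !all_cat /= andbT; apply/andP; split.
      by case: src.2 => [l|[z' j]].
    exact: all_map_true.
  by case/(only_run s) => + _ _; exact.
have [||D2 [b2 s2 h2]] := IH s' _ b1 us.
- by move=> z1 i1 src1 h; apply: ok; rewrite inE h orbT.
- by move=> T st' e; rewrite rpE; apply: rp e.
exists (D1 ++ D2); rewrite catA; split=> //.
  move=> z1 i1; rewrite inE => /predU1P [[-> ->]|]; last exact: s2.
  have := s1; rewrite /slot_ok -(h2 z i 1) // -(h2 z i 2) // -[slot z i]addn0 -(h2 z i 0) //.
  have -> : Gam ++ ONode st :: (D ++ D1) ++ D2 = (Gam ++ ONode st :: D ++ D1) ++ D2 by rewrite -[RHS]catA.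
  exact: slot_rep_cat.
move=> z1 i1 o; rewrite inE negb_or => /andP [ne ni] li lo.
by rewrite h2 // h1 //; apply/eqP.
Qed.

End Building.
End NodeCode.

Lemma enum_prop_sub (T : eqType) (P : T -> Prop) x : x \in enum_prop P -> P x.
Proof. by rewrite /enum_prop; case: pselect => // e; case: cid => /= L [_ h] /h. Qed.

(** * Pushing nodes and moving all stacks over one input symbol *)

Section ThreadCode.
Variables (G : cfg) (k t : nat).
Local Notation K := k.+1.
Local Notation tree := (ptree G).
Local Notation sym := (Nt G + Tm G)%type.
Local Notation rt := (@Defs.root G).
Local Notation roots := (map rt).
Local Notation key := (key G k).
Local Notation lookahead := (K.-tuple (option (Tm G))).
Local Notation source := (source G k).
Local Notation block := (block G k t).
Local Notation obj := (obj G).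
Local Notation ptr := (@ptr G k t).
Local Notation slot := (@slot G k t).
Local Notation label_table := (@label_table G k t).
Local Notation tree_table := (@tree_table G k t).
Local Notation slot_ok := (@slot_ok G k t).
Local Notation node_header := (@node_header G k t).
Implicit Types (T : tree) (cs g st : seq tree) (al ga be : seq sym) (f : frame G) (fs : seq (frame G)).
Implicit Types (z : key) (r : path G) (src : source) (h : nat -> nat) (Gam D : seq obj) (s : state).

Local Notation alloc := (@alloc G k t).
Local Notation heap_ok := (@heap_ok G k t).
Local Notation source_ok := (@source_ok G k t).
Local Notation path_of := (@path_of G k t).
Local Notation mk_node := (@mk_node G k t).
Local Notation building := (@building G k t).
Local Notation nstate := (nstate G k t).
Local Notation state_of := (@state_of G k t).
Local Notation paths := (@paths G k t).
Local Notation tree_rep := (@tree_rep G k t).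
Local Notation threads_ptr := (@threads_ptr G k t).

Definition shape_of al : key -> seq source :=
  if al is Y :: al' then node_shape (state_of al') Y else @root_shape G k t.

Lemma size_shape_of al z : size (shape_of al z) = size (paths al z).
Proof. by case: al => [|Y al] /=; rewrite size_map. Qed.

Lemma root_sources z src : src \in root_shape t z -> source_ok [::] z src.
Proof.
move=> si; have [fT lT] := all_sources_known (root_shape_all si).
move: si => /mem_take/mapP [r /enum_prop_sub + e]; rewrite e /= in fT lT *.
case: z => [[X rb] lam] [_ _ ok _ _]; have {ok} u : all (fun f => fbe f == [::]) r.1.
  by apply: (@frames_ok_nil _ X); move: ok; case: (size _).
have d0 fs : drop_frames [::] fs = [::] :> seq tree by elim: fs.
split=> //=.
- by elim: (r.1) u => //= f fs IH /andP [/eqP -> /IH]; split=> //; right.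
by move=> f fi; split; [exact: fT | move/allP: u => /(_ f fi)/eqP ->].
Qed.

Lemma drop_unit_frames fs st : all (fun f => fbe f == [::]) fs -> drop_frames st fs = st.
Proof. by elim: fs st => //= f fs IH st /andP [/eqP e /IH]; rewrite /drop_frames /= e drop0. Qed.

Lemma last_pops_unit fs f : all (fun f => fbe f == [::]) fs -> last_pops fs /\ last_pops (rcons fs f).
Proof.
elim: fs => [|f' fs IH] /=; first by split=> //; split=> //; left.
by case/andP => /eqP e /IH [? ?]; split; split=> //; right.
Qed.

Section Threads.
Hypothesis xlr : XLR G K t.

Lemma node_sources T st' z src : vall st' ->
  src \in node_shape (state_of (roots st')) (rt T) z -> source_ok (T :: st') z src.
Proof.
move=> vst si; have [fT lT] := all_sources_known (node_shape_all si).
have jT := node_shape_source si.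
move: si => /mem_take/flatten_mapP [e /enum_prop_sub + ei]; rewrite state_of_items.
case: z => [[X rb] lam]; rewrite /is_exit; case: e ei => es [l|z'] /=.
  rewrite inE => /eqP e; rewrite e /= in fT lT *.
  case erb: (bseqval rb) => [|Y rb'] //; case: l {e} lT => B g lT [_ /frames_ok_nil u _ _ _].
  have s0 : slot_stack (X, rb, lam) (T :: st') = T :: st' by rewrite /slot_stack /= erb.
  split=> //=; first by have [] := last_pops_unit (start G, [::], [::]) u.
    by move=> f fi; split; [exact: fT | move/allP: u => /(_ f fi)/eqP ->].
  by rewrite s0 drop_unit_frames.
case/mapP => j _ e; rewrite e /= in fT lT jT *.
have {}jT := jT _ _ erefl; rewrite -size_paths in jT.
(* The outcome referred to is a genuine path of the parent, so its pending pops fit the parent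
   stack. This bounds the size of the popping frame. *)
have pj : prefix z'.1.2 (roots st').
  have [_ /(_ _)] := pathsP xlr z' vst.
  by case/(_ (nth (path0 G) (paths (roots st') z') j)) => /(_ (mem_nth _ jT)); case: (z') => [[? ?] ?] [].
case erb: (bseqval rb) => [|Y rb'].
  case=> us [f [rb' [_ ees /frames_ok_nil u okf [ef ez _]]]]; rewrite ez in pj jT *; rewrite ees in fT *.
  have le : size rb' <= maxrhs G by apply: ltnW; apply: ltnW; have := frame_ok_size okf; rewrite ef.
  have s0 : slot_stack (X, rb, lam) (T :: st') = T :: st' by rewrite /slot_stack /= erb.
  have sle : size rb' <= size st' by move: pj; rewrite /= bsK // => /size_prefix; rewrite size_map.
  split=> //=.
  - by have [] := last_pops_unit f u.
  - move=> f'; rewrite mem_rcons inE => fi; split.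
      by apply: fT; rewrite mem_rcons inE.
    case/predU1P: fi => [->|fi]; first by rewrite ef.
    by move/allP: u => /(_ f' fi)/eqP ->.
  exists T, st'; split=> //.
  by rewrite s0 /drop_frames -cats1 foldl_cat -/(drop_frames _ us) drop_unit_frames //= ef /slot_stack /= bsK.
case=> -> eY ez _; rewrite ez in pj jT *.
have le : size rb' <= maxrhs G by have := size_bseq rb; rewrite erb; apply: ltnW.
split=> //=; exists T, st'; split=> //.
by rewrite /slot_stack /= erb bsK.
Qed.

Lemma shape_slots_mem sh z i src : (z, i, src) \in shape_slots sh ->
  i < size (sh z) /\ src = nth ([::], inl (path0 G).2) (sh z) i.
Proof.
case/flatten_mapP => z' _ /mapP [i']; rewrite mem_iota => lt [-> -> ->]; by [].
Qed.

Lemma shape_slots_has (sh : key -> seq source) z i : i < size (sh z) -> (z, i) \in map fst (shape_slots sh).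
Proof.
move=> lt; apply/mapP; exists (z, i, nth ([::], inl (path0 G).2) (sh z) i) => //.
by apply/flatten_mapP; exists z; rewrite ?mem_enum //; apply/mapP; exists i; rewrite // mem_iota.
Qed.

Lemma shape_slots_uniq (sh : key -> seq source) : uniq (map fst (shape_slots sh)).
Proof.
rewrite /shape_slots map_flatten -map_comp; apply: uniq_flatten_disjoint; first exact: enum_uniq.
  by move=> z _ /=; rewrite -map_comp map_inj_uniq ?iota_uniq // => i j [].
move=> z z' u _ _ /= /mapP [? /mapP [i _ ->] ->] /mapP [? /mapP [j _ ->]]; by case.
Qed.

Lemma nth_paths st z i : i < size (paths (roots st) z) -> (st = [::] \/ vall (behead st)) ->
  nth (path0 G) (paths (roots st) z) i = path_of st (nth ([::], inl (path0 G).2) (shape_of (roots st) z) i)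
  /\ source_ok st z (nth ([::], inl (path0 G).2) (shape_of (roots st) z) i).
Proof.
rewrite -size_shape_of; case: st => [|T st] /= lt vst.
  have si := mem_nth ([::], inl (path0 G).2) lt; split; last exact: root_sources.
  rewrite (nth_map ([::], inl (path0 G).2)) // /path_of.
  by have [l ->] := root_shape_source si.
have {}vst : vall st by case: vst.
have si := mem_nth ([::], inl (path0 G).2) lt; split; last exact: node_sources.
rewrite (nth_map ([::], inl (path0 G).2)) // /path_of.
have jT := node_shape_source si.
case: (nth _ _ _) jT => es [l|[z' j]] //= jT.
by rewrite (set_nth_default (path0 G)) // size_paths; apply: jT.
Qed.

Lemma mk_node_ok s Gam st : heap_ok s Gam -> vall st ->
  (forall T st', st = T :: st' -> ptr Gam (rg s RP) (ONode st') /\ tree_rep Gam (rg s RB) (rg s RC) T) ->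
  let s' := run (mk_node (enum_rank (state_of (roots st))) (shape_of (roots st))) s in
  exists D, heap_ok s' (Gam ++ D) /\ ptr (Gam ++ D) (rg s' RP) (ONode st).
Proof.
move=> [eH w] vst par; have b3 := block_gt3 G k t.
move es' : (run _ s) => s'; move: es'; rewrite /mk_node !run_seqs_cat.
set s1 := run (seqs [:: alloc RS; _; _; _; _]) s; move=> es'.
set p := block * (size Gam).+1.
have hE i a : i < size Gam -> a < block -> hp s1 (block * i.+1 + a) = hp s (block * i.+1 + a).
  by move=> li la; rewrite /s1 /= eH /upd !block_neq //; lia.
have b1 : building Gam st s1 [::].
  split; [by rewrite /s1 /= eH addn0; lia | by rewrite /s1 /= eH | |].
    apply: (wf_except_new (h := hp s)) => [i o _|i a _|[]] //; [exact: w | exact: hE].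
  rewrite /node_header /s1 /= eH -/p /upd.
  rewrite !addn0 !eqn_add2l !eqxx.
  have q1 : (p == p + 1) = false by lia.
  have q2 : (p == p + 2) = false by lia.
  have q3 : (p == p + 3) = false by lia.
  rewrite q1 q2 q3 /=; split=> //; case: (st) par => // T st' /(_ _ _ erefl) [? ?].
  by split; [exact: ptr_cat | exact: tree_rep_cat].
have vb : st = [::] \/ vall (behead st) by case: (st) vst => [|T st'] /=; [left | case; right].
have [|||D2 [[eH2 eS2 w2 hd2] s2 _]] := fill_slots_ok (sl := shape_slots (shape_of (roots st))) b1.
- exact: shape_slots_uniq.
- move=> z i src /shape_slots_mem [lt ->]; rewrite size_shape_of in lt.
  have [e ok] := nth_paths lt vb; split=> //; apply: leq_trans lt _; exact: paths_size.
- move=> T st' e; have -> : rg s1 RP = rg s RP by [].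
  by case: (par _ _ e).
set s3 := run _ s1 in es' eH2 eS2 w2 hd2 s2.
have e1 : rg s' RHp = rg s3 RHp by rewrite -es'.
have e2 : rg s' RP = p by rewrite -es' /= eS2.
have e3 : hp s' = hp s3 by rewrite -es'.
exists (ONode st :: D2); split; last by rewrite e2; exists (size Gam); rewrite ?onth_mid.
split; first by rewrite e1 eH2 cat0s size_cat /= [in RHS]addnS.
rewrite e3 => i o hi; case: (eqVneq i (size Gam)) => [ei|/eqP ni]; last exact: w2.
move: hi; rewrite ei onth_mid => -[<-]; split; first exact: hd2.
by move=> z i2 lt; apply: s2; apply: shape_slots_has; rewrite size_shape_of.
Qed.

Definition push_node (q : nstate) (Y : sym) : cmd := mk_node (enum_rank (next_state q Y)) (node_shape q Y).

(** The states reached by successive pushes are computed when the program is generated; at run time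
    only the first one is looked up. *)
Fixpoint push_trees (q : nstate) g : cmd :=
  if g is E :: g' then
    seqs [:: Const RB (index E tree_table); Const RC 0; push_node q (rt E); push_trees (next_state q (rt E)) g']
  else Skip.

Definition push_regs := map rn [:: RB; RC] ++ node_regs.

Lemma only_push_node q Y : only push_regs (push_node q Y).
Proof. by apply: (only_sub _ (only_mk_node _ _ _)) => x xi; rewrite mem_cat xi orbT. Qed.

Lemma only_push_trees q g : only push_regs (push_trees q g).
Proof.
elim: g q => // E g IH q; do 2 (apply: only_seq; first by []).
by apply: only_seq (only_push_node _ _) _; apply: only_seq (IH _) _.
Qed.

Lemma push_node_ok s Gam T st : heap_ok s Gam -> vall (T :: st) -> ptr Gam (rg s RP) (ONode st) ->
  tree_rep Gam (rg s RB) (rg s RC) T ->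
  let s' := run (push_node (state_of (roots st)) (rt T)) s in
  exists D, heap_ok s' (Gam ++ D) /\ ptr (Gam ++ D) (rg s' RP) (ONode (T :: st)).
Proof. by move=> ok v hp1 tr; apply: (mk_node_ok (st := T :: st)) => // T' st' [<- <-]. Qed.

Lemma push_trees_ok s Gam st g : heap_ok s Gam -> vall st -> vall g -> {subset g <= tree_table} ->
  ptr Gam (rg s RP) (ONode st) ->
  let s' := run (push_trees (state_of (roots st)) g) s in
  exists D, heap_ok s' (Gam ++ D) /\ ptr (Gam ++ D) (rg s' RP) (ONode (rev g ++ st)).
Proof.
elim: g s Gam st => [|E g IH] s Gam st ok vst vg sub pt; first by exists [::]; rewrite cats0.
have ET : E \in tree_table by apply: sub; rewrite mem_head.
have tr : tree_rep Gam (index E tree_table) 0 E by exists [::], E, [::].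
case: vg => vE vg; pose s1 := setr (setr s RB (index E tree_table)) RC 0.
have [|||D1 [ok1 pt1]] := @push_node_ok s1 Gam E st ok; [by split | exact: pt | exact: tr |].
have [||D2 [ok2 pt2]] := IH _ _ (E :: st) ok1 _ vg _ pt1; first by split.
  by move=> x xi; apply: sub; rewrite inE xi orbT.
by exists (D1 ++ D2); rewrite catA rev_cons cat_rcons; split.
Qed.

Definition cons_thread : cmd :=
  seqs [:: alloc RZ; StoreAt RZ 0 RP; StoreAt RZ 1 RNew; Mov RNew RZ].

Lemma cons_thread_ok s Gam st L : heap_ok s Gam -> ptr Gam (rg s RP) (ONode st) ->
  threads_ptr Gam (rg s RNew) L ->
  let s' := run cons_thread s in exists D, heap_ok s' (Gam ++ D) /\ threads_ptr (Gam ++ D) (rg s' RNew) (st :: L).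
Proof.
move=> [eH w] pt tp /=; have b3 := block_gt3 G k t; exists [:: OThreads st L].
split; last by rewrite eH; exists (size Gam) => //; rewrite onth_mid.
split; first by rewrite /= eH size_cat /= addn1; lia.
apply: wf_new w _ _; first by move=> i a li la; rewrite /= eH /upd !block_neq //; lia.
rewrite /= eH /upd !addn0.
have -> : (block * (size Gam).+1 == block * (size Gam).+1 + 1) = false by lia.
by rewrite !eqxx; split; [exact: ptr_cat | exact: threads_ptr_cat].
Qed.

Definition load_slot z i : cmd := seqs
  [:: LoadAt RP RV (slot z i); LoadAt RD RV (slot z i + 1); LoadAt RC RV (slot z i + 2)].

Definition push_label : cmd :=
  switch_fin RX (fun q : nstate => switch RD (size label_table) (fun c =>
    let l := nth (path0 G).2 label_table c in Seq (push_node q l.1) (push_trees (next_state q l.1) l.2))).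

Definition one_result a (lam : lookahead) i : cmd :=
  Seq (load_slot (shift_key a lam) i)
  (Seq (seqs [:: Const RB (index (Leaf a) tree_table); LoadAt RX RP 0]) (Seq push_label cons_thread)).

Definition thread_regs := push_regs ++ map rn [:: RD; RNew].

Lemma only_one_result a lam i : only thread_regs (one_result a lam i).
Proof.
apply: only_seq => //; apply: only_seq => //; apply: only_seq => //.
apply: only_switch_fin => q; apply: only_switch => c.
have sub : {subset push_regs <= thread_regs} by move=> x xi; rewrite mem_cat xi.
by apply: only_seq; apply: only_sub sub _; [exact: only_push_node | exact: only_push_trees].
Qed.

Lemma slot_stack_shift a (lam : lookahead) st : slot_stack (shift_key a lam) st = st.
Proof. by rewrite /slot_stack /= bsK // drop0. Qed.

Lemma node_slots s Gam p st z i : heap_ok s Gam -> ptr Gam p (ONode st) -> i < size (paths (roots st) z) ->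
  slot_ok (hp s) Gam p st z i.
Proof. by move=> [_ w] [j -> /w [_]]; apply. Qed.

Lemma node_state s Gam p st : heap_ok s Gam -> ptr Gam p (ONode st) ->
  hp s p = enum_rank (state_of (roots st)).
Proof. by move=> [_ w] [j -> /w [[]]]. Qed.

Lemma one_result_ok s Gam a (lam : lookahead) st i L : heap_ok s Gam -> ptr Gam (rg s RV) (ONode st) -> vall st ->
  i < size (paths (roots st) (shift_key a lam)) -> threads_ptr Gam (rg s RNew) L ->
  let s' := run (one_result a lam i) s in
  exists D, heap_ok s' (Gam ++ D) /\ threads_ptr (Gam ++ D) (rg s' RNew)
    (path_forest st (Leaf a) (nth (path0 G) (paths (roots st) (shift_key a lam)) i) :: L).
Proof.
set z := shift_key a lam => ok pv vst lt tp; set r := nth _ _ _.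
have := node_slots ok pv lt; rewrite /slot_ok slot_stack_shift -/r => -[pu ec lT cx].
have : is_path (roots st) z r by apply/(proj2 (pathsP xlr z vst)); apply: mem_nth.
move=> /is_shift_path [okf [vg _] [eB _]].
have [v1 v2 rE _] := apply_frames_spec (T := Leaf a) vst I okf.
rewrite -/(roots _) in rE.
set c := apply_frames st (Leaf a) r.1 in v1 v2 rE.
have c1 : c.1 = drop_frames st r.1 by rewrite apply_frames1.
rewrite -c1 in pu.
pose s1 := run (seqs [:: Const RB (index (Leaf a) tree_table); LoadAt RX RP 0]) (run (load_slot z i) s).
have ok1 : heap_ok s1 Gam by [].
have eX : rg s1 RX = enum_rank (state_of (roots c.1)) by rewrite -(node_state ok pu) /s1 /= addn0.
have eD : rg s1 RD = index r.2 label_table by rewrite -ec.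
have swE : run push_label s1 = run (push_trees (state_of (roots (c.2 :: c.1))) r.2.2)
    (run (push_node (state_of (roots c.1)) (rt c.2)) s1).
  rewrite /push_label (run_switch_fin _ eX) run_switch ?eD ?index_mem // nth_index //.
  have -> // : r.2.1 = rt c.2.
  by rewrite eB -rE.
have [|||D1 [ok2 pt2]] := @push_node_ok s1 Gam c.2 c.1 ok1; [by split | exact: pu | |].
  exists st, (Leaf a), r.1; split=> //; exact: leaf_tree.
have [||D2 [ok3 pt3]] := @push_trees_ok _ _ (c.2 :: c.1) r.2.2 ok2 _ vg _ pt2; first by split.
  by move=> E; apply: label_tree lT.
rewrite -swE in ok3 pt3.
have tp3 : threads_ptr ((Gam ++ D1) ++ D2) (rg (run push_label s1) RNew) L.
  have -> : rg (run push_label s1) RNew = rg s RNew.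
    have : only push_regs push_label.
      apply: only_switch_fin => q; apply: only_switch => j.
      by apply: only_seq; [exact: only_push_node | exact: only_push_trees].
    by case/(only_run s1) => -> .
  by do 2 apply: threads_ptr_cat.
have [D3 [ok4 tp4]] := cons_thread_ok ok3 pt3 tp3.
by exists (D1 ++ D2 ++ D3); rewrite !catA; split.
Qed.

Definition one_thread a (lam : lookahead) : cmd :=
  Seq (LoadAt RX RV 0) (switch_fin RX (fun q : nstate =>
    seqs [seq one_result a lam i | i <- iota 0 (q.2 (shift_key a lam))])).

Lemma only_one_thread a lam : only thread_regs (one_thread a lam).
Proof.
apply: only_seq => //; apply: only_switch_fin => q; apply: only_seqs; apply: all_map_true => i.
exact: only_one_result.
Qed.

Lemma one_thread_ok s Gam a (lam : lookahead) st L : heap_ok s Gam -> ptr Gam (rg s RV) (ONode st) -> vall st ->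
  threads_ptr Gam (rg s RNew) L ->
  let s' := run (one_thread a lam) s in
  exists D, heap_ok s' (Gam ++ D) /\
    threads_ptr (Gam ++ D) (rg s' RNew) (catrev (shift_thread t a lam st) L).
Proof.
move=> ok pv vst tp.
pose s1 := run (LoadAt RX RV 0) s.
have eX : rg s1 RX = enum_rank (state_of (roots st)) by rewrite -(node_state ok pv) /s1 /= addn0.
rewrite /one_thread -[run _ s]/(run (switch_fin RX _) s1) (run_switch_fin _ eX).
have ok1 : heap_ok s1 Gam by [].
have pv1 : ptr Gam (rg s1 RV) (ONode st) by [].
have tp1 : threads_ptr Gam (rg s1 RNew) L by [].
rewrite /shift_thread -size_paths.
move: s1 ok1 pv1 tp1 {eX} => s1 ok1 pv1 tp1.
set ps := paths _ _.
have psE : ps = [seq nth (path0 G) ps j | j <- iota 0 (size ps)] by rewrite map_nth_iota0 ?take_size.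
rewrite [X in catrev (map _ X)]psE {psE}.
have : {subset iota 0 (size ps) <= gtn (size ps)} by move=> i; rewrite mem_iota.
elim: (iota _ _) s1 Gam L ok1 pv1 tp1 {s ok pv tp} => [|i l IH] s1 Gam L ok1 pv1 tp1 lts.
  by exists [::]; rewrite cats0; split; [exact: ok1 | exact: tp1].
have lti : i < size ps by apply: lts; rewrite mem_head.
have [D1 [ok2 tp2]] := one_result_ok ok1 pv1 vst lti tp1.
set s2 := run _ s1 in ok2 tp2.
have pv2 : ptr (Gam ++ D1) (rg s2 RV) (ONode st).
  have [-> // _ _] := only_run s1 (only_one_result a lam i); exact: ptr_cat.
have [D2 [ok3 tp3]] := IH s2 _ _ ok2 pv2 tp2 (fun j jl => lts j (@mem_behead _ (i :: l) j jl)).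
by exists (D1 ++ D2); rewrite catA; split.
Qed.

Definition next_thread a (lam : lookahead) : cmd :=
  IfEq ROld 0 Skip (seqs [:: LoadAt RV ROld 0; LoadAt ROld ROld 1; one_thread a lam]).

(** Unrolled rather than looped: there are at most [t] live stacks, and rounds after the end of the
    list do nothing. *)
Definition all_threads n a (lam : lookahead) : cmd := seqs (nseq n (next_thread a lam)).

Definition shift_regs := map rn [:: RV; ROld] ++ thread_regs.

Lemma only_all_threads n a lam : only shift_regs (all_threads n a lam).
Proof.
apply: only_seqs; elim: n => // n IH; apply/andP; split; last exact: IH.
have h : only shift_regs (one_thread a lam).
  by apply: (only_sub _ (only_one_thread a lam)) => x xi; rewrite mem_cat xi orbT.
have h2 : only shift_regs (seqs [:: LoadAt RV ROld 0; LoadAt ROld ROld 1; one_thread a lam]).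
  by apply: only_seq => //; apply: only_seq => //; apply: only_seq.
exact h2.
Qed.

Lemma all_threads_ok n s Gam a (lam : lookahead) L L' : heap_ok s Gam -> size L <= n ->
  threads_ptr Gam (rg s ROld) L -> (forall st, st \in L -> vall st) ->
  threads_ptr Gam (rg s RNew) L' ->
  let s' := run (all_threads n a lam) s in
  exists D, heap_ok s' (Gam ++ D) /\
    threads_ptr (Gam ++ D) (rg s' RNew) (catrev (flatten (map (shift_thread t a lam) L)) L').
Proof.
elim: n s Gam L L' => [|n IH] s Gam L L' ok.
  by rewrite leqn0 => /nilP -> _ _ tp; exists [::]; rewrite cats0.
rewrite -[run _ s]/(run (all_threads n a lam) (run (next_thread a lam) s)).
rewrite -[run (next_thread a lam) s]/(if rg s ROld == 0 then s else
  run (one_thread a lam) (setr (setr s RV (hp s (rg s ROld + 0))) ROld (hp s (rg s ROld + 1)))).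
case: L => [|st L] sL to vL tn.
  by rewrite to eqxx; apply: (IH s Gam [::]).
have [i ei hi] := to; have [_ w] := ok.
have n0 : (rg s ROld == 0) = false by rewrite ei /block; lia.
rewrite n0; have [p1 p2] := w _ _ hi; rewrite -ei in p1 p2.
set s1 := setr (setr s RV _) ROld _.
have ok1 : heap_ok s1 Gam by [].
have [|||D1 [ok2 tp2]] := @one_thread_ok s1 Gam a lam st L' ok1.
- by rewrite /s1 /= addn0.
- by apply: vL; rewrite mem_head.
- by [].
have to2 : threads_ptr (Gam ++ D1) (rg (run (one_thread a lam) s1) ROld) L.
  by have [-> // _ _] := only_run s1 (only_one_thread a lam); apply: threads_ptr_cat.
have [|D2 [ok3 tp3]] := IH _ _ L _ ok2 sL to2 _ tp2.
  by move=> st' h; apply: vL; rewrite inE h orbT.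
exists (D1 ++ D2); rewrite catA; split=> //.
by move: tp3; rewrite !catrevE rev_cat catA.
Qed.

End Threads.
End ThreadCode.

(** * Reading the input *)

Section MainLoop.
Variables (G : cfg) (k t : nat).
Local Notation K := k.+1.
Local Notation tree := (ptree G).
Local Notation sym := (Nt G + Tm G)%type.
Local Notation key := (key G k).
Local Notation lookahead := (K.-tuple (option (Tm G))).
Local Notation source := (source G k).
Local Notation block := (block G k t).
Local Notation obj := (obj G).
Local Notation ptr := (@ptr G k t).
Implicit Types (T : tree) (cs g st : seq tree) (al ga be : seq sym) (f : frame G) (fs : seq (frame G)).
Implicit Types (z : key) (r : path G) (src : source) (h : nat -> nat) (Gam D : seq obj) (s : state).

Local Notation heap_ok := (@heap_ok G k t).
Local Notation mk_node := (@mk_node G k t).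
Local Notation nstate := (nstate G k t).
Local Notation state_of := (@state_of G k t).
Local Notation threads_ptr := (@threads_ptr G k t).

Local Notation live := (@live G k).
Local Notation shape_of := (@shape_of G k t).
Local Notation cons_thread := (cons_thread G k t).
Implicit Types (u v w x : seq (Tm G)) (lam : lookahead).

(** Follows the convention of [IRead], where 0 means that the input is exhausted and symbols are
    shifted by one. *)
Definition sym_code (o : option (Tm G)) : nat := if o is Some a then (enum_rank a).+1 else 0.
Definition sym_decode (c : nat) : option (Tm G) := if c is c'.+1 then nth None (map Some (enum (Tm G))) c' else None.

Lemma sym_codeK : cancel sym_code sym_decode.
Proof.
case=> [a|] //=; rewrite (nth_map a) ?nth_enum_rank //.
by rewrite -cardE; apply: ltn_ord.
Qed.

Lemma sym_code_bound o : sym_code o < #|Tm G|.+1.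
Proof. by case: o => [a|] //=; apply: ltn_ord. Qed.

Definition pack (l : seq (option (Tm G))) : lookahead := insubd (nseq_tuple K None) l.
Lemma packK l : size l = K -> pack l = l :> seq _.
Proof. by move=> h; rewrite /pack insubdK // -topredE /= h. Qed.

Definition lookahead_of v : lookahead := pack (la K v).
Lemma lookahead_ofE v : lookahead_of v = la K v :> seq _.
Proof. by rewrite packK // size_la. Qed.

Lemma nth_padded v m i : nth None (map Some v ++ nseq m None) i = ohead (drop i v).
Proof.
elim: v i => [|a v IH] [|i] //=; first by case: m.
by rewrite nth_nseq; case: ifP.
Qed.

Lemma la_rcons v : la K v = rcons (take k (map Some v ++ nseq K None)) (ohead (drop k v)).
Proof.
rewrite /la (take_nth None); first by rewrite nth_padded.
by rewrite size_cat size_nseq; lia.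
Qed.

Definition flag lam : nat := if ohead lam is Some (Some _) then 1 else 0.

Lemma flag_lookahead v : flag (lookahead_of v) = (v != [::]).
Proof. by rewrite /flag lookahead_ofE; case: v. Qed.

Lemma run_read v s : sin s = encode_input v ->
  [/\ rg (run (Read RX) s) RX = sym_code (ohead v), sin (run (Read RX) s) = encode_input (behead v),
      forall r : reg, rn r != rn RX -> rg (run (Read RX) s) r = rg s r, hp (run (Read RX) s) = hp s
    & sout (run (Read RX) s) = sout s].
Proof.
by case: v => [|a v] /= e; rewrite e; split=> // r nr; rewrite /= (negbTE nr).
Qed.

Definition shift_body a lam : cmd :=
  Seq (Const RNew 0) (Seq (all_threads t t a lam)
    (seqs [:: Mov ROld RNew; Const RLam (enum_rank lam); Const RFlag (flag lam)])).

(** [RLam] holds the number of the current lookahead. The symbol shifted is its head, whereas the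
    symbol read lies [K] positions further and completes the lookahead valid after the shift. *)
Definition main_body : cmd :=
  switch_fin RLam (fun lam : lookahead =>
    if tval lam is Some a :: lam' then
      Seq (Read RX) (switch RX #|Tm G|.+1 (fun c => shift_body a (pack (rcons lam' (sym_decode c)))))
    else Skip).

Definition quiet s := [/\ rg s RAcc = 0, rg s RUniq = 0, rg s RK = 0 & sout s = [::]].

Definition threads_of s u v := exists Gam L,
  [/\ heap_ok s Gam, threads_ptr Gam (rg s ROld) L, uniq L &
      forall st, st \in L <-> live u (lookahead_of v) st].

Definition main_inv x n s := exists u v,
  [/\ x = u ++ v, size v = n, threads_of s u v, quiet s &
      [/\ rg s RLam = enum_rank (lookahead_of v), sin s = encode_input (drop K v) & rg s RFlag = (v != [::])]].

Hypothesis xlr : XLR G K t.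

Lemma main_body_ok x n s : main_inv x n s -> rg s RFlag != 0 ->
  exists2 m, m < n & main_inv x m (run main_body s).
Proof.
case=> u [v [ex sv [Gam [L [ok tp uL LP]]] [q1 q2 q3 q4] [eL ein eF]]]; rewrite eF.
case: v => [|a v] // in ex sv LP eL ein eF * => _.
rewrite /main_body (run_switch_fin _ eL) lookahead_ofE /la.
rewrite -[take K _]/(Some a :: take k (map Some v ++ nseq K None)).
have [r1 r2 r3 r4 r5] := run_read ein.
rewrite run_seq.
set s1 := run (Read RX) s in r1 r2 r3 r4 r5 *.
rewrite run_switch r1 ?sym_code_bound // sym_codeK -[drop K (a :: v)]/(drop k v).
rewrite -la_rcons -/(lookahead_of v).
set lam := lookahead_of v.
pose s2 := run (Const RNew 0) s1.
have ok2 : heap_ok s2 Gam by case: ok => h w; split; rewrite /s2 /= ?r3 ?r4.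
have tp2 : threads_ptr Gam (rg s2 ROld) L by rewrite /s2 /= r3.
have sL : size L <= t by apply: (live_bound xlr uL (x := u) (lam := lookahead_of (a :: v))) => st /LP.
have vL st : st \in L -> vall st by case/LP.
have [D [ok3 tp3]] := all_threads_ok (L' := [::]) xlr a lam ok2 sL tp2 vL erefl.
rewrite /shift_body 2!run_seq -/s2.
have [f1 f2 f3] := only_run s2 (only_all_threads t t a lam).
set s3 := run _ s2 in ok3 tp3 f1 f2 f3 *.
exists (size v); first by rewrite -sv.
exists (rcons u a), v; split; [by rewrite cat_rcons | by [] | | |].
- exists (Gam ++ D), (catrev (flatten (map (shift_thread t a lam) L)) [::]).
  have [|uL' LP'] := shift_threadsP xlr (lam' := lam) (x := u) (a := a) _ uL LP.
    by rewrite !lookahead_ofE -cat1s la_cat.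
  rewrite -/(rev _); split=> //; first by rewrite rev_uniq.
  by move=> st; rewrite mem_rev.
- by split; rewrite /= ?f1 ?f3 // /s2 /= ?r3 ?r5.
split=> //=; last by rewrite flag_lookahead.
by rewrite [LHS]/= f2 /s2 /= r2 -drop1 drop_drop.
Qed.

Definition init_thread st : cmd :=
  Seq (Mov RP RV) (Seq (push_trees (state_of [::]) (rev st)) cons_thread).

Definition init_threads lam : cmd :=
  Seq (Const RHp block) (Seq (mk_node (enum_rank (state_of [::])) (shape_of [::]))
    (Seq (seqs [:: Mov RV RP; Const RNew 0]) (Seq (seqs (map init_thread (empty_threads lam)))
      (seqs [:: Mov ROld RNew; Const RLam (enum_rank lam); Const RFlag (flag lam)])))).

(** The initial lookahead is remembered in the control flow: the code branches at each read, so
    every leaf of this decision tree knows the symbols read. *)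
Fixpoint read_lookahead n (l : seq (option (Tm G))) : cmd :=
  if n is n'.+1 then
    Seq (Read RX) (switch RX #|Tm G|.+1 (fun c => read_lookahead n' (rcons l (sym_decode c))))
  else init_threads (pack l).

Lemma run_read_lookahead n l v s : sin s = encode_input v -> exists s1,
  [/\ run (read_lookahead n l) s = run (init_threads (pack (l ++ la n v))) s1,
      sin s1 = encode_input (drop n v), forall r : reg, rn r != rn RX -> rg s1 r = rg s r & sout s1 = sout s].
Proof.
elim: n l v s => [|n IH] l v s ein.
  by exists s; rewrite /la take0 cats0 drop0.
have [r1 r2 r3 r4 r5] := run_read ein.
rewrite [read_lookahead _ _]/= run_seq run_switch r1 ?sym_code_bound // sym_codeK.
have [s1 [e1 e2 e3 e4]] := IH (rcons l (ohead v)) (behead v) _ r2.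
exists s1; split; last by rewrite e4.
- rewrite e1 cat_rcons; congr (run (init_threads (pack (_ ++ _))) _).
  by case: v {ein r1 r2 IH e1 e2} => [|b v] //; congr (_ :: _); rewrite [RHS](take_pad (m := n.+1)).
- by rewrite e2 -drop1 drop_drop addn1.
by move=> r nr; rewrite e3 // r3.
Qed.

Lemma init_threads_ok lam s : quiet s -> exists Gam L, let s' := run (init_threads lam) s in
  [/\ heap_ok s' Gam, threads_ptr Gam (rg s' ROld) L, L = rev (empty_threads lam) & quiet s' /\
   [/\ sin s' = sin s, rg s' RLam = enum_rank lam & rg s' RFlag = flag lam]].
Proof.
move=> [q1 q2 q3 q4].
pose s1 := run (Const RHp block) s.
have ok1 : heap_ok s1 [::] by split=> [|[|i] o] //; rewrite muln1.
have [//|D1 [ok2 pt2]] := mk_node_ok xlr (st := [::]) ok1 I.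
have [f1 f2 f3] := only_run s1 (only_mk_node t (enum_rank (state_of [::])) (shape_of [::])).
set s2 := run _ s1 in ok2 pt2 f1 f2 f3.
pose s3 := run (seqs [:: Mov RV RP; Const RNew 0]) s2.
have ok3 : heap_ok s3 D1 by [].
have pt3 : ptr D1 (rg s3 RV) (ONode [::]) by [].
have tp3 : threads_ptr D1 (rg s3 RNew) [::] by [].
pose ET := empty_threads lam.
have [_ LP] := empty_threadsP xlr lam.
have : {subset ET <= ET} by [].
rewrite -[run (init_threads lam) s]/(run (seqs [:: Mov ROld RNew; Const RLam (enum_rank lam); Const RFlag (flag lam)])
   (run (seqs (map init_thread ET)) s3)).
suff main l L s4 Gam : heap_ok s4 Gam -> ptr Gam (rg s4 RV) (ONode [::]) -> threads_ptr Gam (rg s4 RNew) L ->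
    {subset l <= ET} -> exists Gam', let s' := run (seqs (map init_thread l)) s4 in
    [/\ heap_ok s' Gam', threads_ptr Gam' (rg s' RNew) (catrev l L), sin s' = sin s4, sout s' = sout s4 &
     forall r : reg, rn r \notin thread_regs -> rg s' r = rg s4 r].
  case/(main ET _ _ _ ok3 pt3 tp3) => Gam' []; set s5 := run _ s3 => ok5 tp5 i5 o5 r5.
  exists Gam', (rev ET); split=> //; split; last by split=> //; rewrite /= i5 /s3 /= f2.
  by split; rewrite /= ?r5 //= ?f1 // o5 /s3 /= f3.
elim: l L s4 Gam => [|st l IH] L s4 Gam ok4 pt4 tp4 sub.
  by exists Gam.
have [vst yst _] : live [::] lam st by apply/LP/sub; rewrite mem_head.
rewrite -[run (seqs (map _ (st :: l))) s4]/(run (seqs (map init_thread l)) (run (init_thread st) s4)).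
have ons : only thread_regs (init_thread st).
  apply: only_seq => //; apply: only_seq => //.
  by apply: (only_sub _ (only_push_trees _ _)) => y yi; rewrite mem_cat yi.
have [g1 g2 g3] := only_run s4 ons.
have okM : heap_ok (run (Mov RP RV) s4) Gam by [].
have [|||D2 [ok5 pt5]] := @push_trees_ok _ _ _ xlr (run (Mov RP RV) s4) Gam [::] (rev st) okM I.
- exact/vall_rev.
- by move=> E; rewrite mem_rev; apply: empty_thread_tree; apply: sub; rewrite mem_head.
- exact: pt4.
- rewrite revK cats0 in pt5.
  have tp5 : threads_ptr (Gam ++ D2) (rg (run (push_trees (state_of [::]) (rev st)) (run (Mov RP RV) s4)) RNew) L.
    have [-> // _ _] := only_run (run (Mov RP RV) s4) (only_push_trees (state_of [::]) (rev st)).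
    exact: threads_ptr_cat.
  have [D3 [ok6 tp6]] := cons_thread_ok ok5 pt5 tp5.
  have pt6 : ptr ((Gam ++ D2) ++ D3) (rg (run (init_thread st) s4) RV) (ONode [::]).
    by rewrite g1 //; do 2 apply: ptr_cat.
  have [|Gam' [o1 o2 o3 o4 o5]] := IH _ (run (init_thread st) s4) _ ok6 pt6 tp6.
    by move=> y yi; apply: sub; rewrite inE yi orbT.
  exists Gam'; split=> //; [by rewrite o3 | by rewrite o4|].
  by move=> r nr; rewrite o5 // g1.
Qed.

Definition init_code := read_lookahead K [::].

Definition init_state x := State (fun _ => 0) (fun _ => 0) (encode_input x) [::].

Lemma init_code_ok x : main_inv x (size x) (run init_code (init_state x)).
Proof.
have [|s1 [-> e2 e3 e4]] := @run_read_lookahead K [::] x (init_state x); first by [].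
rewrite cat0s -/(lookahead_of x).
have [|Gam [L [ok tp eL [q [i1 i2 i3]]]]] := @init_threads_ok (lookahead_of x) s1.
  by split; rewrite ?e3 ?e4.
exists [::], x; split=> //; last by rewrite i1 i2 i3 flag_lookahead e2.
have [uE EP] := empty_threadsP xlr (lookahead_of x).
exists Gam, L; split=> //; first by rewrite eL rev_uniq.
by move=> st; rewrite eL mem_rev.
Qed.

End MainLoop.

(** * Writing the tree *)

Section Output.
Variables (G : cfg) (k t : nat).
Local Notation tree := (ptree G).
Local Notation sym := (Nt G + Tm G)%type.
Local Notation key := (key G k).
Local Notation source := (source G k).
Local Notation block := (block G k t).
Local Notation obj := (obj G).
Local Notation ptr := (@ptr G k t).
Local Notation local := (@local G k t).
Local Notation frame_table := (@frame_table G k t).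
Local Notation tree_table := (@tree_table G k t).
Implicit Types (T : tree) (cs g st : seq tree) (al ga be : seq sym) (f : frame G) (fs : seq (frame G)).
Implicit Types (z : key) (r : path G) (src : source) (h : nat -> nat) (Gam D : seq obj) (s : state).

Local Notation alloc := (@alloc G k t).
Local Notation heap_ok := (@heap_ok G k t).
Local Notation nstate := (nstate G k t).
Local Notation threads_ptr := (@threads_ptr G k t).

Local Notation items_ptr := (@items_ptr G k t).
Local Notation item_rep := (@item_rep G k t).
Local Notation item := (item G).
Implicit Types (it : item) (its : seq item) (e : etree G) (ra rb : reg).

Lemma heap_ok_new s s' Gam o : heap_ok s Gam -> rg s' RHp = rg s RHp + block ->
  (forall a, a < rg s RHp -> hp s' a = hp s a) -> local (hp s') (Gam ++ [:: o]) (rg s RHp) o ->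
  heap_ok s' (Gam ++ [:: o]).
Proof.
move=> [eH w] eH' hE lo; split.
  by rewrite eH' eH size_cat /= addn1 [RHS]mulnS addnC.
apply: wf_new w _ _; last by rewrite -eH.
move=> i a li la; apply: hE; rewrite eH.
have : block * i.+1 + block <= block * (size Gam).+1 by rewrite -mulnSr leq_mul2l; lia.
by lia.
Qed.

Lemma ptr_new s Gam o : heap_ok s Gam -> ptr (Gam ++ [:: o]) (rg s RHp) o.
Proof. by move=> [eH _]; exists (size Gam); rewrite ?onth_mid. Qed.

Lemma ptr_bound s Gam p o : heap_ok s Gam -> ptr Gam p o -> p + block <= rg s RHp /\ 0 < p.
Proof.
move=> [-> _] [i -> hi]; have lt := onth_size hi; have := block_gt3 G k t.
have : block * i.+1 + block <= block * (size Gam).+1 by rewrite -mulnSr leq_mul2l; lia.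
by rewrite mulnS; lia.
Qed.

Definition push_item kind ra rb : cmd := seqs
  [:: alloc RS; StoreC RS 0 kind; StoreAt RS 1 ra; StoreAt RS 2 rb; StoreAt RS 3 RK; Mov RK RS].

Definition item_regs := map rn [:: RS; RHp; RK].

Lemma push_item_ok s Gam it its kind ra rb : rn ra \notin item_regs -> rn rb \notin item_regs ->
  heap_ok s Gam -> item_rep Gam it kind (rg s ra) (rg s rb) -> items_ptr Gam (rg s RK) its ->
  let s' := run (push_item kind ra rb) s in
  heap_ok s' (Gam ++ [:: OItem it its]) /\ items_ptr (Gam ++ [:: OItem it its]) (rg s' RK) (it :: its).
Proof.
rewrite /item_regs /= !inE !negb_or => /and3P [/negbTE a1 /negbTE a2 _] /and3P [/negbTE b1 /negbTE b2 _] ok ir ip.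
split; last by apply: ptr_new.
apply: heap_ok_new ok _ _ _ => [//=|a la|].
  have h c : (a == rg s RHp + c) = false by lia.
  by rewrite /= /upd !h.
rewrite /= /upd a1 a2 b1 b2 /= !addn0 !eqn_add2l !eqxx /=.
have q1 n : (rg s RHp == rg s RHp + n.+1) = false by lia.
by rewrite !q1; split; [apply: item_rep_cat | apply: items_ptr_cat].
Qed.

Definition writes (l : seq nat) : cmd := seqs (map Write l).

Lemma run_writes l s : run (writes l) s = State (rg s) (hp s) (sin s) (sout s ++ l).
Proof.
rewrite /writes; elim: l s => [|a l IH] s /=; first by rewrite cats0; case: s.
by rewrite IH /= cat_rcons.
Qed.

Definition frame0 : frame G := (start G, [::], [::]).
Definition tree0 : tree := Node (start G) [::].

Definition write_eps : cmd :=
  switch RY (size frame_table) (fun c => writes (flatten (map (@encode_tree G) (nth frame0 frame_table c).2))).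

Definition copy_base : cmd := seqs
  [:: alloc RV; StoreC RV 0 (size frame_table); LoadAt RX RY 2; StoreAt RV 1 RX; LoadAt RX RY 3].

Definition open_node : cmd := Seq copy_base (push_item 2 RX RV).

Definition copy_frame : cmd := seqs
  [:: alloc RV; LoadAt RX RY 0; StoreAt RV 0 RX; LoadAt RX RY 1; StoreAt RV 1 RX; StoreAt RV 2 RZ; LoadAt RX RY 2].

Definition walk_context : cmd :=
  IfEq RY 0 (push_item 3 RZ RZ) (Seq copy_frame (push_item 2 RX RV)).

Definition push_child : cmd := Seq (push_item 1 RV RV) (LoadAt RV RV 1).
Definition push_children n : cmd := seqs (nseq n push_child).

Lemma only_push_children n : only (rn RV :: item_regs) (push_children n).
Proof. by apply: only_seqs; elim: n. Qed.

(** After the header of the node, items are pushed in the reverse of the output order: trailing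
    empty trees, then the inner tree, then the stacked siblings from the top. The leftmost child is
    thus written first. *)
Definition write_frame c f : cmd :=
  Seq (writes [:: 1; nat_of_ord (enum_rank f.1.1); size (fbe f) + (size f.2).+1])
  (Seq (Seq (Const RX c) (push_item 0 RX RX))
  (Seq (Seq (LoadAt RX RY 2) (push_item 3 RX RX))
  (Seq (LoadAt RV RY 1) (push_children (size (fbe f)))))).

Definition write_cell : cmd :=
  Seq (LoadAt RX RY 0) (switch RX (size frame_table).+1 (fun c =>
    if c < size frame_table then write_frame c (nth frame0 frame_table c)
    else Seq (LoadAt RX RY 1) (switch RX (size tree_table) (fun b => writes (encode_tree (nth tree0 tree_table b)))))).

Definition pop_item : cmd := seqs [:: LoadAt RX RK 0; LoadAt RY RK 1; LoadAt RZ RK 2; LoadAt RK RK 3].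

Definition encode_all cs := flatten (map (@encode_tree G) cs).

Definition item_out it : seq nat :=
  match it with
  | INode T _ => encode_tree T
  | IEps f => encode_all f.2
  | IWalk st fs e => encode_tree (apply_frames st (etree_tree e) fs).2
  | ICell e => encode_tree (etree_tree e)
  end.

Definition trees_size cs := sumn (map (@tsize G) cs).

(** Weights bound the remaining rounds of the output loop. A frame stands for one tree node and
    takes one round to be walked over, one to be written and one for its trailing empty trees. The 5
    units per tree node cover this with room to spare. *)
Fixpoint cell_weight e : nat :=
  match e with
  | EBase _ => 1
  | EFrame st f e' => 2 + 5 * trees_size (take (size (fbe f)) st) + cell_weight e'
  end.

Fixpoint walk_weight st fs e : nat :=
  if fs is f :: fs' then (walk_weight (drop (size (fbe f)) st) fs' (EFrame st f e)).+1
  else (cell_weight e).+1.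

Definition item_weight it : nat :=
  match it with
  | INode T _ => 5 * tsize T
  | IEps _ => 1
  | IWalk st fs e => walk_weight st fs e
  | ICell e => cell_weight e
  end.

Definition items_out its := flatten (map item_out its).
Definition items_weight its := sumn (map item_weight its).

Lemma walk_weight_size st fs e : walk_weight st fs e + 5 * tsize (etree_tree e) <=
  (cell_weight e).+1 + 5 * tsize (apply_frames st (etree_tree e) fs).2.
Proof.
elim: fs st e => [|f fs IH] st e //=.
have := IH (drop (size (fbe f)) st) (EFrame st f e).
rewrite /apply_frames /= -!/(apply_frames _ _ _) /apply_frame /= map_cat sumn_cat map_rev sumn_rev /=.
by rewrite /trees_size; lia.
Qed.

Lemma push_children_ok n s Gam st its : n <= size st -> heap_ok s Gam -> ptr Gam (rg s RV) (ONode st) ->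
  items_ptr Gam (rg s RK) its ->
  let s' := run (push_children n) s in exists D its',
  [/\ heap_ok s' (Gam ++ D), items_ptr (Gam ++ D) (rg s' RK) (its' ++ its),
      items_out its' = encode_all (rev (take n st)), items_weight its' = 5 * trees_size (take n st) &
      sout s' = sout s].
Proof.
elim: n s Gam st its => [|n IH] s Gam st its.
  by move=> _ ok _ ip; exists [::], [::]; rewrite take0 cats0.
case: st => [|T st] // ln ok pv ip.
rewrite -[run _ s]/(run (push_children n) (run push_child s)).
have [ok1 ip1] := @push_item_ok s Gam (INode T st) its 1 RV RV isT isT ok (conj erefl pv) ip.
set D1 := [:: _] in ok1 ip1; set s1 := run (push_item 1 RV RV) s in ok1 ip1.
have pv1 : ptr (Gam ++ D1) (rg s1 RV) (ONode (T :: st)) by apply: ptr_cat.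
have pv2 : ptr (Gam ++ D1) (rg (run push_child s) RV) (ONode st).
  have [_ w] := ok1; have [i ei hi] := pv1.
  by have [[_ [+ _]] _] := w _ _ hi; rewrite -ei.
have [D2 [its' [ok2 ip2 o2 w2 so2]]] := IH (run push_child s) _ st _ ln ok1 pv2 ip1.
exists (D1 ++ D2), (rcons its' (INode T st)); rewrite catA cat_rcons; split=> //.
- by rewrite /items_out map_rcons flatten_rcons -/(items_out _) o2 rev_cons /encode_all map_rcons flatten_rcons.
by rewrite /items_weight map_rcons sumn_rcons -/(items_weight _) w2 /trees_size /= mulnDr addnC.
Qed.

Definition out_state s out n a u := exists Gam its,
  [/\ heap_ok s Gam, items_ptr Gam (rg s RK) its, sout s ++ items_out its = out, items_weight its = n &
      rg s RAcc = a /\ rg s RUniq = u].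

Lemma encode_frame st f T : size (fbe f) <= size st ->
  encode_tree (apply_frame (st, T) f).2 = [:: 1; nat_of_ord (enum_rank f.1.1); size (fbe f) + (size f.2).+1]
    ++ encode_all (rev (take (size (fbe f)) st)) ++ encode_tree T ++ encode_all f.2.
Proof.
by move=> le; rewrite /= size_cat size_rev size_takel //= map_cat flatten_cat.
Qed.

Lemma open_node_ok s Gam its out a u T st :
  heap_ok s Gam -> items_ptr Gam (rg s RK) its -> item_rep Gam (INode T st) 1 (rg s RY) (rg s RZ) ->
  sout s ++ item_out (INode T st) ++ items_out its = out -> rg s RAcc = a -> rg s RUniq = u ->
  exists2 m, m < item_weight (INode T st) + items_weight its & out_state (run open_node s) out m a u.
Proof.
move=> ok ip [_ pY] eo ea eu; have [_ w] := ok; move ew: (_ + items_weight its) => n.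
have [bY _] := ptr_bound ok pY.
have [iY eY hY] := pY; have := w _ _ hY; rewrite -eY => -[[_ [_ [st0 [T0 [fs [eb bT cx eT]]]]]] _].
pose s1 := run copy_base s; rewrite /open_node run_seq -/s1.
have b3 := block_gt3 G k t.
have hE c : c < rg s RHp -> hp s1 c = hp s c.
  move=> lc; have h d : (c == rg s RHp + d) = false by lia.
  by rewrite /s1 /= /upd !h.
have rd d d' : d < 4 -> (rg s RY + d == rg s RHp + d') = false by move=> *; lia.
have ok1 : heap_ok s1 (Gam ++ [:: OCell (EBase T0)]).
  apply: heap_ok_new ok _ hE _ => //.
  rewrite /= /s1 /= /upd rd // addn0.
  have -> : (rg s RHp == rg s RHp + 1) = false by lia.
  by rewrite !eqxx.
have [||ok2 ip2] := @push_item_ok s1 _ (IWalk st0 fs (EBase T0)) its 2 RX RV isT isT ok1.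
- split; [by [] | | exact: ptr_new].
  by rewrite /s1 /= /upd !rd //; apply: ctx_ptr_cat.
- exact: items_ptr_cat.
exists (item_weight (IWalk st0 fs (EBase T0)) + items_weight its).
  rewrite -ew ltn_add2r /=; have := walk_weight_size st0 fs (EBase T0).
  have : 0 < tsize T0 by case: (T0).
  by rewrite /= eT; lia.
eexists; eexists; split; [exact: ok2 | exact: ip2 | | by [] | by []].
by rewrite -eo /items_out /= eT.
Qed.

Lemma write_eps_ok s Gam its out a u f :
  heap_ok s Gam -> items_ptr Gam (rg s RK) its -> item_rep Gam (IEps f) 0 (rg s RY) (rg s RZ) ->
  sout s ++ item_out (IEps f) ++ items_out its = out -> rg s RAcc = a -> rg s RUniq = u ->
  exists2 m, m < item_weight (IEps f) + items_weight its & out_state (run write_eps s) out m a u.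
Proof.
move=> ok ip [_ eY fT] eo ea eu; have [_ w] := ok; move ew: (_ + items_weight its) => n.
rewrite /write_eps run_switch eY ?index_mem // nth_index // run_writes.
exists (items_weight its); first by rewrite -ew /= add1n.
by exists Gam, its; split=> //=; rewrite -catA.
Qed.

Lemma walk_context_ok s Gam its out a u st fs e :
  heap_ok s Gam -> items_ptr Gam (rg s RK) its -> item_rep Gam (IWalk st fs e) 2 (rg s RY) (rg s RZ) ->
  sout s ++ item_out (IWalk st fs e) ++ items_out its = out -> rg s RAcc = a -> rg s RUniq = u ->
  exists2 m, m < item_weight (IWalk st fs e) + items_weight its & out_state (run walk_context s) out m a u.
Proof.
move=> ok ip [_ cx pZ] eo ea eu; have [_ w] := ok; move ew: (_ + items_weight its) => n.
rewrite /walk_context run_ifeq.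
case: fs cx eo ew => [|f fs] cx eo ew.
  rewrite cx eqxx.
  have [ok2 ip2] := @push_item_ok s _ (ICell e) its 3 RZ RZ isT isT ok (conj erefl pZ) ip.
  exists (cell_weight e + items_weight its); first by rewrite -ew /= addSn.
  by eexists; eexists; split; [exact: ok2 | exact: ip2 | | by [] | by []].
have [bY Y0] := ptr_bound ok cx.
have nY : (rg s RY == 0) = false by lia.
rewrite nY; have [iY eY hY] := cx; have := w _ _ hY; rewrite -eY => -[[ef fT pf lf] cx'].
pose s1 := run copy_frame s; rewrite run_seq -/s1.
have b3 := block_gt3 G k t.
have hE c : c < rg s RHp -> hp s1 c = hp s c.
  move=> lc; have h d : (c == rg s RHp + d) = false by lia.
  by rewrite /s1 /= /upd !h.
have rd d d' : d < 4 -> (rg s RY + d == rg s RHp + d') = false by move=> *; lia.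
have ok1 : heap_ok s1 (Gam ++ [:: OCell (EFrame st f e)]).
  apply: heap_ok_new ok _ hE _ => //.
  have q1 d : (rg s RHp == rg s RHp + d.+1) = false by lia.
  rewrite /= /frame_rep /s1 /= /upd !rd // !addn0 !q1 !eqn_add2l /= !eqxx.
  by split; [split=> //; apply: ptr_cat | apply: ptr_cat].
have [||ok2 ip2] := @push_item_ok s1 _ (IWalk (drop (size (fbe f)) st) fs (EFrame st f e)) its 2 RX RV isT isT ok1.
- split; [by [] | | exact: ptr_new].
  by rewrite /s1 /= /upd !rd //; apply: ctx_ptr_cat.
- exact: items_ptr_cat.
exists (item_weight (IWalk (drop (size (fbe f)) st) fs (EFrame st f e)) + items_weight its).
  by rewrite -ew ltn_add2r.
by eexists; eexists; split; [exact: ok2 | exact: ip2 | | by [] | by []].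
Qed.

Lemma write_cell_ok s Gam its out a u e :
  heap_ok s Gam -> items_ptr Gam (rg s RK) its -> item_rep Gam (ICell e) 3 (rg s RY) (rg s RZ) ->
  sout s ++ item_out (ICell e) ++ items_out its = out -> rg s RAcc = a -> rg s RUniq = u ->
  exists2 m, m < item_weight (ICell e) + items_weight its & out_state (run write_cell s) out m a u.
Proof.
move=> ok ip [_ pY] eo ea eu; have [_ w] := ok; move ew: (_ + items_weight its) => n.
have [iY eY hY] := pY; have := w _ _ hY; rewrite -eY.
rewrite /write_cell run_seq; pose s1 := run (LoadAt RX RY 0) s; rewrite -/s1.
case: e pY eo ew {hY} => [T|st f e] pY eo ew.
  case=> e0 e1 TT.
  have eX : rg s1 RX = size frame_table by rewrite /s1 /= addn0.
  rewrite run_switch eX // ltnn run_seq run_switch.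
    rewrite run_writes; exists (items_weight its); first by rewrite -ew /= add1n.
    by exists Gam, its; split=> //=; rewrite e1 nth_index // -catA.
  by rewrite /= e1 index_mem.
case=> -[ef fT pf lf] pe.
have eX : rg s1 RX = index f frame_table by rewrite /s1 /= addn0.
have lX : index f frame_table < size frame_table by rewrite index_mem.
rewrite run_switch eX ?ltnS ?(ltnW lX) // lX nth_index //.
rewrite /write_frame run_seq run_writes; set hd := [:: 1; _; _].
set s2 := State _ _ _ _; have ok2 : heap_ok s2 Gam by [].
have [q2 y2] : [/\ rg s2 RAcc = a, rg s2 RUniq = u & sout s2 = sout s ++ hd] /\
  ptr Gam (rg s2 RY) (OCell (EFrame st f e)) by [].
have {}ip : items_ptr Gam (rg s2 RK) its by [].
move: s2 ok2 q2 y2 ip => s2 ok2 [qa qu qo] y2 ip.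
have [s3 [e3 ok3 ip3 [qa3 qu3 qo3 qy3]]] : exists s3,
    [/\ run (Seq (Const RX (index f frame_table)) (push_item 0 RX RX)) s2 = s3,
     heap_ok s3 (Gam ++ [:: OItem (IEps f) its]),
     items_ptr (Gam ++ [:: OItem (IEps f) its]) (rg s3 RK) (IEps f :: its) &
     [/\ rg s3 RAcc = a, rg s3 RUniq = u, sout s3 = sout s ++ hd & rg s3 RY = rg s2 RY]].
  pose s2' := run (Const RX (index f frame_table)) s2.
  have [//|ok3 ip3] := @push_item_ok s2' Gam (IEps f) its 0 RX RX isT isT ok2 _ ip.
  by exists (run (push_item 0 RX RX) s2').
rewrite run_seq e3; set D3 := [:: _] in ok3 ip3.
have pY3 : ptr (Gam ++ D3) (rg s3 RY) (OCell (EFrame st f e)) by rewrite qy3; apply: ptr_cat.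
have [s4 [e4 ok4 ip4 [qa4 qu4 qo4 qy4]]] : exists s4,
    let D4 := [:: OItem (ICell e) (IEps f :: its)] in
    [/\ run (Seq (LoadAt RX RY 2) (push_item 3 RX RX)) s3 = s4, heap_ok s4 ((Gam ++ D3) ++ D4),
     items_ptr ((Gam ++ D3) ++ D4) (rg s4 RK) [:: ICell e, IEps f & its] &
     [/\ rg s4 RAcc = a, rg s4 RUniq = u, sout s4 = sout s ++ hd & rg s4 RY = rg s3 RY]].
  have [j3 ej3 hj3] := pY3; have [_ pe3] := proj2 ok3 _ _ hj3; rewrite -ej3 in pe3.
  pose s3' := run (LoadAt RX RY 2) s3.
  have [ok4 ip4] := @push_item_ok s3' _ (ICell e) _ 3 RX RX isT isT ok3 (conj erefl pe3) ip3.
  by exists (run (push_item 3 RX RX) s3').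
rewrite run_seq e4; set D4 := [:: OItem (ICell e) _] in ok4 ip4.
have [s5 [e5 ok5 ip5 [qa5 qu5 qo5 pf5]]] : exists s5,
    [/\ run (LoadAt RV RY 1) s4 = s5, heap_ok s5 ((Gam ++ D3) ++ D4),
     items_ptr ((Gam ++ D3) ++ D4) (rg s5 RK) [:: ICell e, IEps f & its] &
     [/\ rg s5 RAcc = a, rg s5 RUniq = u, sout s5 = sout s ++ hd & ptr ((Gam ++ D3) ++ D4) (rg s5 RV) (ONode st)]].
  have pY4 : ptr ((Gam ++ D3) ++ D4) (rg s4 RY) (OCell (EFrame st f e)) by rewrite qy4; apply: ptr_cat.
  have [j4 ej4 hj4] := pY4; have [[_ _ pf4 _] _] := proj2 ok4 _ _ hj4; rewrite -ej4 in pf4.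
  by exists (run (LoadAt RV RY 1) s4).
rewrite run_seq e5.
have [D5 [its' [ok6 ip6 o6 w6 so6]]] := push_children_ok lf ok5 pf5 ip5.
have [f1 _ _] := only_run s5 (only_push_children (size (fbe f))).
exists (items_weight (its' ++ [:: ICell e, IEps f & its])).
  by rewrite -ew /items_weight map_cat sumn_cat -/(items_weight its') w6 /=; lia.
eexists; eexists; split; [exact: ok6 | exact: ip6 | | by [] | by rewrite !f1].
rewrite so6 qo5 -eo.
rewrite -[item_out _]/(encode_tree (apply_frame (st, etree_tree e) f).2) encode_frame //.
by rewrite /items_out map_cat flatten_cat -/(items_out its') o6 /= -!catA.
Qed.

Lemma pop_item_ok s Gam it its : heap_ok s Gam -> items_ptr Gam (rg s RK) (it :: its) ->
  let s' := run pop_item s in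
  [/\ heap_ok s' Gam, items_ptr Gam (rg s' RK) its, item_rep Gam it (rg s' RX) (rg s' RY) (rg s' RZ) &
      [/\ sout s' = sout s, rg s' RAcc = rg s RAcc & rg s' RUniq = rg s RUniq]].
Proof.
move=> ok ip; have [i ei hi] := ip; have [_ w] := ok; have [ir ip1] := w _ _ hi.
rewrite -ei in ir ip1; split=> //.
by rewrite /= addn0.
Qed.

Definition out_code c : cmd :=
  match c with 0 => write_eps | 1 => open_node | 2 => walk_context | _ => write_cell end.

Definition out_body : cmd := Seq pop_item (switch RX 4 out_code).

Lemma out_body_ok s out n a u : out_state s out n a u -> rg s RK != 0 ->
  exists2 m, m < n & out_state (run out_body s) out m a u.
Proof.
case=> Gam [its [ok ip eo ew [ea eu]]] nK.
case: its ip eo ew => [e|it its ip eo ew]; first by rewrite e in nK.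
rewrite /out_body run_seq; have [ok1 ip1 ir [so1 ea1 eu1]] := pop_item_ok ok ip.
move: (run pop_item s) ok1 ip1 ir so1 ea1 eu1 => s1 ok1 ip1 ir so1 ea1 eu1.
rewrite -{}so1 in eo; rewrite -{}ea1 in ea; rewrite -{}eu1 in eu.
rewrite /items_out [map _ _]/= [flatten _]/= -/(items_out its) in eo.
rewrite /items_weight [map _ _]/= [sumn _]/= -/(items_weight its) in ew.
have rX : rg s1 RX < 4 by case: (it) ir => [T st [->]|f [->]|st fs e [->]|e [->]].
rewrite run_switch // -ew.
case: it ir eo {ew rX ip} => [T st|f|st fs e|e] ir eo.
- have [eX _] := ir; rewrite eX in ir *; exact: open_node_ok ok1 ip1 ir eo ea eu.
- have [eX _ _] := ir; rewrite eX in ir *; exact: write_eps_ok ok1 ip1 ir eo ea eu.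
- have [eX _ _] := ir; rewrite eX in ir *; exact: walk_context_ok ok1 ip1 ir eo ea eu.
have [eX _] := ir; rewrite eX in ir *; exact: write_cell_ok ok1 ip1 ir eo ea eu.
Qed.

(** After the last symbol the live stacks correspond to the parse trees, without repetition. A
    nonempty list means membership, and a null tail after the first entry means uniqueness. *)
Definition finish : cmd :=
  IfEq ROld 0 Skip (seqs [:: Const RAcc 1; LoadAt RX ROld 1;
    IfEq RX 0 (seqs [:: Const RUniq 1; LoadAt RY ROld 0; push_item 1 RY RY]) Skip]).

Lemma finish_ok s Gam L : heap_ok s Gam -> threads_ptr Gam (rg s ROld) L -> quiet s ->
  let n := if L is [:: T :: _] then 5 * tsize T else 0 in
  let out := if L is [:: T :: _] then encode_tree T else [::] in
  (L = [:: [::]] -> False) ->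
  out_state (run finish s) out n (L != [::]) (size L == 1).
Proof.
move=> ok tp [q1 q2 q3 q4] n out nL; rewrite [run _ _]/=.
case: L tp nL @n @out => [|st L] tp nL n out.
  by rewrite tp eqxx; exists Gam, [::]; split; rewrite ?q3 ?q4.
have [_ ST0] := ptr_bound ok tp.
have -> : (rg s ROld == 0) = false by lia.
have [i ei hi] := tp; have [p0 p1] := proj2 ok _ _ hi; rewrite -ei in p0 p1.
case: L p1 @n @out tp hi nL => [|st' L] p1 n out tp hi nL.
  rewrite p1 eqxx; case: st p0 @n @out tp hi nL => [|T st] p0 n out tp hi nL; first by case: nL.
  set s1 := setr _ RY _.
  have ok1 : heap_ok s1 Gam by [].
  have pY : ptr Gam (rg s1 RY) (ONode (T :: st)) by rewrite /s1 /= addn0.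
  have [|ok2 ip2] := @push_item_ok s1 Gam (INode T st) [::] 1 RY RY isT isT ok1 (conj erefl pY).
    by rewrite /= q3.
  exists (Gam ++ [:: OItem (INode T st) [::]]), [:: INode T st]; split=> //; first by rewrite /items_out /= cats0 q4.
  by rewrite /items_weight /= addn0.
have [_ SL0] := ptr_bound ok p1.
have -> : (hp s (rg s ROld + 1) == 0) = false by lia.
exists Gam, [::]; split=> //=; [by rewrite q4 /out; case: (st) | by rewrite /n; case: (st)].
Qed.

End Output.

(** * The parser *)

Section Program.
Variables (G : cfg) (k t : nat).

Definition init_part := init_code G k t.
Definition loop_part := main_body G k t.
Definition finish_part := finish G k t.
Definition output_part := out_body G k t.

Definition parser : program :=
  let o1 := clen init_part in let o2 := o1 + (3 + clen loop_part) in let o3 := o2 + clen finish_part in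
  compile 0 init_part ++ while_code o1 RFlag loop_part ++ compile o2 finish_part ++ while_code o3 RK output_part.

Hypothesis xlr : XLR G k.+1 t.

(** The output loop runs with weight [5 * tsize P] for a unique tree and 0 otherwise. The size
    hypothesis turns this into the factor [5 * c0], and the extra 1 accounts for the last test of
    the loop. *)
Lemma parser_correct c0 x :
  (forall P : ptree G, parse_tree_of x P -> (forall P', parse_tree_of x P' -> P' = P) ->
     tsize P <= c0 * (size x).+1) ->
  exists (acc uniq : bool) (out : seq nat),
    runs_within parser (encode_input x)
      ((clen init_part + (clen loop_part + 3) + clen finish_part + (clen output_part + 3) * (5 * c0 + 1)) * (size x).+1) acc uniq out /\
    (acc <-> exists P, parse_tree_of x P) /\
    (uniq <-> exists P, parse_tree_of x P /\ forall P', parse_tree_of x P' -> P' = P) /\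
    (forall P, parse_tree_of x P -> (forall P', parse_tree_of x P' -> P' = P) -> out = encode_tree P).
Proof.
move=> bound.
set o1 := clen init_part; set o2 := o1 + (3 + clen loop_part); set o3 := o2 + clen finish_part.
have h0 : code_at parser 0 parser by [].
have [h1 {}h0] := code_at_cat h0; rewrite size_compile add0n in h0.
have [h2 {}h0] := code_at_cat h0; rewrite size_while_code in h0.
have [h3 h4] := code_at_cat h0; rewrite size_compile -/o1 -/o2 -/o3 in h4.
have rep0 : represents (init_config (encode_input x)) (init_state x) by [].
have R1 := compile_correct (cf := init_config (encode_input x)) h1 erefl rep0.
have I1 := init_code_ok xlr x.
set s1 := run init_part _ in R1 I1; rewrite add0n in R1.
case: R1 => m1 l1 [pc1 rep1].
have [s2 [fl0 [n2 [u [v [ex sv [Gam [L [ok tp uL LP]]] q [_ _ eF]]]]] [m2 l2 [pc2 rep2]]]] :=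
  while_correct h2 pc1 rep1 I1 (main_body_ok xlr (x := x)).
have v0 : v = [::] by move: eF; rewrite fl0; case: (v).
move: ex LP; rewrite v0 cats0 => ex; rewrite -ex => {u ex} LP.
have {}LP st : st \in L <-> exists2 P, st = [:: P] & parse_tree_of x P.
  rewrite LP; apply: live_end; by rewrite lookahead_ofE la_nseq.
have nL : L = [:: [::]] -> False.
  by move=> e; have := proj1 (LP [::]); rewrite e mem_head => /(_ isT) [].
have [m3 l3 [pc3 rep3]] := compile_correct h3 pc2 rep2.
have := finish_ok ok tp q nL.
set N := match L with nil => 0 | _ => _ end; set out := match L with nil => [::] | _ => _ end => I3.
have [s4 [K0 [n4 [Gam4 [its [ok4 ip4 eo _ [ea eu]]]]] [m4 l4 [pc4 rep4]]]] :=
  while_correct (I := fun n s => out_state G k t s out n (L != [::]) (size L == 1)) h4 pc3 rep3 I3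
    (fun n s Is Ir => out_body_ok Is Ir).
(* The loop ends with a null [RK], while pointers to objects are positive, so no item is left and
   the whole output has been written. *)
have its0 : its = [::].
  case: its ip4 {eo} => // it its ip4; have [_] := ptr_bound ok4 ip4; by rewrite K0.
rewrite its0 cats0 in eo.
have uniqE P : parse_tree_of x P -> (forall P', parse_tree_of x P' -> P' = P) -> L = [:: [:: P]].
  move=> pP un; have : [:: P] \in L by apply/LP; exists P.
  have all1 st : st \in L -> st = [:: P] by move/LP => [P' -> /un ->].
  case: (L) uL all1 => [|st [|st' L']] //= uL all1; first by rewrite (all1 st) ?mem_head.
  move: uL; rewrite (all1 st) ?mem_head // (all1 st') ?inE ?eqxx ?orbT //.
have uniqE' : size L == 1 -> exists P, L = [:: [:: P]] /\ (parse_tree_of x P /\ forall P', parse_tree_of x P' -> P' = P).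
  case eL: L => [|st [|st' L']] // _.
  have [P eP pP] : exists2 P, st = [:: P] & parse_tree_of x P by apply/LP; rewrite eL mem_head.
  exists P; rewrite eP; split=> //; split=> // P' pP'.
  have : [:: P'] \in L by apply/LP; exists P'.
  by rewrite eL inE eP => /eqP [].
have boundN : N <= 5 * (c0 * (size x).+1).
  rewrite /N; case eL: L => [|[|T st] [|st' L']] //.
  have [|P [e [pP un]]] := uniqE'; first by rewrite eL.
  by move: e; rewrite eL => -[-> _]; rewrite leq_mul2l bound.
exists (L != [::]), (size L == 1), out; split; last split; [| | split].
- exists (m4 + (m3 + (m2 + m1))); split.
    apply: leq_trans (_ : (clen output_part + 3) * N.+1 + (clen finish_part + ((clen loop_part + 3) * (size x).+1 + clen init_part)) <= _).
      by rewrite !leq_add.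
    have : (clen output_part + 3) * N.+1 <= (clen output_part + 3) * (5 * c0 + 1) * (size x).+1.
      by rewrite -mulnA leq_mul2l; apply/orP; right; nia.
    move: ((clen output_part + 3) * N.+1) ((clen output_part + 3) * (5 * c0 + 1)) => y z; nia.
  rewrite !iterD; move: pc4 rep4; set cf := iter m4 _ _; cbv zeta => pc4 [r1 _ _ r4].
  have e0 : Defs.mem cf 0 = (L != [::]) by rewrite -ea -r1.
  have e1 : Defs.mem cf 1 = (size L == 1) by rewrite -eu -r1.
  split; last by rewrite e0 e1 r4 eo; case: (L != _); case: (size L == 1).
  (* The program counter is just past the end of the code, where the default instruction [IHalt] is
     found. *)
  rewrite /halted nth_default // pc4 /parser (size_cat (compile 0 init_part)) size_compile (size_cat (while_code _ _ _)) size_while_code.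
  rewrite (size_cat (compile _ finish_part)) size_compile size_while_code -/o1 -/o2 -/o3.
  by rewrite /o3 /o2 /o1; lia.
- split=> [nl|[P pP]].
    case eL: L nl => [|st L'] // _; have [P _ pP] : exists2 P, st = [:: P] & parse_tree_of x P.
      by apply/LP; rewrite eL mem_head.
    by exists P.
  have : [:: P] \in L by apply/LP; exists P.
  by case: (L).
- split=> [/uniqE' [P [_ h]]|[P [pP un]]]; first by exists P.
  by rewrite (uniqE P).
by move=> P pP un; rewrite /out (uniqE P pP un).
Qed.

End Program.

Theorem mainTheorem14 (k t : nat) (G : cfg) :
  XLR G k t ->
  exists (p : program) (C : nat),
    forall x : seq (Tm G),
      exists (acc uniq : bool) (out : seq nat),
        runs_within p (encode_input x) (C * (size x).+1) acc uniq out /\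
        (acc <-> exists P, parse_tree_of x P) /\
        (uniq <-> exists P, parse_tree_of x P /\
                    forall P', parse_tree_of x P' -> P' = P) /\
        (forall P, parse_tree_of x P ->
                   (forall P', parse_tree_of x P' -> P' = P) ->
                   out = encode_tree P).
Proof.
move=> /XLR_succ xlr; have [c0 size_bound] := unique_tree_size G.
by eexists; eexists => x; exact: (parser_correct xlr (size_bound x)).
Qed.
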